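(* (1) Let $1<p<\infty$. Then $\operatorname{dist}_{W^{1/p,p}}(\mathcal{E}_{d_1},\mathcal{E}_{d_2})=0$ for all $d_1,d_2\in\mathbb{Z}$. (2) Let $s>0$ and $1\le p<\infty$ with $sp>1$. Then there exist constants $C_{s,p},C'_{s,p}>0$ such that for all $d_1,d_2\in\mathbb{Z}$, $$C'_{s,p}|d_1-d_2|^s\le \operatorname{dist}_{W^{s,p}}(\mathcal{E}_{d_1},\mathcal{E}_{d_2})\le C_{s,p}|d_1-d_2|^s.$$
   Context: Let $s>0$, $1\le p<\infty$ with $sp\ge 1$. $W^{s,p}(\mathbb{S}^1;\mathbb{S}^1)$ is the set of $f\in W^{s,p}(\mathbb{S}^1;\mathbb{R}^2)$ with $|f|=1$ a.e. Such maps have a well-defined integer degree (the Brezis–Nirenberg degree): the unique extension of the topological degree of smooth maps that is continuous with respect to $W^{s,p}$ convergence (smooth maps are dense). For $d\in\mathbb{Z}$, $\mathcal{E}_d=\{f\in W^{s,p}(\mathbb{S}^1;\mathbb{S}^1):\deg f=d\}$. For $h\in W^{s,p}(\mathbb{S}^1;\mathbb{R}^2)$, $|h|_{W^{s,p}}=\|h-\fint_{\mathbb{S}^1}h\|_{W^{s,p}}$ for a fixed standard $W^{s,p}$ norm; when $0<s<1$ one may use the Gagliardo semi-norm $\left(\int_{\mathbb{S}^1}\int_{\mathbb{S}^1}\frac{|h(x)-h(y)|^p}{|x-y|^{1+sp}}dx\,dy\right)^{1/p}$. Then $d_{W^{s,p}}(f,g)=|f-g|_{W^{s,p}}$ and $\operatorname{dist}_{W^{s,p}}(\mathcal{E}_{d_1},\mathcal{E}_{d_2})=\inf_{f\in\mathcal{E}_{d_1}}\inf_{g\in\mathcal{E}_{d_2}}d_{W^{s,p}}(f,g)$.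 *)

(* Defs.v *)
From HB Require Import structures.
From mathcomp Require Import all_boot all_order all_algebra.
From mathcomp Require Import all_classical all_reals all_analysis.
Set Implicit Arguments. Unset Strict Implicit. Unset Printing Implicit Defensive.
Import Order.TTheory GRing.Theory Num.Theory numFieldNormedType.Exports.
Local Open Scope classical_set_scope.
Local Open Scope ring_scope.

(* S^1 is identified with R/Z; a map S^1 -> R^2 is represented by a function
   R -> R * R, of which only the values on [0,1] matter (the circle's
   periodicity enters through periodic test functions and the circle distance). *)

Section Sobolev.
Variable R : realType.
Local Notation mu := (@lebesgue_measure R).
Local Notation I01 := (`[0%R, 1%R]%classic : set R).

Definition en (a : R * R) : R := Num.sqrt (a.1 ^+ 2 + a.2 ^+ 2).

(* geodesic distance on the circle R/Z of length 1, for x, y in [0,1] *)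
Definition cdist (x y : R) : R := Num.min `|x - y| (1 - `|x - y|).

Definition smooth_fun (u : R -> R) : Prop :=
  forall (n : nat) (x : R), derivable (derive1n n u) x 1.
Definition periodic1 (u : R -> R) : Prop := forall x, u (x + 1) = u x.

Definition weak_deriv (u v : R -> R) : Prop :=
  forall phi : R -> R, smooth_fun phi -> periodic1 phi ->
    (\int[mu]_(x in I01) (u x * derive1 phi x)%:E =
     - \int[mu]_(x in I01) (v x * phi x)%:E)%E.

Definition sob_k (s : R) : nat := Num.truncn s.
Definition sob_sigma (s : R) : R := s - (sob_k s)%:R.

Definition pint (p : R) (h : R -> R * R) : \bar R :=
  \int[mu]_(x in I01) (powR (en (h x)) p)%:E.

Definition gagliardo (s p : R) (h : R -> R * R) : \bar R :=
  \int[mu]_(x in I01) \int[mu]_(y in I01)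
    (powR (en ((h x).1 - (h y).1, (h x).2 - (h y).2)) p
      / powR (cdist x y) (1 + s * p))%:E.

Definition sob_witness (s p : R) (h : R -> R * R) (g : nat -> R -> R * R) : Prop :=
  g 0%N = h /\
  (forall j : nat, (j <= sob_k s)%N ->
     measurable_fun I01 (fun x => (g j x).1) /\
     measurable_fun I01 (fun x => (g j x).2) /\
     (pint p (g j) < +oo)%E) /\
  (forall j : nat, (j < sob_k s)%N ->
     weak_deriv (fun x => (g j x).1) (fun x => (g j.+1 x).1) /\
     weak_deriv (fun x => (g j x).2) (fun x => (g j.+1 x).2)) /\
  (0 < sob_sigma s -> (gagliardo (sob_sigma s) p (g (sob_k s)) < +oo)%E).

(* standard W^{s,p} norm: sum_{j<=k} ||h^(j)||_{L^p}
   + [h^(k)]_{W^{sigma,p}} (Gagliardo seminorm, only if sigma > 0).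
   It is +oo if h is not in W^{s,p}(S^1;R^2). *)
Definition sob_norm_val (s p : R) (g : nat -> R -> R * R) : R :=
  \sum_(j < (sob_k s).+1) powR (fine (pint p (g j))) (1 / p) +
  (if 0 < sob_sigma s then powR (fine (gagliardo (sob_sigma s) p (g (sob_k s)))) (1 / p)
   else 0).

Definition Wnorm (s p : R) (h : R -> R * R) : \bar R :=
  ereal_inf [set N : \bar R | exists g, sob_witness s p h g /\ N = (sob_norm_val s p g)%:E].

Definition fsub (f g : R -> R * R) : R -> R * R :=
  fun x => ((f x).1 - (g x).1, (f x).2 - (g x).2).

Definition mean (h : R -> R * R) : R * R :=
  (Rintegral mu I01 (fun x => (h x).1), Rintegral mu I01 (fun x => (h x).2)).

Definition Wsemi (s p : R) (h : R -> R * R) : \bar R :=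
  Wnorm s p (fun x => ((h x).1 - (mean h).1, (h x).2 - (mean h).2)).

Definition smooth_S1_map (f : R -> R * R) : Prop :=
  smooth_fun (fun x => (f x).1) /\ smooth_fun (fun x => (f x).2) /\
  (forall x, f (x + 1) = f x) /\ (forall x, en (f x) = 1).

Definition has_degree (f : R -> R * R) (d : int) : Prop :=
  exists theta : R -> R, continuous theta /\
    (forall x, f x = (cos (theta x), sin (theta x))) /\
    theta 1 - theta 0 = 2 * pi * d%:~R.

Definition WS1 (s p : R) (f : R -> R * R) : Prop :=
  (Wnorm s p f < +oo)%E /\ {ae mu, forall x, I01 x -> en (f x) = 1}.

(* E_d: maps of Brezis--Nirenberg degree d, i.e. W^{s,p}-limits of smooth
   S^1-valued maps of degree d (the degree being the unique W^{s,p}-continuous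
   extension of the degree of smooth maps, which are dense). *)
Definition Edeg (s p : R) (d : int) : set (R -> R * R) :=
  [set f | WS1 s p f /\
     exists fn : nat -> R -> R * R,
       (forall n, smooth_S1_map (fn n) /\ has_degree (fn n) d) /\
       (forall eps : R, 0 < eps -> exists N : nat, forall n : nat, (N <= n)%N ->
          (Wnorm s p (fsub f (fn n)) <= eps%:E)%E)].

Definition distW (s p : R) (d1 d2 : int) : \bar R :=
  ereal_inf [set Wsemi s p (fsub f g) | f in Edeg s p d1 & g in Edeg s p d2].
End Sobolev.

(* Main.v *)
(* Write smooth S^1-valued maps as exp(i a).

   Lower bound.  If f and g have degrees differing by n, the angle difference runs over an interval
   of length 2 pi n, so |f - g| alternates at least n times between 0 and 2.  Choosing the component
   of f - g and grouping consecutive zeros into blocks, Rolle's theorem makes a derivative of order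
   below s oscillate on each block of length l by at least l to the power minus that order; a
   Poincare or Morrey inequality turns this into an energy at least c l^(1 - s p) per block.  As the
   lengths add up to at most 1, convexity gives a total of at least c n^(s p).  A general witness of
   f - g is compared with smooth approximations up to an arbitrarily small error.

   Upper bounds.  Let dl increase by pi over a period and be constant near the integers, and put
   D x = +- dl(n x).  With a common phase m, constant where D varies, exp(i(m + D)) and
   exp(i(m - D)) have the two prescribed degrees and differ by (0, 2 sin D) on [0,1].  For a fixed
   dl this scales like n^s.  When s p = 1, take dl' proportional to 1 / (|x - 1/2| + eps): then
   sin dl is, on each period, a function of log(|x - 1/2| + eps) with Lipschitz constant of order
   1 / ln(1/eps), so its energy is of order ln(1/eps)^(1 - p), which tends to 0. *)
Require Import Defs.
From HB Require Import structures.
From mathcomp Require Import all_boot all_order all_algebra.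
From mathcomp Require Import all_classical all_reals all_analysis.
From mathcomp Require Import measurable_realfun ring lra zify.
Import Order.TTheory GRing.Theory Num.Theory numFieldNormedType.Exports.
Local Open Scope classical_set_scope.
Local Open Scope ring_scope.
Set Implicit Arguments. Unset Strict Implicit. Unset Printing Implicit Defensive.

(** * Smooth functions of one variable *)

(** The norm of f - g is an infimum over witnesses, that is, over families of weak derivatives,
    while angles are given only for the smooth approximations. So zeros and peaks are located on the
    approximations, but energy is measured on the witness, and for k >= 1 the two meet only in
    integrals: over every interval, the witness of order k integrates to an increment of the
    classical derivative of order k - 1. A block is therefore an interval over which this increment
    is 0 in total and large on a part. Only k = 0, where s p > 1 reads sg > 1/p, calls for pointwise
    bounds. The mean subtracted in the distance is a constant, invisible to increments.

    At the critical exponent the energy is estimated for one period of sin D at a time. Such a piece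
    vanishes near 0 and 1, so that the circle distance is comparable to |x - y| where it matters.
    Adding n pieces costs a constant that depends on n, but n is fixed before eps tends to 0. The
    L^p part of the norm is controlled by the Gagliardo energy of the centred map. *)

Section Smooth.
Variable R : realType.
Implicit Types (f g : R -> R) (n : nat).

(* A record rather than a bare Prop, so that [apply] does not unfold it. *)
Record has_drv f f' : Prop := HasDrv { has_drvE : forall x : R, is_derive x (1 : R) f (f' x) }.

(** Finite order allows induction: the product, chain and quotient rules express the derivative
    through the function itself, which is then used one order lower. *)
Record Cn n f : Prop :=
  CnI { CnE : forall k (x : R), (k < n)%N -> derivable (derive1n k f) x 1 }.

Lemma has_drv_ex f f' x : has_drv f f' -> derivable f x 1.
Proof. by case=> /(_ x) [+ _]. Qed.

Lemma has_drv_val f f' : has_drv f f' -> derive1 f = f'.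
Proof. by case=> h; apply/funext => x; rewrite derive1E; have [_ ->] := h x. Qed.

Lemma has_drv_cont f f' : has_drv f f' -> continuous f.
Proof.
move=> h x; apply: differentiable_continuous.
by apply/derivable1_diffP; exact: has_drv_ex h.
Qed.

Lemma has_drvP f : (forall x, derivable f x 1) -> has_drv f (derive1 f).
Proof. by move=> h; split=> x; apply: DeriveDef; [exact: h|rewrite derive1E]. Qed.

Lemma smooth_funP f : smooth_fun f <-> forall n, Cn n f.
Proof.
split=> [h n|h n x]; first by split=> k x _; exact: h.
exact: (CnE (h n.+1)).
Qed.

Lemma Cn0 f : Cn 0 f. Proof. by split. Qed.

Lemma CnS n f f' : has_drv f f' -> Cn n f' -> Cn n.+1 f.
Proof.
move=> h h'; split=> -[|k] x kn; first exact: has_drv_ex h.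
by rewrite derive1Sn (has_drv_val h); exact: (CnE h').
Qed.

Lemma Cn_drv n f : Cn n.+1 f -> has_drv f (derive1 f) /\ Cn n (derive1 f).
Proof.
case=> h; split; first by apply: has_drvP => x; exact: (h 0%N).
by split=> k x kn; rewrite -derive1Sn; exact: h.
Qed.

Lemma Cn_le n f m : (m <= n)%N -> Cn n f -> Cn m f.
Proof. by move=> mn [h]; split=> k x km; apply: h; exact: leq_trans mn. Qed.

Lemma has_drvD f g f' g' : has_drv f f' -> has_drv g g' ->
  has_drv (fun x => f x + g x) (fun x => f' x + g' x).
Proof. by case=> hf [hg]; split=> x; have := hf x; have := hg x => ? ?; exact: is_deriveD. Qed.

Lemma has_drvN f f' : has_drv f f' -> has_drv (fun x => - f x) (fun x => - f' x).
Proof. by case=> hf; split=> x; have := hf x => ?; exact: is_deriveN. Qed.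

Lemma has_drvM f g f' g' : has_drv f f' -> has_drv g g' ->
  has_drv (fun x => f x * g x) (fun x => f' x * g x + f x * g' x).
Proof.
case=> hf [hg]; split=> x; have := hf x; have := hg x => ? ?.
apply: is_derive_eq; rewrite addrC; congr (_ + _).
by rewrite /GRing.scale /= mulrC.
Qed.

Lemma has_drv_cst (c : R) : has_drv (fun=> c) (fun=> 0).
Proof. by split=> x; exact: is_derive_cst. Qed.

Lemma has_drv_id : has_drv id (fun=> 1).
Proof. by split=> x; exact: is_derive_id. Qed.

Lemma has_drv_comp f g f' g' : has_drv f f' -> has_drv g g' ->
  has_drv (fun x => f (g x)) (fun x => f' (g x) * g' x).
Proof.
case=> hf [hg]; split=> x; have := hf (g x); have := hg x => ? ?.
exact: is_derive1_comp.
Qed.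

Lemma has_drvV f f' : (forall x, f x != 0) -> has_drv f f' ->
  has_drv (fun x => (f x)^-1) (fun x => - f' x * ((f x)^-1 * (f x)^-1)).
Proof.
move=> f0 [hf]; split=> x; have := hf x => ?; have := is_deriveV (f0 x) (hf x).
move=> h; apply: is_derive_eq.
by rewrite /GRing.scale /= expr2 invfM; ring.
Qed.

Lemma Cn_cst n c : Cn n (fun=> c : R).
Proof.
elim: n c => [|n IH] c; [exact: Cn0|]; exact: CnS (has_drv_cst c) (IH 0).
Qed.

Lemma Cn_id n : Cn n (id : R -> R).
Proof. by case: n => [|n]; [exact: Cn0|exact: CnS has_drv_id (Cn_cst n 1)]. Qed.

Lemma CnD n f g : Cn n f -> Cn n g -> Cn n (fun x => f x + g x).
Proof.
elim: n f g => [|n IH] f g; first by split.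
move=> /Cn_drv[f1 f2] /Cn_drv[g1 g2].
exact: CnS (has_drvD f1 g1) (IH _ _ f2 g2).
Qed.

Lemma CnN n f : Cn n f -> Cn n (fun x => - f x).
Proof.
elim: n f => [|n IH] f; first by split.
move=> /Cn_drv[f1 f2].
exact: CnS (has_drvN f1) (IH _ f2).
Qed.

Lemma CnM n f g : Cn n f -> Cn n g -> Cn n (fun x => f x * g x).
Proof.
elim: n f g => [|n IH] f g hf hg; first exact: Cn0.
have [f1 f2] := Cn_drv hf; have [g1 g2] := Cn_drv hg.
have fn := Cn_le (leqnSn n) hf; have gn := Cn_le (leqnSn n) hg.
apply: CnS (has_drvM f1 g1) _; apply: CnD; exact: IH.
Qed.

Lemma Cn_comp n f g : Cn n f -> Cn n g -> Cn n (fun x => f (g x)).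
Proof.
elim: n f g => [|n IH] f g hf hg; first exact: Cn0.
have [f1 f2] := Cn_drv hf; have [g1 g2] := Cn_drv hg.
have gn := Cn_le (leqnSn n) hg.
by apply: CnS (has_drv_comp f1 g1) _; apply: CnM => //; exact: IH.
Qed.

Lemma CnV n f : (forall x, f x != 0) -> Cn n f -> Cn n (fun x => (f x)^-1).
Proof.
move=> f0; elim: n => [|n IH] hf; first exact: Cn0.
have [f1 f2] := Cn_drv hf; have fn := Cn_le (leqnSn n) hf.
apply: CnS (has_drvV f0 f1) _; apply: CnM; first exact: CnN.
by apply: CnM; exact: IH.
Qed.

Lemma smooth_drv f : smooth_fun f -> has_drv f (derive1 f).
Proof. by move=> /smooth_funP /(_ 1%N) /Cn_drv[]. Qed.

Lemma smooth_drvn f n : smooth_fun f -> has_drv (derive1n n f) (derive1n n.+1 f).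
Proof. by move=> h; apply: (@has_drvP (derive1n n f)) => x; exact: h. Qed.

Lemma smooth_derive1 f : smooth_fun f -> smooth_fun (derive1 f).
Proof. by move=> h n x; rewrite -derive1Sn; exact: h. Qed.

Lemma smooth_derive1n f n : smooth_fun f -> smooth_fun (derive1n n f).
Proof. by move=> h; elim: n => [//|n IH]; exact: smooth_derive1 IH. Qed.

Lemma smooth_cont f : smooth_fun f -> continuous f.
Proof. by move=> /smooth_drv; exact: has_drv_cont. Qed.

Lemma smooth_prim f f' : has_drv f f' -> smooth_fun f' -> smooth_fun f.
Proof.
move=> h /smooth_funP h'; apply/smooth_funP => -[|n]; [exact: Cn0|exact: CnS h (h' n)].
Qed.

Lemma smooth_cst c : smooth_fun (fun=> c : R).
Proof. by apply/smooth_funP => n; exact: Cn_cst. Qed.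

Lemma smooth_id : smooth_fun (id : R -> R).
Proof. by apply/smooth_funP => n; exact: Cn_id. Qed.

Lemma smoothD f g : smooth_fun f -> smooth_fun g -> smooth_fun (fun x => f x + g x).
Proof. by move=> /smooth_funP hf /smooth_funP hg; apply/smooth_funP => n; exact: CnD. Qed.

Lemma smoothN f : smooth_fun f -> smooth_fun (fun x => - f x).
Proof. by move=> /smooth_funP hf; apply/smooth_funP => n; exact: CnN. Qed.

Lemma smoothB f g : smooth_fun f -> smooth_fun g -> smooth_fun (fun x => f x - g x).
Proof. by move=> hf hg; exact: (smoothD hf (smoothN hg)). Qed.

Lemma smoothM f g : smooth_fun f -> smooth_fun g -> smooth_fun (fun x => f x * g x).
Proof. by move=> /smooth_funP hf /smooth_funP hg; apply/smooth_funP => n; exact: CnM. Qed.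

Lemma smooth_comp f g : smooth_fun f -> smooth_fun g -> smooth_fun (fun x => f (g x)).
Proof. by move=> /smooth_funP hf /smooth_funP hg; apply/smooth_funP => n; exact: Cn_comp. Qed.

Lemma smoothV f : (forall x, f x != 0) -> smooth_fun f -> smooth_fun (fun x => (f x)^-1).
Proof. by move=> f0 /smooth_funP hf; apply/smooth_funP => n; exact: CnV. Qed.

Lemma smooth_expR : smooth_fun (@expR R).
Proof.
apply/smooth_funP; elim=> [|n IH]; first exact: Cn0.
by apply: CnS IH; split=> x; exact: is_derive_expR.
Qed.

Lemma Cn_sincos n : Cn n (@sin R) /\ Cn n (@cos R).
Proof.
elim: n => [|n [IHs IHc]]; first by split; exact: Cn0.
split; first by apply: CnS IHc; split=> x; exact: is_derive_sin.
by apply: CnS (CnN IHs); split=> x; exact: is_derive_cos.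
Qed.

Lemma smooth_sin : smooth_fun (@sin R).
Proof. by apply/smooth_funP => n; exact: (Cn_sincos n).1. Qed.

Lemma smooth_cos : smooth_fun (@cos R).
Proof. by apply/smooth_funP => n; exact: (Cn_sincos n).2. Qed.

Lemma smooth_ln f : (forall x, 0 < f x) -> smooth_fun f -> smooth_fun (fun x => ln (f x)).
Proof.
move=> f0 hf; apply: (@smooth_prim _ (fun x => (f x)^-1 * derive1 f x)).
  split=> x; have h1 := is_derive1_ln (f0 x); have h2 := has_drvE (smooth_drv hf) x.
  exact: is_derive1_comp.
apply: smoothM (smooth_derive1 hf); apply: smoothV => // x; exact: lt0r_neq0.
Qed.

Lemma has_drv_MVT f f' (a b : R) : has_drv f f' -> a <= b ->
  exists2 c, a <= c <= b & f b - f a = f' c * (b - a).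
Proof.
move=> h ab; have := @MVT_segment R f f' a b ab.
case=> [x _| |c]; first exact: (has_drvE h).
  by apply: continuous_subspaceT; exact: has_drv_cont h.
by rewrite in_itv /= => ? ?; exists c.
Qed.

Lemma has_drv0_cst f : has_drv f (fun=> 0) -> forall x y, f x = f y.
Proof.
move=> h x y; wlog xy : x y / x <= y.
  by move=> W; case/orP: (le_total x y) => [/W//|/W <-].
have [c _] := has_drv_MVT h xy; rewrite mul0r => /eqP; rewrite subr_eq0.
by move=> /eqP.
Qed.

(* This family is closed under differentiation (see [flatexp_drv]), which gives smoothness at 0. *)
Definition flatexp (k : nat) (x : R) : R :=
  if 0 < x then x^-1 ^+ k * expR (- x^-1) else 0.

Lemma flatexp_gt0E k x : 0 < x -> flatexp k x = x^-1 ^+ k * expR (- x^-1).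
Proof. by rewrite /flatexp => ->. Qed.

Lemma flatexp_le0E k x : x <= 0 -> flatexp k x = 0.
Proof. by rewrite /flatexp ltNge => ->. Qed.

Lemma flatexp_ge0 k x : 0 <= flatexp k x.
Proof.
rewrite /flatexp; case: ifP => // x0.
by rewrite mulr_ge0 ?expR_ge0 // exprn_ge0 // invr_ge0 ltW.
Qed.

(** One term of the exponential series bounds x^-(k+2) by (k+2)! exp(1/x). The resulting quadratic
    decay makes the difference quotient at 0 tend to 0. *)
Lemma flatexp_le (k : nat) (x : R) : flatexp k x <= x ^+ 2 * (k.+2`!)%:R.
Proof.
have [x0|x0] := leP x 0.
  by rewrite flatexp_le0E // mulr_ge0 // sqr_ge0.
rewrite /flatexp x0.
have xi : 0 < x^-1 by rewrite invr_gt0.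
have f0 : (0 : R) < (k.+2)`!%:R by rewrite ltr0n fact_gt0.
have h : x^-1 ^+ k.+2 <= (k.+2)`!%:R * expR x^-1.
  rewrite mulrC -ler_pdivrMr //; have := expR_ge1Dxn k.+1 (ltW xi).
  by apply: le_trans; rewrite lerDr.
rewrite expRN ler_pdivrMr ?expR_gt0 // -mulrA.
rewrite -(ler_pM2l (exprn_gt0 2 xi)) -exprD add2n.
by rewrite (mulrA (x^-1 ^+ 2)) -exprMn mulVf ?gt_eqF // expr1n mul1r.
Qed.

Lemma is_derive_subst (f : R -> R) (x a b : R) :
  is_derive x (1 : R) f a -> a = b -> is_derive x (1 : R) f b.
Proof. by move=> h <-. Qed.

Lemma flatexp_drv k :
  has_drv (flatexp k) (fun x => flatexp k.+2 x - k%:R * flatexp k.+1 x).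
Proof.
split=> x; have [x0|x0|->] := ltgtP x 0.
- rewrite !flatexp_le0E ?ltW // mulr0 subr0.
  apply: (@near_eq_is_derive _ _ _ (cst 0)).
  near do (apply/esym/flatexp_le0E/ltW).
  exact: lt_nbhsl.
- rewrite !flatexp_gt0E //.
  have hx : x != 0 by rewrite gt_eqF.
  have h1 : is_derive x (1 : R) (fun x : R => x^-1) (- x^-1 ^+ 2).
    apply: (is_derive_subst (is_deriveV hx (is_derive_id x (1:R)))).
    by rewrite /GRing.scale /= exprVn mulr1.
  have h2 : is_derive x (1 : R) (fun x : R => - x^-1) (x^-1 ^+ 2).
    by apply: (is_derive_subst (is_deriveN h1)); rewrite opprK.
  have h3 := @is_derive1_comp R expR (fun x : R => - x^-1) x _ _ (is_derive_expR (- x^-1)) h2.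
  have h4 := is_deriveX k h1.
  have h5 := is_deriveM h4 h3.
  have h6 : \forall y \near x, ((fun x : R => x^-1) ^+ k * (expR \o (fun x : R => - x^-1))) y
      = flatexp k y.
    near=> y; rewrite flatexp_gt0E; first by rewrite mulrfctE exprfctE.
    by near: y; exact: lt_nbhsr.
  apply: (is_derive_subst (near_eq_is_derive h6 h5)).
  rewrite exprfctE /GRing.scale /=.
  case: k h4 h5 h6 => [|k] _ _ _ /=; first by ring.
  by rewrite !exprS; ring.
- have E0 : flatexp k 0 = 0 by exact: flatexp_le0E.
  rewrite !flatexp_le0E // mulr0 subr0.
  suff H : h^-1 *: (flatexp k (h *: (1:R) + 0) - flatexp k 0) @[h --> 0^'] --> (0 : R).
    by apply: DeriveDef; [apply/cvg_ex; exists 0|apply/cvg_lim].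
  apply/cvgr0Pnorm_lt => e e0.
  near=> h.
  rewrite E0 subr0 addr0 /GRing.scale /= mulr1 normrM normfV.
  have h0 : h != 0 by near: h; exact: nbhs_dnbhs_neq.
  rewrite mulrC ltr_pdivrMr ?normr_gt0 // ger0_norm ?flatexp_ge0 //.
  apply: le_lt_trans (flatexp_le _ _) _.
  rewrite -real_normK ?num_real // expr2 -mulrA mulrC.
  rewrite ltr_pM2r ?normr_gt0 // mulrC -ltr_pdivlMl ?ltr0n ?fact_gt0 //.
  near: h; apply: dnbhs0_lt.
  by rewrite mulr_gt0 // invr_gt0 ltr0n fact_gt0.
Unshelve. all: by end_near. Qed.

Lemma smooth_flatexp k : smooth_fun (flatexp k).
Proof.
apply/smooth_funP => n; elim: n k => [|n IH] k; first exact: Cn0.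
apply: CnS (flatexp_drv k) _; apply: CnD => //; apply: CnN; apply: CnM => //.
exact: Cn_cst.
Qed.

Lemma flatexp_gt0 k x : 0 < x -> 0 < flatexp k x.
Proof. by move=> x0; rewrite flatexp_gt0E // mulr_gt0 ?expR_gt0 // exprn_gt0 // invr_gt0. Qed.

Lemma flatexp0_le1 x : flatexp 0 x <= 1.
Proof.
rewrite /flatexp; case: ifP => // x0.
by rewrite expr0 mul1r expR_le1 oppr_le0 invr_ge0 ltW.
Qed.

End Smooth.

(** * Primitives of continuous functions *)

Section Primitive.
Variable R : realType.
Local Notation mu := (@lebesgue_measure R).

Lemma cont_integrable (b : R -> R) (x y : R) : continuous b ->
  mu.-integrable `[x, y] (EFin \o b).
Proof.
move=> cb; apply: continuous_compact_integrable; first exact: segment_compact.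
exact: continuous_subspaceT.
Qed.

(** The integral from 0 is defined by cases on the sign of x. Near a given x it equals, up to a
    constant, the integral from a point a below both x and 0, to which the fundamental theorem
    applies. *)
Lemma primitive_ex (b : R -> R) : continuous b ->
  exists B : R -> R, has_drv B b /\ B 0 = 0.
Proof.
move=> cb.
pose F (a x : R) : R := \int[mu]_(t in `[a, x]) b t.
have Fsplit (a x y : R) : a <= x -> x <= y -> F a y - F a x = F x y.
  move=> ax xy; rewrite /F Rintegral_itvB ?bnd_simp //; last exact: cont_integrable.
  rewrite Rintegral_itv_obnd_cbnd //.
  apply: integrableS (cont_integrable x y cb) => //.
  by apply: subset_itvr; rewrite bnd_simp.
pose B x := if 0 <= x then F 0 x else - F x 0.
have BE a x : a < 0 -> a < x -> B x = F a x - F a 0.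
  move=> a0 ax; rewrite /B; case: leP => x0; first by rewrite Fsplit // ltW.
  by rewrite -(Fsplit a x 0) ?opprB // ltW.
exists B; split; last first.
  by rewrite (BE (-1)) ?subrr // ltrN10.
split=> x; pose a := Num.min x 0 - 1.
have [m0 mx] : Num.min x 0 <= 0 /\ Num.min x 0 <= x by rewrite !ge_min !lexx orbT.
have a0 : a < 0 by rewrite /a; lra.
have ax : a < x by rewrite /a; lra.
have xu : x < x + 1 by rewrite ltrDl.
have [d1 d2] := @continuous_FTC1_closed R b a x (x + 1) xu (cont_integrable _ _ cb) ax (cb x).
have h : is_derive x (1:R) (F a) (b x) by split; [exact: d1|rewrite -derive1E; exact: d2].
have h' := is_deriveB h (is_derive_cst (F a 0) x (1 : R)).
apply: (is_derive_subst (near_eq_is_derive _ h')); last by rewrite subr0.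
near=> y; apply/esym/BE => //.
by near: y; exact: lt_nbhsr.
Unshelve. all: by end_near. Qed.

End Primitive.

(** * Integration *)

Section Integration.
Variable R : realType.
Local Notation mu := (@lebesgue_measure R).

(* The integral of a nonnegative function is a supremum over simple functions, so no
   measurability is needed. *)
Lemma le_int (D : set R) (f g : R -> \bar R) :
  (forall x, D x -> 0 <= f x)%E -> (forall x, D x -> f x <= g x)%E ->
  (\int[mu]_(x in D) f x <= \int[mu]_(x in D) g x)%E.
Proof.
move=> f0 fg; rewrite !ge0_integralE //; last first.
  by move=> x Dx; exact: le_trans (f0 x Dx) (fg x Dx).
apply: le_ereal_sup => _ [h hf <-]; exists h => // x.
apply: le_trans (hf x) _; rewrite /patch; case: ifP => // /set_mem; exact: fg.
Qed.

Lemma le_int_mono (A B : set R) (f : R -> \bar R) :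
  (forall x, B x -> 0 <= f x)%E -> A `<=` B ->
  (\int[mu]_(x in A) f x <= \int[mu]_(x in B) f x)%E.
Proof.
move=> f0 AB; rewrite integral_mkcond [leRHS]integral_mkcond.
apply: le_int => x _; rewrite /patch.
  by case: ifP => // /set_mem /AB; exact: f0.
case: ifPn => [/set_mem /AB /mem_set ->//|_].
by case: ifP => // /set_mem; exact: f0.
Qed.

Lemma continuous_measurable (f : R -> R) (D : set R) :
  measurable D -> continuous f -> measurable_fun D f.
Proof.
move=> mD cf; apply: (measurable_funS _ (@subsetT _ D)) => //.
exact: continuous_measurable_fun.
Qed.

Lemma FTC2 (f F : R -> R) (a b : R) : a <= b ->
  (forall x, a <= x <= b -> is_derive x (1 : R) F (f x)) ->
  {within `[a, b], continuous f} ->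
  (\int[mu]_(x in `[a, b]) (f x)%:E = (F b - F a)%:E)%E.
Proof.
rewrite le_eqVlt => /orP[/eqP <- _ _|ab dF cf].
  by rewrite set_itv1 integral_set1 subrr.
have Fc x : a <= x <= b -> {for x, continuous F}.
  move=> /dF dFx; apply: differentiable_continuous.
  by apply/derivable1_diffP; case: dFx.
rewrite EFinB; apply: continuous_FTC2 => //.
- split.
  + by move=> x; rewrite in_itv /= => /andP[/ltW ax /ltW xb]; case: (dF x); rewrite ?ax.
  + by apply: cvg_at_right_filter; apply: Fc; rewrite lexx ltW.
  + by apply: cvg_at_left_filter; apply: Fc; rewrite lexx ltW.
- move=> x; rewrite in_itv /= => /andP[/ltW ax /ltW xb].
  by rewrite derive1E; case: (dF x) => //; rewrite ax.
Qed.

Lemma has_drv_FTC2 (f F : R -> R) (a b : R) : a <= b -> has_drv F f -> continuous f ->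
  (\int[mu]_(x in `[a, b]) (f x)%:E = (F b - F a)%:E)%E.
Proof.
move=> ab [h] cf; apply: FTC2 => //; exact: continuous_subspaceT.
Qed.

(** Monotone convergence along growing segments, with the fundamental theorem on each: this covers
    integrands singular at an end of the domain as well as unbounded domains. *)
Lemma int_antider_le (f F : R -> R) (a b : nat -> R) (M : R) :
  (forall n, a n <= b n) -> (forall n, a n.+1 <= a n) -> (forall n, b n <= b n.+1) ->
  (forall n x, a n <= x <= b n -> [/\ 0 <= f x, is_derive x (1 : R) F (f x) &
      {for x, continuous f}]) ->
  (forall n, F (b n) - F (a n) <= M) ->
  measurable_fun (\bigcup_n `[a n, b n]%classic) f /\
  (\int[mu]_(x in \bigcup_n `[a n, b n]%classic) (f x)%:E <= M%:E)%E.
Proof.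
move=> ab da ib H HM.
have cw n : {within `[a n, b n], continuous f}.
  by apply: continuous_in_subspaceT => x /set_mem /= xi; case: (H n x xi).
have mf n : measurable_fun (`[a n, b n]%classic : set R) f.
  exact: subspace_continuous_measurable_fun.
split; first by apply/measurable_fun_bigcup.
have h : (\int[mu]_(x in `[a i, b i]) (f x)%:E)%E @[i --> \oo] -->
    (\int[mu]_(x in \bigcup_i `[a i, b i]%classic) (f x)%:E)%E.
  pose I n : set R := `[a n, b n]%classic.
  have h1 : {homo I : n m / (n <= m)%N >-> (n <= m)%O}.
    apply/nondecreasing_seqP => n; apply/subsetPset; apply: subset_itv;
    by rewrite bnd_simp.
  have h2 n : measurable (I n) by exact: measurable_itv.
  have h3 n : measurable_fun (I n) (EFin \o f) by apply/measurable_EFinP; exact: mf.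
  have h4 n x : I n x -> (0 <= (EFin \o f) x)%E.
    by rewrite /I /= in_itv => xi; rewrite lee_fin; case: (H n x xi).
  exact: (ge0_nondecreasing_set_cvg_integral (mu := mu) h1 h2 h3 h4).
rewrite -(cvg_lim _ h) //; apply: lime_le; first by apply/cvg_ex; eexists; exact: h.
near=> n.
have -> : (\int[mu]_(x in `[a n, b n]) (f x)%:E = (F (b n) - F (a n))%:E)%E.
  by apply: FTC2 => // x xi; case: (H n x xi).
by rewrite lee_fin.
Unshelve. all: by end_near. Qed.

Lemma bigcup_itvP (a b : nat -> R) x :
  (\bigcup_n `[a n, b n]%classic) x <-> exists n, a n <= x <= b n.
Proof.
split=> [[n _ /= xi]|[n xi]]; first by exists n.
by exists n => //=; rewrite in_itv.
Qed.

(** The shell splits into two mirror halves, whence the factor 2. Letting [al] decrease to 0 gives a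
    punctured neighbourhood of c, letting [be] grow to infinity gives the complement of a
    neighbourhood. *)
Lemma int_shell_le (g G : R -> R) (c : R) (al be : nat -> R) (M : R) (D : set R) :
  (forall n, 0 < al n) -> (forall n, al n <= be n) ->
  (forall n, al n.+1 <= al n) -> (forall n, be n <= be n.+1) ->
  (forall t, 0 < t -> [/\ 0 <= g t, is_derive t (1 : R) G (g t) &
      {for t, continuous g}]) ->
  (forall n, G (be n) - G (al n) <= M) ->
  (forall y, D y <-> exists n, al n <= `|y - c| <= be n) ->
  [/\ measurable D, measurable_fun D (fun y => g `|y - c|) &
  (\int[mu]_(y in D) (g `|y - c|)%:E <= (2 * M)%:E)%E].
Proof.
move=> al0 ab da ib H HM DE.
pose D1 := \bigcup_n `[c + al n, c + be n]%classic.
pose D2 := \bigcup_n `[c - be n, c - al n]%classic.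
have mD1 : measurable D1 by apply: bigcup_measurable.
have mD2 : measurable D2 by apply: bigcup_measurable.
have [mf1 i1] : measurable_fun D1 (fun y => g (y - c)) /\
   (\int[mu]_(y in D1) (g (y - c))%:E <= M%:E)%E.
  apply: (@int_antider_le _ (fun y => G (y - c))).
  - by move=> n; rewrite lerD2l.
  - by move=> n; rewrite lerD2l.
  - by move=> n; rewrite lerD2l.
  - move=> n x /andP[x1 x2].
    have t0 : 0 < x - c by rewrite subr_gt0; apply: lt_le_trans x1; rewrite ltrDl.
    have [g0 dG cg] := H _ t0; split => //.
      have h := is_deriveB (is_derive_id x (1 : R)) (is_derive_cst c x (1 : R)).
      apply: (is_derive_subst (@is_derive1_comp R G (fun y => y - c) x _ _ dG h)).
      by rewrite subr0 mulr1.
    apply: (@continuous_comp _ _ _ (fun y : R => y - c) g) => //.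
    by apply: cvgB; [exact: cvg_id|exact: cvg_cst].
  - by move=> n; rewrite !(addrC c) !addrK.
have [mf2 i2] : measurable_fun D2 (fun y => g (c - y)) /\
   (\int[mu]_(y in D2) (g (c - y))%:E <= M%:E)%E.
  apply: (@int_antider_le _ (fun y => - G (c - y))).
  - by move=> n; rewrite lerD2l lerN2.
  - by move=> n; rewrite lerD2l lerN2.
  - by move=> n; rewrite lerD2l lerN2.
  - move=> n x /andP[x1 x2].
    have t0 : 0 < c - x by rewrite subr_gt0; apply: le_lt_trans x2 _; rewrite ltrBlDr ltrDl.
    have [g0 dG cg] := H _ t0; split => //.
      have h := is_deriveB (is_derive_cst c x (1 : R)) (is_derive_id x (1 : R)).
      apply: (is_derive_subst (is_deriveN (@is_derive1_comp R G (fun y => c - y) x _ _ dG h))).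
      by rewrite sub0r mulrN1 opprK.
    apply: (@continuous_comp _ _ _ (fun y : R => c - y) g) => //.
    by apply: cvgB; [exact: cvg_cst|exact: cvg_id].
  - by move=> n; rewrite !subKr opprK addrC.
have E1 y : D1 y -> `|y - c| = y - c.
  move=> /bigcup_itvP[n /andP[h _]]; rewrite ger0_norm // subr_ge0.
  by apply: le_trans h; rewrite lerDl ltW.
have E2 y : D2 y -> `|y - c| = c - y.
  move=> /bigcup_itvP[n /andP[_ h]]; rewrite distrC ger0_norm // subr_ge0.
  by apply: le_trans h _; rewrite lerBlDr lerDl ltW.
have DU : D = D1 `|` D2.
  apply/seteqP; split => y.
    move=> /DE[n]; case: (leP c y) => cy.
      rewrite ger0_norm ?subr_ge0 // => h; left; apply/bigcup_itvP; exists n.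
      by case/andP: h => h1 h2; apply/andP; split; lra.
    rewrite distrC gtr0_norm ?subr_gt0 // => h; right; apply/bigcup_itvP; exists n.
    by case/andP: h => h1 h2; apply/andP; split; lra.
  case=> h; apply/DE; move: (h) => /bigcup_itvP[n /andP[h1 h2]]; exists n.
    by rewrite E1 //; apply/andP; split; lra.
  by rewrite E2 //; apply/andP; split; lra.
have mg1 : measurable_fun D1 (fun y => g `|y - c|).
  by apply: eq_measurable_fun mf1 => y /set_mem /E1 ->.
have mg2 : measurable_fun D2 (fun y => g `|y - c|).
  by apply: eq_measurable_fun mf2 => y /set_mem /E2 ->.
split; first by rewrite DU; exact: measurableU.
  by rewrite DU; apply/measurable_funU.
rewrite DU ge0_integral_setU //.
- rewrite (_ : 2 * M = M + M); last by ring.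
  rewrite EFinD; apply: leeD.
    by apply: le_trans i1; rewrite le_eqVlt; apply/orP; left; apply/eqP;
       apply: eq_integral => y /set_mem /E1 ->.
  by apply: le_trans i2; rewrite le_eqVlt; apply/orP; left; apply/eqP;
       apply: eq_integral => y /set_mem /E2 ->.
- by apply/measurable_EFinP/measurable_funU.
- move=> y h; rewrite lee_fin.
  have [n /andP[h1 h2]] : exists n, al n <= `|y - c| <= be n by apply/DE; rewrite DU.
  by case: (H `|y - c|) => //; exact: lt_le_trans (al0 n) h1.
- apply/disj_setPS => y [/E1 h1 h2]; move: (h2) => /E2; rewrite h1 => h3.
  move: h2 => /bigcup_itvP[n /andP[_ h2]]; have := al0 n; lra.
Qed.

End Integration.

(** * Powers of the distance to a point, near it and far from it *)

Section PowerIntegrals.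
Variable R : realType.
Local Notation mu := (@lebesgue_measure R).
Local Notation I01 := (`[0%R, 1%R]%classic : set R).

(* The strict inequality excludes [y = c], where [0 `^ q = 0] for [q <> 0]. *)
Definition near_pw (c r q y : R) : R :=
  if (0 < `|y - c|) && (`|y - c| <= r) then `|y - c| `^ q else 0.

Definition far_pw (c r q y : R) : R :=
  if r <= `|y - c| then `|y - c| `^ q else 0.

Lemma near_pw_ge0 c r q y : 0 <= near_pw c r q y.
Proof. by rewrite /near_pw; case: ifP => // _; exact: powR_ge0. Qed.

Lemma far_pw_ge0 c r q y : 0 <= far_pw c r q y.
Proof. by rewrite /far_pw; case: ifP => // _; exact: powR_ge0. Qed.

Lemma near_pwE c r q :
  near_pw c r q = (fun y => `|y - c| `^ q) \_ [set y | 0 < `|y - c| /\ `|y - c| <= r].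
Proof.
apply/funext => y; rewrite /near_pw /patch; case: ifPn => [/andP h|h].
  by rewrite ifT //; apply/mem_set.
by rewrite ifF //; apply/negbTE; apply: contra h => /set_mem /= h; apply/andP.
Qed.

Lemma far_pwE c r q :
  far_pw c r q = (fun y => `|y - c| `^ q) \_ [set y | r <= `|y - c|].
Proof.
apply/funext => y; rewrite /far_pw /patch; case: ifPn => h.
  by rewrite ifT //; apply/mem_set.
by rewrite ifF //; apply/negbTE; apply: contra h => /set_mem.
Qed.

Lemma powR_derivs (k q t : R) : 0 < t -> k * q != 0 ->
  is_derive t (1 : R) (fun x : R => k * x `^ q) (k * (q * t `^ (q - 1))).
Proof.
move=> t0 kq; have h := is_derive1_powR q t0.
exact: (is_deriveZ k h).
Qed.

Lemma powR_cont (q t : R) : 0 < t -> {for t, continuous (fun x : R => x `^ q)}.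
Proof.
move=> t0; have [h _] := is_derive1_powR q t0.
by apply: differentiable_continuous; apply/derivable1_diffP.
Qed.

Lemma near_pw_shell (c r q : R) : -1 < q -> 0 < r ->
  let D := [set y | 0 < `|y - c| /\ `|y - c| <= r] in
  [/\ measurable D, measurable_fun D (fun y => `|y - c| `^ q) &
  (\int[mu]_(y in D) (`|y - c| `^ q)%:E <= (2 * (r `^ (q + 1) / (q + 1)))%:E)%E].
Proof.
move=> q1 r0 D; have qp : 0 < q + 1 by lra.
apply: (@int_shell_le R (fun t => t `^ q) (fun t => (q + 1)^-1 * t `^ (q + 1)) c
  (fun n => r / n.+1%:R) (fun=> r)).
- by move=> n; rewrite divr_gt0.
- by move=> n; rewrite ler_pdivrMr // ler_peMr ?ler1n ?ltW //.
- by move=> n; rewrite ler_pM2l // lef_pV2 ?posrE // ler_nat.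
- by [].
- move=> t t0; split; [exact: powR_ge0| |exact: powR_cont].
  apply: (is_derive_subst (powR_derivs _ _)) => //.
    by rewrite mulVf ?gt_eqF ?oner_eq0.
  by rewrite mulrA mulVf ?gt_eqF // mul1r addrK.
- move=> n; rewrite [leRHS]mulrC gerBl.
  by rewrite mulr_ge0 ?powR_ge0 // invr_ge0 ltW.
- move=> y; split => [[y0 yr]|[n /andP[h1 h2]]]; last first.
    by split => //; apply: lt_le_trans h1; rewrite divr_gt0.
  exists (Num.truncn (r / `|y - c|)); rewrite yr andbT ler_pdivrMr ?ltr0Sn //.
  by rewrite mulrC -ler_pdivrMr //; apply/ltW; exact: truncnS_gt.
Qed.

Lemma far_pw_shell (c r a : R) : 0 < a -> 0 < r ->
  let D := [set y | r <= `|y - c|] in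
  [/\ measurable D, measurable_fun D (fun y => `|y - c| `^ (- 1 - a)) &
  (\int[mu]_(y in D) (`|y - c| `^ (- 1 - a))%:E <= (2 * (r `^ (- a) / a))%:E)%E].
Proof.
move=> a0 r0 D.
apply: (@int_shell_le R (fun t => t `^ (- 1 - a)) (fun t => - a^-1 * t `^ (- a)) c
  (fun n => r) (fun n => r + n%:R)) => //.
- by move=> n; rewrite lerDl.
- by move=> n; rewrite lerD2l ler_nat.
- move=> t t0; split; [exact: powR_ge0| |exact: powR_cont].
  apply: (is_derive_subst (powR_derivs _ _)) => //.
    by rewrite mulrNN mulVf ?gt_eqF ?oner_eq0.
  by rewrite mulrA mulrNN mulVf ?gt_eqF // mul1r addrC.
- move=> n; rewrite !mulNr opprK addrC mulrC gerBl.
  by rewrite mulr_ge0 ?powR_ge0 // invr_ge0 ltW.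
- move=> y; split => [yr|[n /andP[h1 h2]] //].
  have n0 : 0 <= `|y - c| - r by rewrite subr_ge0.
  exists (Num.truncn (`|y - c| - r)).+1; rewrite yr /=.
  by rewrite -lerBlDl; apply/ltW; exact: truncnS_gt.
Qed.

Lemma near_pw_meas (c r q : R) : -1 < q -> 0 < r -> measurable_fun setT (near_pw c r q).
Proof.
move=> q1 r0; have [mD mf _] := near_pw_shell c q1 r0.
by rewrite near_pwE; apply/(measurable_restrictT _ mD).
Qed.

Lemma far_pw_meas (c r a : R) : 0 < a -> 0 < r -> measurable_fun setT (far_pw c r (- 1 - a)).
Proof.
move=> q1 r0; have [mD mf _] := far_pw_shell c q1 r0.
by rewrite far_pwE; apply/(measurable_restrictT _ mD).
Qed.

Lemma int_near_pw (c r q : R) (S : set R) : -1 < q -> 0 < r ->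
  (\int[mu]_(y in S) (near_pw c r q y)%:E <= (2 * (r `^ (q + 1) / (q + 1)))%:E)%E.
Proof.
move=> q1 r0; have [mD mf] := near_pw_shell c q1 r0; apply: le_trans.
apply: (@le_trans _ _ (\int[mu]_y (near_pw c r q y)%:E)%E).
  by apply: le_int_mono => // y _; rewrite lee_fin near_pw_ge0.
rewrite [leRHS]integral_mkcond le_eqVlt; apply/orP; left; apply/eqP.
by apply: eq_integral => y _; rewrite near_pwE /patch; case: ifP.
Qed.

Lemma int_far_pw (c r a : R) (S : set R) : 0 < a -> 0 < r ->
  (\int[mu]_(y in S) (far_pw c r (- 1 - a) y)%:E <= (2 * (r `^ (- a) / a))%:E)%E.
Proof.
move=> q1 r0; have [mD mf] := far_pw_shell c q1 r0; apply: le_trans.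
apply: (@le_trans _ _ (\int[mu]_y (far_pw c r (- 1 - a) y)%:E)%E).
  by apply: le_int_mono => // y _; rewrite lee_fin far_pw_ge0.
rewrite [leRHS]integral_mkcond le_eqVlt; apply/orP; left; apply/eqP.
by apply: eq_integral => y _; rewrite far_pwE /patch; case: ifP.
Qed.

End PowerIntegrals.

(** * Gagliardo energies *)

Section GagliardoLipschitz.
Variable R : realType.
Local Notation mu := (@lebesgue_measure R).
Local Notation I01 := (`[0%R, 1%R]%classic : set R).

Lemma mu_I01 : mu I01 = 1%E.
Proof. by rewrite lebesgue_measure_itv /= lte_fin ltr01 oppr0 addr0. Qed.

Lemma int_I01_le (f : R -> \bar R) (c : R) :
  (forall x, I01 x -> 0 <= f x)%E -> (forall x, I01 x -> f x <= c%:E)%E ->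
  (\int[mu]_(x in I01) f x <= c%:E)%E.
Proof.
move=> f0 fc; apply: (le_trans (le_int f0 fc)).
by rewrite integral_cst // [X in (_ * X)%E]mu_I01 mule1.
Qed.

Lemma powR_le (p x y : R) : 0 <= p -> 0 <= x -> x <= y -> x `^ p <= y `^ p.
Proof.
move=> p0 x0 xy; apply: ge0_ler_powR => //; rewrite nnegrE //.
exact: le_trans xy.
Qed.

(** Passing to one of three translates of x reduces kernels on the circle to kernels on the line. *)
Lemma cdist_shift (x y : R) : I01 x -> I01 y ->
  exists2 c, (c = x) \/ (c = x - 1) \/ (c = x + 1) & cdist x y = `|y - c|.
Proof.
rewrite /= !in_itv /= => /andP[x0 x1] /andP[y0 y1]; rewrite /cdist.
have [h|h] := leP `|x - y| (1 - `|x - y|); first by exists x; [left|rewrite distrC].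
have [xy|xy] := leP x y.
  exists (x + 1); first by right; right.
  rewrite (ler0_norm (_ : x - y <= 0)) ?(ler0_norm (_ : y - (x + 1) <= 0)); lra.
exists (x - 1); first by right; left.
rewrite (gtr0_norm (_ : 0 < x - y)) ?(ger0_norm (_ : 0 <= y - (x - 1))); lra.
Qed.

Lemma cdist_ge0 (x y : R) : I01 x -> I01 y -> 0 <= cdist x y.
Proof. by move=> Ix Iy; have [c _ ->] := cdist_shift Ix Iy. Qed.

(** The minimum changes regime at t = 1/lam. For a = 1 + sg p with 0 < sg < 1 the power below the
    threshold is integrable at 0 and the one above it at infinity. *)
Lemma profile_le (p a A lam t v : R) : 0 <= p -> 0 < lam -> 0 <= A -> 0 <= v -> 0 < t ->
  v <= A * Num.min 1 (lam * t) ->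
  v `^ p / t `^ a <= A `^ p *
    (if t <= lam^-1 then lam `^ p * t `^ (p - a) else t `^ (- a)).
Proof.
move=> p0 l0 A0 v0 t0 h.
have ta : 0 < t `^ a by exact: powR_gt0.
have tn : t != 0 by rewrite gt_eqF.
case: ifP => tl.
  rewrite powRB ?tn ?implybT // !mulrA ler_pM2r ?invr_gt0 //.
  have lt0 : 0 <= lam * t by rewrite mulr_ge0 // ltW.
  rewrite -mulrA -(powRM p (ltW l0) (ltW t0)) -(powRM p A0 lt0).
  apply: powR_le => //; apply: (le_trans h).
  by rewrite ler_wpM2l // ge_min lexx orbT.
rewrite powRN ler_pM2r ?invr_gt0 //; apply: powR_le => //; apply: (le_trans h).
by rewrite ler_piMr // ge_min lexx.
Qed.

(** The factor 6 counts two sides of the centre and three translates; the two terms are the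
    integrals of the near and the far regime. *)
Definition gag_cst (sg p : R) : R := 6 * ((p * (1 - sg))^-1 + (sg * p)^-1).

Lemma int_profile (sg p lam : R) (c : R) : 0 < sg < 1 -> 1 <= p -> 0 < lam ->
  (\int[mu]_(y in I01) (lam `^ p * near_pw c lam^-1 (p - (1 + sg * p)) y
     + far_pw c lam^-1 (- 1 - sg * p) y)%:E
   <= (2 * ((p * (1 - sg))^-1 + (sg * p)^-1) * lam `^ (sg * p))%:E)%E.
Proof.
move=> /andP[s0 s1] p1 l0.
have e1 : -1 < p - (1 + sg * p) by nra.
have e2 : 0 < sg * p by nra.
have li : 0 < lam^-1 by rewrite invr_gt0.
under eq_integral do rewrite EFinD EFinM.
have m1 : measurable_fun I01 (near_pw c lam^-1 (p - (1 + sg * p))).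
  exact: measurable_funS (near_pw_meas _ _ _).
have m2 : measurable_fun I01 (far_pw c lam^-1 (- 1 - sg * p)).
  exact: measurable_funS (far_pw_meas _ _ _).
rewrite ge0_integralD //; first last.
- exact/measurable_EFinP.
- by move=> x _; rewrite lee_fin far_pw_ge0.
- by apply: measurable_funeM; exact/measurable_EFinP.
- by move=> x _; rewrite -EFinM lee_fin mulr_ge0 ?powR_ge0 ?near_pw_ge0.
rewrite ge0_integralZl_EFin ?powR_ge0 //; first last.
- exact/measurable_EFinP.
- by move=> x _; rewrite lee_fin near_pw_ge0.
rewrite (mulrDr 2) mulrDl EFinD; apply: leeD.
  apply: (@le_trans _ _ ((lam `^ p)%:E *
     (2 * (lam^-1 `^ (p - (1 + sg * p) + 1) / (p - (1 + sg * p) + 1)))%:E)%E).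
    by rewrite lee_pmul2l ?lte_fin ?powR_gt0 //; exact: int_near_pw.
  rewrite -EFinM lee_fin.
  rewrite (_ : p - (1 + sg * p) + 1 = p * (1 - sg)); last by ring.
  rewrite -(powR_inv1 (ltW l0)) -powRrM mulN1r.
  rewrite le_eqVlt; apply/orP; left; apply/eqP.
  rewrite (_ : sg * p = p + - (p * (1 - sg))); last by ring.
  rewrite [lam `^ (p + _)]powRD; last by rewrite (gt_eqF l0) implybT.
  by ring.
apply: (le_trans (int_far_pw _ _ _ _)) => //.
rewrite lee_fin -(powR_inv1 (ltW l0)) -powRrM mulN1r opprK.
by rewrite le_eqVlt; apply/orP; left; apply/eqP; ring.
Qed.

(** A map of size A that varies on the scale 1/lam has energy of order A^p lam^(sg p). With lam = n
    this is the source of the fractional part of the exponent s in the upper bound. *)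
Lemma gagliardo_lip (sg p A lam : R) (h : R -> R * R) :
  0 < sg < 1 -> 1 <= p -> 0 <= A -> 0 < lam ->
  (forall x y, I01 x -> I01 y ->
     en ((h x).1 - (h y).1, (h x).2 - (h y).2) <= A * Num.min 1 (lam * cdist x y)) ->
  (gagliardo sg p h <= (gag_cst sg p * A `^ p * lam `^ (sg * p))%:E)%E.
Proof.
move=> sg01 p1 A0 l0 H; have [s0 s1] := andP sg01.
have li : 0 < lam^-1 by rewrite invr_gt0.
have p0 : 0 <= p by lra.
have e1 : -1 < p - (1 + sg * p) by nra.
have e2 : 0 < sg * p by nra.
apply: int_I01_le => x Ix.
  by apply: integral_ge0 => y Iy; rewrite lee_fin divr_ge0 ?powR_ge0.
pose P c y := lam `^ p * near_pw c lam^-1 (p - (1 + sg * p)) y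
     + far_pw c lam^-1 (- 1 - sg * p) y.
have P0 c y : 0 <= P c y.
  by rewrite addr_ge0 ?far_pw_ge0 // mulr_ge0 ?near_pw_ge0 // powR_ge0.
have mP c : measurable_fun I01 (EFin \o P c).
  apply/measurable_EFinP; apply: measurable_funD.
    apply: measurable_funM; first exact: measurable_cst.
    exact: measurable_funS (near_pw_meas _ _ _).
  exact: measurable_funS (far_pw_meas _ _ _).
apply: (@le_trans _ _ (\int[mu]_(y in I01)
   ((A `^ p)%:E * ((P x y)%:E + ((P (x - 1) y)%:E + (P (x + 1) y)%:E))))%E).
  apply: le_int => y Iy; first by rewrite lee_fin divr_ge0 ?powR_ge0.
  rewrite -!EFinD -EFinM lee_fin.
  have [c cE dE] := cdist_shift Ix Iy.
  (* At circle distance 0 the denominator is 0, and by the convention on the inverse of 0 the kernel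
     is 0 as well. *)
  have := cdist_ge0 Ix Iy; rewrite le_eqVlt => /orP[/eqP d0|d0].
    have a0 : 1 + sg * p != 0 by rewrite gt_eqF //; lra.
    rewrite -d0 (powR0 a0) invr0 mulr0; apply: mulr_ge0; first exact: powR_ge0.
    apply: addr_ge0; first exact: P0.
    by apply: addr_ge0; exact: P0.
  apply: (@le_trans _ _ (A `^ p * P c y)); last first.
    apply: ler_wpM2l; first exact: powR_ge0.
    have := P0 x y; have := P0 (x - 1) y; have := P0 (x + 1) y.
    case: cE => [->|[->|->]]; lra.
  have := @profile_le p (1 + sg * p) A lam (cdist x y) _ p0 l0 A0 (sqrtr_ge0 _) d0 (H x y Ix Iy).
  move=> /le_trans; apply; apply: ler_wpM2l; first exact: powR_ge0.
  rewrite /P /near_pw /far_pw -dE d0 /=.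
  case: (leP (cdist x y) lam^-1) => h1.
    by rewrite lerDl; case: ifP => // _; exact: powR_ge0.
  by rewrite mulr0 add0r (ltW h1) opprD.
rewrite ge0_integralZl_EFin ?powR_ge0 //; first last.
- exact: (emeasurable_funD (mP _) (emeasurable_funD (mP _) (mP _))).
- by move=> y Iy; apply: adde_ge0; [|apply: adde_ge0]; rewrite lee_fin; exact: P0.
rewrite ge0_integralD //; first last.
- exact: (emeasurable_funD (mP _) (mP _)).
- by move=> y Iy; apply: adde_ge0; rewrite lee_fin; exact: P0.
- exact: mP.
- by move=> y Iy; rewrite lee_fin; exact: P0.
rewrite ge0_integralD //; first last.
- exact: mP.
- by move=> y Iy; rewrite lee_fin; exact: P0.
- exact: mP.
- by move=> y Iy; rewrite lee_fin; exact: P0.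
have B c : (\int[mu]_(y in I01) (P c y)%:E <=
   (2 * ((p * (1 - sg))^-1 + (sg * p)^-1) * lam `^ (sg * p))%:E)%E by exact: int_profile.
apply: (@le_trans _ _ ((A `^ p)%:E *
   ((2 * ((p * (1 - sg))^-1 + (sg * p)^-1) * lam `^ (sg * p)) +
   ((2 * ((p * (1 - sg))^-1 + (sg * p)^-1) * lam `^ (sg * p)) +
   (2 * ((p * (1 - sg))^-1 + (sg * p)^-1) * lam `^ (sg * p))))%:E)%E).
  apply: lee_wpmul2l; first by rewrite lee_fin powR_ge0.
  by rewrite !EFinD; apply: leeD; [exact: B|apply: leeD; exact: B].
rewrite -EFinM lee_fin /gag_cst le_eqVlt; apply/orP; left; apply/eqP; ring.
Qed.

End GagliardoLipschitz.

(** * Young's and Jensen's inequalities *)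

Section Jensen.
Variable R : realType.
Local Notation mu := (@lebesgue_measure R).
Local Notation I01 := (`[0%R, 1%R]%classic : set R).

(** Young's inequality for the exponents p and p/(p - 1), with m left free. The case p = 1, whose
    conjugate exponent is infinite, is an equality. *)
Lemma young (p m t : R) : 1 <= p -> 0 < m -> 0 <= t ->
  t * m `^ (p - 1) <= t `^ p / p + m `^ p * (1 - p^-1).
Proof.
move=> p1 m0 t0; have p0 : 0 < p by lra.
move: p1; rewrite le_eqVlt => /orP[/eqP <-|p1].
  by rewrite subrr powRr0 !powRr1 ?(ltW m0) // invr1 subrr !mulr1 mulr0 addr0.
have q0 : 0 < 1 - p^-1 by rewrite subr_gt0 invf_lt1.
have qi : 0 < (1 - p^-1)^-1 by rewrite invr_gt0.
have mp : 0 <= m `^ (p - 1) by exact: powR_ge0.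
have pq : p^-1 + (1 - p^-1)^-1^-1 = 1 by rewrite invrK; ring.
have := conjugate_powR t0 mp p0 qi pq.
rewrite invrK -powRrM (_ : (p - 1) * (1 - p^-1)^-1 = p) //.
have -> : 1 - p^-1 = (p - 1) / p by field; rewrite gt_eqF.
by rewrite invf_div mulrCA mulfV ?mulr1 // subr_eq0 gt_eqF.
Qed.

(** Young's inequality is integrated twice: m = 1 shows that the integral of f is finite, then m
    equal to the mean of f gives the sharp constant. *)
Lemma jensen (D : set R) (f : R -> R) (l p E : R) : measurable D ->
  measurable_fun D f -> (forall x, D x -> 0 <= f x) -> mu D = l%:E -> 0 < l -> 1 <= p ->
  (\int[mu]_(x in D) (f x `^ p)%:E <= E%:E)%E ->
  exists I : R, [/\ (\int[mu]_(x in D) (f x)%:E = I%:E)%E, 0 <= I &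
    I `^ p <= l `^ (p - 1) * E].
Proof.
move=> mD mf f0 muD l0 p1 fE; have p0 : 0 < p by lra.
have pi1 : 0 <= 1 - p^-1 by rewrite subr_ge0 invf_le1.
have mfp : measurable_fun D (fun x => f x `^ p).
  exact: (measurableT_comp (@measurable_powR R p) mf).
have key m : 0 < m -> ((m `^ (p - 1))%:E * \int[mu]_(x in D) (f x)%:E <=
    (E / p + m `^ p * (1 - p^-1) * l)%:E)%E.
  move=> m0.
  rewrite -ge0_integralZl_EFin ?powR_ge0 //; last exact/measurable_EFinP.
  apply: (@le_trans _ _ (\int[mu]_(x in D)
     ((p^-1)%:E * (f x `^ p)%:E + (m `^ p * (1 - p^-1))%:E))%E).
    apply: le_int => x Dx.
      by rewrite -EFinM lee_fin mulr_ge0 ?powR_ge0 ?f0.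
    rewrite -!EFinM -EFinD lee_fin mulrC (mulrC p^-1).
    by apply: young => //; exact: f0.
  rewrite ge0_integralD //; first last.
  - by move=> x _; rewrite lee_fin mulr_ge0 ?powR_ge0.
  - by apply: measurable_funeM; exact/measurable_EFinP.
  - by move=> x _; rewrite -EFinM lee_fin mulr_ge0 ?powR_ge0 // invr_ge0 ltW.
  rewrite ge0_integralZl_EFin ?invr_ge0 ?(ltW p0) //; first last.
  - exact/measurable_EFinP.
  - by move=> x _; rewrite lee_fin powR_ge0.
  have -> : (\int[mu]_(x in D) (m `^ p * (1 - p^-1))%:E)%E =
      ((m `^ p * (1 - p^-1))%:E * mu D)%E by exact: integral_cst.
  rewrite muD EFinD leeD //.
    by rewrite mulrC EFinM lee_pmul2l // lte_fin invr_gt0.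
have I0 : (0 <= \int[mu]_(x in D) (f x)%:E)%E.
  by apply: integral_ge0 => x Dx; rewrite lee_fin f0.
have := key 1 ltr01; rewrite !powR1 mul1e mul1r => h.
case EI : (\int[mu]_(x in D) (f x)%:E)%E h I0 => [I| |] // _.
rewrite lee_fin => I0; exists I; split => //.
have E0 : 0 <= E.
  rewrite -lee_fin; apply: le_trans fE; apply: integral_ge0 => x Dx.
  by rewrite lee_fin powR_ge0.
move: I0; rewrite le_eqVlt => /orP[/eqP <-|I0].
  by rewrite powR0 ?gt_eqF // mulr_ge0 ?powR_ge0.
pose m := I / l; have m0 : 0 < m by rewrite divr_gt0.
have IE : I = m * l by rewrite /m mulfVK // gt_eqF.
have := key m m0; rewrite EI -EFinM lee_fin {1}IE => h.
have mm : m `^ (p - 1) * m = m `^ p.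
  by rewrite mulrC mulr_powRB1 // ltW.
have h2 : m `^ p * l <= E.
  move: h; rewrite mulrA mm => h.
  have : m `^ p * l / p <= E / p by rewrite mulrBr mulr1 mulrBl in h; lra.
  by rewrite ler_pM2r // invr_gt0.
rewrite IE powRM ?(ltW m0) ?(ltW l0) //.
rewrite -(mulr_powRB1 (ltW l0) p0) mulrA mulrC.
by rewrite ler_wpM2l // powR_ge0.
Qed.

End Jensen.

(** * Measurability of the Gagliardo kernel *)

Section Kernel.
Variable R : realType.
Local Notation mu := (@lebesgue_measure R).
Local Notation I01 := (`[0%R, 1%R]%classic : set R).

Definition gk (sg p : R) (h : R -> R * R) (x y : R) : R :=
  en ((h x).1 - (h y).1, (h x).2 - (h y).2) `^ p / cdist x y `^ (1 + sg * p).

Definition meas2 (h : R -> R * R) :=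
  measurable_fun I01 (fun x => (h x).1) /\ measurable_fun I01 (fun x => (h x).2).

Lemma gk_ge0 sg p h x y : 0 <= gk sg p h x y.
Proof. by rewrite divr_ge0 // powR_ge0. Qed.

Lemma measurable_sqrtr : measurable_fun setT (@Num.sqrt R).
Proof. by apply: continuous_measurable_fun; exact: sqrt_continuous. Qed.

Lemma gk_meas (sg p : R) (h : R -> R * R) :
  measurable_fun setT (fun x => (h x).1) -> measurable_fun setT (fun x => (h x).2) ->
  measurable_fun setT (fun z : R * R => gk sg p h z.1 z.2).
Proof.
move=> m1 m2.
have f1 : measurable_fun setT (fun z : R * R => (h z.1).1 - (h z.2).1).
  apply: measurable_funB.
    exact: (measurableT_comp m1 measurable_fst).
  exact: (measurableT_comp m1 measurable_snd).
have f2 : measurable_fun setT (fun z : R * R => (h z.1).2 - (h z.2).2).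
  apply: measurable_funB.
    exact: (measurableT_comp m2 measurable_fst).
  exact: (measurableT_comp m2 measurable_snd).
have f3 : measurable_fun setT (fun z : R * R => `|z.1 - z.2|).
  apply: (measurableT_comp (normr_measurable (D := setT))).
  by apply: measurable_funB; [exact: measurable_fst|exact: measurable_snd].
apply: measurable_funM.
  apply: (measurableT_comp (@measurable_powR R p)).
  apply: (measurableT_comp measurable_sqrtr).
  by apply: measurable_funD; exact: measurable_funX.
rewrite (_ : (fun _ => _) = (fun z : R * R => cdist z.1 z.2 `^ (- (1 + sg * p)))); last first.
  by apply/funext => z; rewrite powRN.
apply: (measurableT_comp (@measurable_powR R _)).
apply: measurable_minr => //; apply: measurable_funB => //.
Qed.

(** Tonelli's theorem is applied on the whole plane, so h is extended by 0 outside the unit interval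
    and the domain of the inner integral enters as an indicator. *)
Lemma inner_meas (sg p : R) (h : R -> R * R) (J : set R) : measurable J -> J `<=` I01 ->
  meas2 h -> measurable_fun I01 (fun x => \int[mu]_(y in J) (gk sg p h x y)%:E)%E.
Proof.
move=> mJ JI [m1 m2].
pose h1 x := (((fun x => (h x).1) \_ I01) x, ((fun x => (h x).2) \_ I01) x).
have hh x : I01 x -> h1 x = h x.
  by move=> Ix; rewrite /h1 /patch ifT ?mem_set //; case: (h x).
have mI : measurable I01 by exact: measurable_itv.
have mK : measurable_fun setT (fun z : R * R => gk sg p h1 z.1 z.2).
  apply: gk_meas; first exact: (proj1 (measurable_restrictT (fun x => (h x).1) mI) m1).
  exact: (proj1 (measurable_restrictT (fun x => (h x).2) mI) m2).
pose F (z : R * R) := ((gk sg p h1 z.1 z.2) * (\1_J z.2))%:E.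
have mF : measurable_fun setT F.
  apply/measurable_EFinP; apply: measurable_funM => //.
  by apply: (measurableT_comp (measurable_indic mJ)); exact: measurable_snd.
have F0 z : (0 <= F z)%E.
  by rewrite lee_fin mulr_ge0 ?gk_ge0.
have := @measurable_fun_fubini_tonelli_F _ _ (measurableTypeR R) (measurableTypeR R) R mu F mF F0.
move=> /(measurable_funS measurableT (@subsetT _ I01)).
apply: eq_measurable_fun => x /set_mem Ix.
rewrite /fubini_F [RHS]integral_mkcond; apply: eq_integral => y _.
rewrite /F /patch indicE; case: (boolP (y \in J)) => yJ /=.
  by rewrite mulr1 /gk !hh //; apply: JI; exact/set_mem.
by rewrite mulr0.
Qed.

Lemma ymeas (sg p : R) (h : R -> R * R) (J : set R) (x : R) : measurable J -> J `<=` I01 ->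
  meas2 h -> I01 x -> measurable_fun J (fun y => gk sg p h x y).
Proof.
move=> mJ JI [m1 m2] Ix.
pose h1 x := (((fun x => (h x).1) \_ I01) x, ((fun x => (h x).2) \_ I01) x).
have hh x' : I01 x' -> h1 x' = h x'.
  by move=> Ix'; rewrite /h1 /patch ifT ?mem_set //; case: (h x').
have mI : measurable I01 by exact: measurable_itv.
have mK : measurable_fun setT (fun z : R * R => gk sg p h1 z.1 z.2).
  apply: gk_meas; first exact: (proj1 (measurable_restrictT (fun x => (h x).1) mI) m1).
  exact: (proj1 (measurable_restrictT (fun x => (h x).2) mI) m2).
have := measurableT_comp mK (pair1_measurable x).
move=> /(measurable_funS measurableT (@subsetT _ J)).
apply: eq_measurable_fun => y /set_mem Jy /=.
by rewrite /gk !hh //; apply: JI.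
Qed.

End Kernel.

(** * Fractional Poincare inequality on an interval *)

Section Poincare.
Variable R : realType.
Local Notation mu := (@lebesgue_measure R).
Local Notation I01 := (`[0%R, 1%R]%classic : set R).
Local Notation oo a b := (`]a, b[%classic : set R).

Lemma mu_oo (a b : R) : a < b -> mu (oo a b) = (b - a)%:E.
Proof. by move=> ab; rewrite lebesgue_measure_itv /= lte_fin ab EFinB. Qed.

Lemma oo_I01 (a b : R) : 0 <= a -> b <= 1 -> oo a b `<=` I01.
Proof.
move=> a0 b1 x; rewrite /= !in_itv /= => /andP[ax xb]; apply/andP; split.
  by apply: le_trans (ltW ax).
by apply: le_trans (ltW xb) _.
Qed.

Lemma cdist_oo (a b x y : R) : 0 <= a -> b <= 1 -> oo a b x -> oo a b y -> x != y ->
  0 < cdist x y <= b - a.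
Proof.
rewrite /= !in_itv /= => a0 b1 /andP[ax xb] /andP[ay yb] xy.
have n0 : 0 < `|x - y| by rewrite normr_gt0 subr_eq0.
have n1 : `|x - y| < b - a by rewrite ltr_norml; apply/andP; split; lra.
rewrite /cdist lt_min ge_min n0 (ltW n1) /= andbT; lra.
Qed.

(** Inside the interval the circle distance is at most b - a, so the kernel dominates the difference
    up to this power of the length. *)
Lemma gk_lower (sg p a b x y : R) (h : R -> R * R) (v : R -> R) : 0 < sg -> 1 <= p ->
  0 <= a -> b <= 1 -> oo a b x -> oo a b y ->
  (forall x y, `|v x - v y| <= en ((h x).1 - (h y).1, (h x).2 - (h y).2)) ->
  `|v x - v y| `^ p <= (b - a) `^ (1 + sg * p) * gk sg p h x y.
Proof.
move=> s0 p1 a0 b1 Jx Jy hv.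
have p0 : 0 <= p by lra.
have sp : 0 <= 1 + sg * p by nra.
have [->|xy] := eqVneq x y.
  have pn : p != 0 by apply: lt0r_neq0; lra.
  by rewrite subrr normr0 (powR0 pn) mulr_ge0 ?gk_ge0 ?powR_ge0.
have /andP[c0 c1] := cdist_oo a0 b1 Jx Jy xy.
rewrite /gk mulrCA; apply: (@le_trans _ _ (en ((h x).1 - (h y).1, (h x).2 - (h y).2) `^ p)).
  exact: powR_le.
rewrite ler_peMr ?powR_ge0 // ler_pdivlMr ?powR_gt0 // mul1r.
by apply: powR_le => //; exact: ltW.
Qed.

(** The deviation of v x from the mean is the mean over y of v x - v y; Jensen's inequality takes
    the power p inside, where the kernel bounds it. *)
Lemma poincare_Lp (sg p a b E : R) (h : R -> R * R) (v : R -> R) :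
  0 < sg -> 1 <= p -> 0 <= a -> a < b -> b <= 1 -> meas2 h -> measurable_fun I01 v ->
  (forall x y, `|v x - v y| <= en ((h x).1 - (h y).1, (h x).2 - (h y).2)) ->
  mu.-integrable (oo a b) (EFin \o v) ->
  (\int[mu]_(x in oo a b) \int[mu]_(y in oo a b) (gk sg p h x y)%:E <= E%:E)%E ->
  (\int[mu]_(x in oo a b) (`|v x - (\int[mu]_(y in oo a b) v y)%R / (b - a)| `^ p)%:E
    <= ((b - a) `^ (sg * p) * E)%:E)%E.
Proof.
move=> s0 p1 a0 ab b1 mh mv hv iv HE.
set J := oo a b; set l := b - a; set A := _ / l.
have l0 : 0 < l by rewrite subr_gt0.
have p0 : 0 < p by lra.
have mJ : measurable J by exact: measurable_itv.
have JI : J `<=` I01 by exact: oo_I01.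
have mvJ : measurable_fun J v by exact: measurable_funS mv.
have muJ : mu J = l%:E by exact: mu_oo.
have mPsi : measurable_fun J (fun x => \int[mu]_(y in J) (gk sg p h x y)%:E)%E.
  by apply: measurable_funS (inner_meas _ _ mJ JI mh).
have Psi0 x : J x -> (0 <= \int[mu]_(y in J) (gk sg p h x y)%:E)%E.
  by move=> _; apply: integral_ge0 => y _; rewrite lee_fin gk_ge0.
have pt x : J x -> ((`|v x - A| `^ p)%:E <=
    (l `^ (sg * p))%:E * \int[mu]_(y in J) (gk sg p h x y)%:E)%E.
  move=> Jx; have := Psi0 x Jx.
  case EP : (\int[mu]_(y in J) (gk sg p h x y)%:E)%E => [r| |] // r0; last first.
    by rewrite mulry gtr0_sg ?powR_gt0 // mul1e leey.
  have mvx : measurable_fun J (fun y => `|v x - v y|).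
    apply: (measurableT_comp (normr_measurable (D := setT))).
    by apply: measurable_funB => //; exact: measurable_cst.
  have [|Ix [Ix1 Ix2 Ix3]] := jensen (E := l `^ (1 + sg * p) * r) mJ mvx (fun _ _ => normr_ge0 _) muJ l0 p1.
    rewrite EFinM -EP -ge0_integralZl_EFin ?powR_ge0 //; first last.
    - by apply/measurable_EFinP; apply: ymeas => //; exact: JI.
    - by move=> y _; rewrite lee_fin gk_ge0.
    apply: le_int => y Jy; first by rewrite lee_fin powR_ge0.
    by rewrite -EFinM lee_fin; exact: gk_lower.
  have ic : mu.-integrable J (EFin \o cst (v x)).
    have cc : continuous (cst (v x) : R -> R) by exact: cst_continuous.
    by apply: integrableS (cont_integrable a b cc) => //; exact: subset_itv_oo_cc.
  have ivx : mu.-integrable J (EFin \o (fun y => v x - v y)).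
    rewrite (_ : EFin \o _ = ((EFin \o cst (v x)) \- (EFin \o v))%E).
      by apply: integrableB.
    by apply/funext => y; rewrite /= EFinB.
  have EA : v x - A = (\int[mu]_(y in J) (v x - v y)) / l.
    rewrite RintegralB // Rintegral_cst // (_ : fine _ = l); last exact: (congr1 fine muJ).
    rewrite mulrBl mulfK //.
    by rewrite gt_eqF.
  have hA : `|v x - A| <= Ix / l.
    rewrite EA normrM (gtr0_norm (_ : 0 < l^-1)) ?invr_gt0 //.
    rewrite ler_pM2r ?invr_gt0 //.
    apply: (@le_trans _ _ (\int[mu]_(y in J) `|v x - v y|)).
      exact: le_normr_Rintegral.
    by rewrite /Rintegral Ix1.
  rewrite -EFinM lee_fin.
  apply: (@le_trans _ _ ((Ix / l) `^ p)); first by apply: powR_le => //; lra.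
  rewrite powRM ?invr_ge0 ?(ltW l0) //.
  rewrite -(powR_inv1 (ltW l0)) -powRrM mulN1r powRN.
  rewrite ler_pdivrMr ?powR_gt0 //; apply: (le_trans Ix3).
  rewrite !mulrA -powRD; last by rewrite (gt_eqF l0) implybT.
  rewrite mulrAC -powRD; last by rewrite (gt_eqF l0) implybT.
  rewrite le_eqVlt; apply/orP; left; apply/eqP; congr (_ `^ _ * _); ring.
apply: (@le_trans _ _ (\int[mu]_(x in J) ((l `^ (sg * p))%:E *
    \int[mu]_(y in J) (gk sg p h x y)%:E))%E).
  by apply: le_int => x Jx; [rewrite lee_fin powR_ge0|exact: pt].
rewrite ge0_integralZl_EFin ?powR_ge0 // EFinM lee_pmul2l ?lte_fin ?powR_gt0 //.
Qed.

Lemma poincare (sg p a b E : R) (h : R -> R * R) (v : R -> R) :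
  0 < sg -> 1 <= p -> 0 <= a -> a < b -> b <= 1 -> meas2 h -> measurable_fun I01 v ->
  (forall x y, `|v x - v y| <= en ((h x).1 - (h y).1, (h x).2 - (h y).2)) ->
  mu.-integrable (oo a b) (EFin \o v) ->
  (\int[mu]_(x in oo a b) \int[mu]_(y in oo a b) (gk sg p h x y)%:E <= E%:E)%E ->
  exists I : R, [/\ (\int[mu]_(x in oo a b)
    (`|v x - (\int[mu]_(y in oo a b) v y) / (b - a)|)%:E = I%:E)%E, 0 <= I &
    I `^ p <= (b - a) `^ (p - 1 + sg * p) * E].
Proof.
move=> s0 p1 a0 ab b1 mh mv hv iv HE.
have H := poincare_Lp s0 p1 a0 ab b1 mh mv hv iv HE.
set J := oo a b in H *; set l := b - a in H *; set A := _ / l in H *.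
have l0 : 0 < l by rewrite subr_gt0.
have mJ : measurable J by exact: measurable_itv.
have mvJ : measurable_fun J v by apply: measurable_funS mv => //; exact: oo_I01.
have mvA : measurable_fun J (fun x => `|v x - A|).
  apply: (measurableT_comp (normr_measurable (D := setT))).
  exact: (measurable_funB mvJ (measurable_cst A)).
have [I [I1 I2 I3]] := jensen mJ mvA (fun _ _ => normr_ge0 _) (mu_oo ab) l0 p1 H.
exists I; split => //; apply: (le_trans I3).
by rewrite mulrA -powRD // (gt_eqF l0) implybT.
Qed.

End Poincare.

(** * Lower bounds on one interval; fractional Morrey inequality *)

Section Morrey.
Variable R : realType.
Local Notation mu := (@lebesgue_measure R).
Local Notation I01 := (`[0%R, 1%R]%classic : set R).
Local Notation oo a b := (`]a, b[%classic : set R).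

Lemma Rint_sub_le (v : R -> R) (J K : set R) (I : R) : measurable J -> measurable K ->
  J `<=` K -> mu.-integrable K (EFin \o v) ->
  (\int[mu]_(x in K) `|v x|%:E = I%:E)%E -> `|\int[mu]_(x in J) v x| <= I.
Proof.
move=> mJ mK JK iv IE.
have ivJ : mu.-integrable J (EFin \o v) by apply: integrableS iv.
have h : (`|\int[mu]_(x in J) (v x)%:E| <= \int[mu]_(x in J) `|v x|%:E)%E.
  by apply: le_abse_integral => //; case/integrableP: ivJ.
have h2 : (\int[mu]_(x in J) `|v x|%:E <= I%:E)%E.
  by rewrite -IE; apply: le_int_mono => // x _; rewrite lee_fin.
have := le_trans h h2; rewrite /Rintegral.
by case: (\int[mu]_(x in J) (v x)%:E)%E => [r| |] //; rewrite /= ?lee_fin.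
Qed.

(** With mean zero, the Poincare inequality controls the L^1 norm of v and so each of its partial
    integrals. These will be increments of a derivative one order lower. *)
Lemma mean_zero_lower (sg p a b a' c' E M : R) (h : R -> R * R) (v : R -> R) :
  0 < sg -> 1 <= p -> 0 <= a -> a < b -> b <= 1 -> meas2 h -> measurable_fun I01 v ->
  (forall x y, `|v x - v y| <= en ((h x).1 - (h y).1, (h x).2 - (h y).2)) ->
  mu.-integrable (oo a b) (EFin \o v) ->
  \int[mu]_(y in oo a b) v y = 0 ->
  a <= a' -> c' <= b -> 0 <= M -> M <= `|\int[mu]_(y in oo a' c') v y| ->
  (\int[mu]_(x in oo a b) \int[mu]_(y in oo a b) (gk sg p h x y)%:E <= E%:E)%E ->
  M `^ p <= (b - a) `^ (p - 1 + sg * p) * E.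
Proof.
move=> s0 p1 a0 ab b1 mh mv hv iv v0 aa cb M0 HM HE.
have [I [I1 I2 I3]] := poincare s0 p1 a0 ab b1 mh mv hv iv HE.
rewrite v0 mul0r in I1; apply: le_trans I3; apply: powR_le => //; first by lra.
apply: (le_trans HM); apply: (Rint_sub_le _ _ _ iv) => //.
  by apply: subset_itvW.
by rewrite -I1; apply: eq_integral => x _; rewrite subr0.
Qed.

(** Counterpart for integer s, where the energy is an L^p norm and Jensen's inequality alone gives
    the bound. *)
Lemma Lp_lower (p a b a' c' E M : R) (v : R -> R) :
  1 <= p -> 0 <= a -> a < b -> b <= 1 -> measurable_fun I01 v ->
  mu.-integrable (oo a b) (EFin \o v) ->
  a <= a' -> c' <= b -> 0 <= M -> M <= `|\int[mu]_(y in oo a' c') v y| ->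
  (\int[mu]_(x in oo a b) (`|v x| `^ p)%:E <= E%:E)%E ->
  M `^ p <= (b - a) `^ (p - 1) * E.
Proof.
move=> p1 a0 ab b1 mv iv aa cb M0 HM HE.
have mJ : measurable (oo a b) by exact: measurable_itv.
have l0 : 0 < b - a by rewrite subr_gt0.
have mvJ : measurable_fun (oo a b) (fun x => `|v x|).
  apply: (measurableT_comp (normr_measurable (D := setT))).
  by apply: measurable_funS mv => //; exact: oo_I01.
have [I [I1 I2 I3]] := jensen mJ mvJ (fun _ _ => normr_ge0 _) (mu_oo ab) l0 p1 HE.
apply: le_trans I3; apply: powR_le => //; first by lra.
apply: (le_trans HM); apply: (Rint_sub_le _ _ _ iv) => //.
by apply: subset_itvW.
Qed.

Lemma energy_mono (sg p a b a' b' : R) (h : R -> R * R) :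
  a <= a' -> b' <= b ->
  (\int[mu]_(x in oo a' b') \int[mu]_(y in oo a' b') (gk sg p h x y)%:E <=
   \int[mu]_(x in oo a b) \int[mu]_(y in oo a b) (gk sg p h x y)%:E)%E.
Proof.
move=> aa bb; have sub : oo a' b' `<=` oo a b by exact: subset_itvW.
apply: (@le_trans _ _ (\int[mu]_(x in oo a' b') \int[mu]_(y in oo a b) (gk sg p h x y)%:E)%E).
  apply: le_int => x _; first by apply: integral_ge0 => y _; rewrite lee_fin gk_ge0.
  by apply: le_int_mono => // y _; rewrite lee_fin gk_ge0.
apply: le_int_mono => // x _; by apply: integral_ge0 => y _; rewrite lee_fin gk_ge0.
Qed.

Definition avg (v : R -> R) (a b : R) : R := (\int[mu]_(y in oo a b) v y) / (b - a).

Lemma oo_integrable (v : R -> R) (a b : R) : continuous v ->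
  mu.-integrable (oo a b) (EFin \o v).
Proof.
move=> cv; apply: integrableS (cont_integrable a b cv) => //.
exact: subset_itv_oo_cc.
Qed.

Lemma avg_subc (v : R -> R) (a b c : R) : continuous v -> a < b ->
  avg v a b - c = (\int[mu]_(y in oo a b) (v y - c)) / (b - a).
Proof.
move=> cv ab; rewrite RintegralB //; first last.
- by apply: oo_integrable; exact: cst_continuous.
- exact: oo_integrable.
rewrite Rintegral_cst // (_ : fine _ = b - a); last exact: (congr1 fine (mu_oo ab)).
by rewrite mulrBl mulfK // subr_eq0 gt_eqF.
Qed.

Lemma avg_near (v : R -> R) (a b c e : R) : continuous v -> a < b ->
  (forall x, a < x < b -> `|v x - c| <= e) -> `|avg v a b - c| <= e.
Proof.
move=> cv ab H; rewrite avg_subc // normrM (gtr0_norm (_ : 0 < (b - a)^-1)) ?invr_gt0 ?subr_gt0 //.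
rewrite ler_pdivrMr ?subr_gt0 //.
have cvc : continuous (fun y => v y - c).
  by move=> y; apply: cvgB; [exact: cv|exact: cvg_cst].
have cva : continuous (fun y => `|v y - c|).
  by move=> y; apply: cvg_norm; exact: cvc.
apply: (@le_trans _ _ (\int[mu]_(y in oo a b) `|v y - c|)).
  by apply: le_normr_Rintegral => //; exact: oo_integrable.
apply: (@le_trans _ _ (\int[mu]_(y in oo a b) (cst e y))).
  apply: le_Rintegral => //.
  - exact: oo_integrable.
  - by apply: oo_integrable; exact: cst_continuous.
rewrite /cst Rintegral_cst // (_ : fine _ = b - a) //; exact: (congr1 fine (mu_oo ab)).
Qed.

(** The difference of the averages is at most the L^1 deviation from the mean on the large interval,
    divided by half its length; hence the factor 2. *)
Lemma avg_step (sg p a b a' b' E : R) (h : R -> R * R) (v : R -> R) :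
  0 < sg -> 1 <= p -> 0 <= a -> a < b -> b <= 1 -> meas2 h -> continuous v ->
  (forall x y, `|v x - v y| <= en ((h x).1 - (h y).1, (h x).2 - (h y).2)) ->
  (\int[mu]_(x in oo a b) \int[mu]_(y in oo a b) (gk sg p h x y)%:E <= E%:E)%E ->
  a <= a' -> b' <= b -> b' - a' = (b - a) / 2 ->
  `|avg v a' b' - avg v a b| <= 2 * (b - a) `^ (sg - p^-1) * E `^ p^-1.
Proof.
move=> s0 p1 a0 ab b1 mh cv hv HE aa bb hl.
have ab' : a' < b' by lra.
have l0 : 0 < b - a by rewrite subr_gt0.
have p0 : 0 < p by lra.
have mv : measurable_fun I01 v by apply: continuous_measurable => //.
have E0 : 0 <= E.
  rewrite -lee_fin; apply: le_trans HE; apply: integral_ge0 => x _.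
  by apply: integral_ge0 => y _; rewrite lee_fin gk_ge0.
have [I [I1 I2 I3]] := poincare s0 p1 a0 ab b1 mh mv hv (oo_integrable _ _ cv) HE.
have cvc : continuous (fun y => v y - avg v a b).
  by move=> y; apply: cvgB; [exact: cv|exact: cvg_cst].
rewrite avg_subc // normrM (gtr0_norm (_ : 0 < (b' - a')^-1)) ?invr_gt0 ?subr_gt0 //.
apply: (@le_trans _ _ (I * (b' - a')^-1)).
  rewrite ler_pM2r ?invr_gt0 ?subr_gt0 //.
  apply: (@Rint_sub_le _ _ (oo a b)) => //.
    exact: subset_itvW.
  exact: oo_integrable.
rewrite hl invf_div mulrCA -!mulrA ler_pM2l //.
rewrite mulrC ler_pdivrMl //.
have -> : I = (I `^ p) `^ p^-1 by rewrite -powRrM mulfV ?powRr1 // gt_eqF.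
apply: (@le_trans _ _ (((b - a) `^ (p - 1 + sg * p) * E) `^ p^-1)).
  by apply: powR_le => //; [rewrite invr_ge0 ltW|exact: powR_ge0].
rewrite powRM ?powR_ge0 // -powRrM mulrA.
rewrite -{2}(powRr1 (ltW l0)) -powRD; last by rewrite (gt_eqF l0) implybT.
rewrite le_eqVlt; apply/orP; left; apply/eqP; congr (_ `^ _ * _).
by field; rewrite gt_eqF.
Qed.

(** The numerator comes from halving the interval; the denominator sums the geometric series of
    ratio 2^-(sg - 1/p), which converges when sg > 1/p. *)
Definition morrey_cst (sg p : R) : R := 2 / (1 - 2 `^ (- (sg - p^-1))).

Lemma morrey_ratio (sg p : R) : p^-1 < sg -> 0 < (2 : R) `^ (- (sg - p^-1)) < 1.
Proof.
move=> h; rewrite powR_gt0 //=.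
rewrite /powR ifF; last by rewrite gt_eqF.
by rewrite expR_lt1 mulNr oppr_lt0 mulr_gt0 ?subr_gt0 // ln_gt0 // ltr1n.
Qed.

Lemma dyadic_powR (n : nat) (tau : R) : (2 ^- n) `^ tau = ((2 : R) `^ (- tau)) ^+ n.
Proof.
have h2 : (0 : R) <= 2 by exact: ler0n.
have e1 := powR_invn n h2.
have e2 := powR_mulrn n (powR_ge0 (2 : R) (- tau)).
by rewrite -[LHS]/((2 ^- n) `^ tau) -e1 -e2 -!powRrM; congr (_ `^ _); rewrite mulNr mulrC mulNr.
Qed.

(* Telescoping the averages over intervals shrinking dyadically towards [t]. *)
Lemma morrey_point (sg p a b E t : R) (h : R -> R * R) (v : R -> R) :
  p^-1 < sg -> 1 <= p -> 0 <= a -> a < b -> b <= 1 -> meas2 h -> continuous v ->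
  (forall x y, `|v x - v y| <= en ((h x).1 - (h y).1, (h x).2 - (h y).2)) ->
  (\int[mu]_(x in oo a b) \int[mu]_(y in oo a b) (gk sg p h x y)%:E <= E%:E)%E ->
  a <= t <= b ->
  `|v t - avg v a b| <= morrey_cst sg p * ((b - a) `^ (sg - p^-1) * E `^ p^-1).
Proof.
move=> ps p1 a0 ab b1 mh cv hv HE /andP[ta tb].
have p0 : 0 < p by lra.
have s0 : 0 < sg by apply: lt_trans ps; rewrite invr_gt0.
have [r0 r1] := andP (morrey_ratio ps); set r := 2 `^ _ in r0 r1.
have l0 : 0 < b - a by rewrite subr_gt0.
pose d n : R := 2 ^- n.
have d0 n : 0 < d n by rewrite invr_gt0 exprn_gt0.
have d1 n : d n <= 1 by rewrite invf_le1 ?exprn_gt0 // exprn_ege1 // ler1n.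
have dS n : d n.+1 = d n / 2 by rewrite /d exprS invfM mulrC.
(* The point t divides every interval in the same ratio, so the argument also covers t at an end. *)
pose an n := t - (t - a) * d n; pose bn n := t + (b - t) * d n.
have bna n : bn n - an n = (b - a) * d n by rewrite /an /bn; ring.
have abn n : an n < bn n by rewrite -subr_gt0 bna mulr_gt0.
have an_ge n : a <= an n by rewrite /an; have := d1 n; nra.
have bn_le n : bn n <= b by rewrite /bn; have := d1 n; nra.
set K := _ * _.
have KE : K * (1 - r) = 2 * (b - a) `^ (sg - p^-1) * E `^ p^-1.
  by rewrite /K /morrey_cst -/r; field; rewrite subr_eq0 gt_eqF.
have K0 : 0 <= K.
  by rewrite /K /morrey_cst -/r !mulr_ge0 ?powR_ge0 // invr_ge0 subr_ge0 ltW.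
have step n : `|avg v (an n.+1) (bn n.+1) - avg v (an n) (bn n)| <= K * (1 - r) * r ^+ n.
  have -> : K * (1 - r) * r ^+ n = 2 * (bn n - an n) `^ (sg - p^-1) * E `^ p^-1.
    rewrite KE bna powRM ?(ltW l0) ?(ltW (d0 n)) //.
    have -> : d n `^ (sg - p^-1) = r ^+ n by exact: dyadic_powR.
    by ring.
  have HEn : (\int[mu]_(x in oo (an n) (bn n)) \int[mu]_(y in oo (an n) (bn n))
      (gk sg p h x y)%:E <= E%:E)%E.
    exact: le_trans (energy_mono _ _ _ (an_ge n) (bn_le n)) HE.
  have e1 : 0 <= an n by exact: le_trans (an_ge n).
  have e2 : bn n <= 1 by exact: le_trans (bn_le n) _.
  have e3 : an n <= an n.+1 by rewrite /an dS; have := d0 n; nra.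
  have e4 : bn n.+1 <= bn n by rewrite /bn dS; have := d0 n; nra.
  have e5 : bn n.+1 - an n.+1 = (bn n - an n) / 2 by rewrite !bna dS mulrA.
  exact: (avg_step s0 p1 e1 (abn n) e2 mh cv hv HEn e3 e4 e5).
have tel n : `|avg v (an n) (bn n) - avg v a b| <= K * (1 - r ^+ n).
  elim: n => [|n IH].
    have -> : an 0%N = a by rewrite /an /d expr0 invr1 mulr1 subKr.
    have -> : bn 0%N = b by rewrite /bn /d expr0 invr1 mulr1 addrC subrK.
    by rewrite subrr normr0 expr0 subrr mulr0.
  have := step n; rewrite exprS.
  have := ler_normD (avg v (an n.+1) (bn n.+1) - avg v (an n) (bn n))
    (avg v (an n) (bn n) - avg v a b).
  rewrite addrA subrK; move: IH; set u := r ^+ n; lra.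
apply/ler_addgt0Pl => e e0.
have /cvgrPdist_le /(_ e e0) := cv t.
move=> /nbhs_ballP[del /= del0 Hd].
have [n Hn] : exists n, d n < del.
  have del1 : 0 < del^-1 by rewrite invr_gt0.
  exists (Num.truncn del^-1).+1.
  rewrite /d -[ltRHS]invrK ltf_pV2 ?posrE ?exprn_gt0 //.
  apply: (lt_le_trans (truncnS_gt _)); rewrite -natrX ler_nat.
  by apply: ltnW; exact: ltn_expl.
have hA : `|avg v (an n) (bn n) - v t| <= e.
  apply: avg_near => // x /andP[x1 x2]; rewrite distrC; apply: Hd.
  rewrite /ball /= distrC ltr_norml; apply/andP; split.
    by move: x1; rewrite /an; have := d0 n; nra.
  by move: x2; rewrite /bn; have := d0 n; nra.
have := tel n; have := ler_normD (v t - avg v (an n) (bn n)) (avg v (an n) (bn n) - avg v a b).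
rewrite addrA subrK distrC in hA *.
have : 0 <= r ^+ n by rewrite exprn_ge0 // ltW.
nra.
Qed.

Lemma morrey (sg p a b E t t' : R) (h : R -> R * R) (v : R -> R) :
  p^-1 < sg -> 1 <= p -> 0 <= a -> a < b -> b <= 1 -> meas2 h -> continuous v ->
  (forall x y, `|v x - v y| <= en ((h x).1 - (h y).1, (h x).2 - (h y).2)) ->
  (\int[mu]_(x in oo a b) \int[mu]_(y in oo a b) (gk sg p h x y)%:E <= E%:E)%E ->
  a <= t <= b -> a <= t' <= b ->
  `|v t - v t'| `^ p <= (2 * morrey_cst sg p) `^ p * ((b - a) `^ (sg * p - 1) * E).
Proof.
move=> ps p1 a0 ab b1 mh cv hv HE ht ht'.
have p0 : 0 < p by lra.
have l0 : 0 < b - a by rewrite subr_gt0.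
have [r0 r1] := andP (morrey_ratio ps).
have h1 := morrey_point ps p1 a0 ab b1 mh cv hv HE ht.
have h2 := morrey_point ps p1 a0 ab b1 mh cv hv HE ht'.
have E0 : 0 <= E.
  rewrite -lee_fin; apply: le_trans HE; apply: integral_ge0 => x _.
  by apply: integral_ge0 => y _; rewrite lee_fin gk_ge0.
have C0 : 0 <= 2 * morrey_cst sg p.
  by rewrite /morrey_cst !mulr_ge0 // invr_ge0 subr_ge0 ltW.
set X := (b - a) `^ (sg - p^-1) * E `^ p^-1 in h1 h2.
have X0 : 0 <= X by rewrite /X mulr_ge0 // powR_ge0.
have XE : X `^ p = (b - a) `^ (sg * p - 1) * E.
  rewrite /X powRM ?powR_ge0 // -!powRrM mulVf ?gt_eqF // powRr1 //.
  by rewrite mulrBl mulVf // gt_eqF.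
rewrite -XE -powRM //; apply: powR_le => //; first exact: ltW.
have := ler_normB (v t - avg v a b) (v t' - avg v a b).
rewrite (_ : _ - _ - (_ - _) = v t - v t'); last by ring.
by move=> h3; apply: (le_trans h3); lra.
Qed.

End Morrey.

(** * Weak derivatives on the circle *)

Section WeakDerivative.
Variable R : realType.
Local Notation mu := (@lebesgue_measure R).
Local Notation I01 := (`[0%R, 1%R]%classic : set R).
Local Notation oo a b := (`]a, b[%classic : set R).

Lemma cos_gap (u rho : R) :
  cos (2 * pi * u) - cos (2 * pi * rho) = 2 * sin (pi * (rho + u)) * sin (pi * (rho - u)).
Proof.
rewrite (_ : 2 * pi * u = pi * (rho + u) - pi * (rho - u)); last by ring.
rewrite (_ : 2 * pi * rho = pi * (rho + u) + pi * (rho - u)); last by ring.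
by rewrite cosB cosD; ring.
Qed.

Lemma cos_gap_gt0 (u rho : R) : rho <= 2^-1 -> `|u| < rho ->
  0 < cos (2 * pi * u) - cos (2 * pi * rho).
Proof.
rewrite ltr_norml => r1 /andP[u1 u2]; rewrite cos_gap; have := pi_gt0 R => pi0.
by rewrite !mulr_gt0 // sin_gt0_pi //; apply/andP; split; nra.
Qed.

Lemma cos_gap_le0 (u rho : R) : 0 <= rho -> rho <= `|u| -> `|u| <= 1 - rho ->
  cos (2 * pi * u) - cos (2 * pi * rho) <= 0.
Proof.
move=> r0; wlog u0 : u / 0 <= u.
  move=> W; case/orP: (le_total 0 u) => [/W//|u0 h1 h2].
  by have := W (- u); rewrite oppr_ge0 normrN mulrN cosN; apply.
rewrite ger0_norm // => h1 h2; rewrite cos_gap; have := pi_gt0 R => pi0.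
have s1 : 0 <= sin (pi * (rho + u)) by apply: sin_ge0_pi; apply/andP; split; nra.
have s2 : sin (pi * (rho - u)) <= 0.
  rewrite -oppr_ge0 -sinN; apply: sin_ge0_pi; apply/andP; split; nra.
nra.
Qed.

Lemma cos_period1 (u : R) : cos (2 * pi * (u + 1)) = cos (2 * pi * u).
Proof.
rewrite (_ : 2 * pi * (u + 1) = 2 * pi * u + pi *+ 2) ?cosD2pi //.
by rewrite -mulr_natl; ring.
Qed.

(* Periodic; positive exactly at distance less than rho from c + Z, and tending to the indicator
   of that set as n goes to infinity. *)
Definition bump (n c rho x : R) : R :=
  flatexp 0 (n * (cos (2 * pi * (x - c)) - cos (2 * pi * rho))).

Lemma smooth_affine (a b : R) : smooth_fun (fun x : R => a * (x - b)).
Proof.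
apply: smoothM; first exact: smooth_cst.
by apply: smoothB; [exact: smooth_id|exact: smooth_cst].
Qed.

Lemma bump_smooth n c rho : smooth_fun (bump n c rho).
Proof.
apply: (smooth_comp (@smooth_flatexp R 0)).
apply: smoothM; first exact: smooth_cst.
apply: smoothB; last exact: smooth_cst.
exact: (smooth_comp (@smooth_cos R) (@smooth_affine (2 * pi) c)).
Qed.

Lemma bump_periodic n c rho : periodic1 (bump n c rho).
Proof. by move=> x; rewrite /bump addrAC cos_period1. Qed.

Lemma bump_ge0 n c rho x : 0 <= bump n c rho x.
Proof. exact: flatexp_ge0. Qed.

Lemma bump_le1 n c rho x : bump n c rho x <= 1.
Proof. exact: flatexp0_le1. Qed.

Lemma periodic_derive1n (u : R -> R) k : smooth_fun u -> periodic1 u -> periodic1 (derive1n k u).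
Proof.
move=> su pu; elim: k => [//|k IH] x.
have sk := smooth_derive1n (n := k) su.
have h1 := has_drvE (smooth_drv sk).
have h : is_derive x (1 : R) (fun y => derive1n k u (y + 1)) (derive1n k.+1 u (x + 1)).
  have hs := is_deriveD (is_derive_id x (1 : R)) (is_derive_cst (1 : R) x (1 : R)).
  have := @is_derive1_comp R (derive1n k u) (fun y => y + 1) x _ _ (h1 (x + 1)) hs.
  by move=> H; apply: (is_derive_subst H); rewrite addr0 mulr1.
have E : (fun y => derive1n k u (y + 1)) = derive1n k u by apply/funext => y; exact: IH.
move: h; rewrite E => -[_ h2]; case: (h1 x) => _ h3.
exact: (etrans (esym h2) h3).
Qed.

Lemma cont_bounded (f : R -> R) : continuous f ->
  exists2 M : R, 0 <= M & forall x, I01 x -> `|f x| <= M.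
Proof.
move=> cf; have cn : {within `[0, 1], continuous (fun x => `|f x|)}.
  by apply: continuous_subspaceT => x; apply: cvg_norm; exact: cf.
have [c _ Hc] := EVT_max ler01 cn.
by exists `|f c| => // x Ix; exact: Hc.
Qed.

Lemma integrable_mulc (u f : R -> R) : mu.-integrable I01 (EFin \o u) -> continuous f ->
  mu.-integrable I01 (EFin \o (fun x => u x * f x)).
Proof.
move=> iu cf; have [M M0 HM] := cont_bounded cf.
have mI : measurable I01 by exact: measurable_itv.
have mu' : measurable_fun I01 u by case/integrableP: iu => /measurable_EFinP.
have iM : mu.-integrable I01 (fun x => M%:E * (EFin \o u) x)%E by apply: integrableZl.
apply: (le_integrable _ _ _ iM) => //.
  apply/measurable_EFinP; apply: measurable_funM => //.
  exact: continuous_measurable.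
move=> x Ix /=; rewrite lee_fin !normrM mulrC (ger0_norm M0).
by apply: ler_wpM2r => //; exact: HM.
Qed.

Lemma fin_int (u : R -> R) : mu.-integrable I01 (EFin \o u) ->
  (\int[mu]_(x in I01) (u x)%:E)%E = (\int[mu]_(x in I01) u x)%:E.
Proof.
by move=> iu; rewrite /Rintegral fineK //; apply: (integrable_fin_num _ iu).
Qed.

Lemma weak_derivB (u v u' v' : R -> R) :
  mu.-integrable I01 (EFin \o u) -> mu.-integrable I01 (EFin \o u') ->
  mu.-integrable I01 (EFin \o v) -> mu.-integrable I01 (EFin \o v') ->
  weak_deriv u u' -> weak_deriv v v' ->
  weak_deriv (fun x => u x - v x) (fun x => u' x - v' x).
Proof.
move=> iu iu' iv iv' wu wv phi sphi pphi.
have cphi := smooth_cont sphi; have cphi' := smooth_cont (smooth_derive1 sphi).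
have mI : measurable I01 by exact: measurable_itv.
have h1 := wu phi sphi pphi; have h2 := wv phi sphi pphi.
under eq_integral do rewrite mulrBl EFinB.
under [in RHS]eq_integral do rewrite mulrBl EFinB.
have a1 := integrable_mulc iu cphi'; have a2 := integrable_mulc iv cphi'.
have a3 := integrable_mulc iu' cphi; have a4 := integrable_mulc iv' cphi.
rewrite !integralB //= h1 h2 !fin_int //.
by rewrite -!EFinN -!EFinD; congr (_%:E); ring.
Qed.

Lemma smooth_weak_deriv (u : R -> R) : smooth_fun u -> u 0 = u 1 ->
  weak_deriv u (derive1 u).
Proof.
move=> su u01 phi sphi pphi.
have cphi := smooth_cont sphi; have cphi' := smooth_cont (smooth_derive1 sphi).
have cu := smooth_cont su; have cu' := smooth_cont (smooth_derive1 su).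
have mI : measurable I01 by exact: measurable_itv.
have iu := cont_integrable 0 1 cu; have iu' := cont_integrable 0 1 cu'.
have a1 := integrable_mulc iu cphi'; have a2 := integrable_mulc iu' cphi.
have := has_drv_FTC2 (@ler01 R) (has_drvM (smooth_drv su) (smooth_drv sphi)).
have phi01 : phi 1 = phi 0 by rewrite -[in LHS](add0r 1) pphi.
rewrite phi01 u01 subrr => H.
have {H} : (\int[mu]_(x in I01) ((derive1 u x * phi x)%:E + (u x * derive1 phi x)%:E) = 0)%E.
  under eq_integral do rewrite -EFinD.
  apply: H => x; apply: cvgD; apply: cvgM; [exact: cu'|exact: cphi|exact: cu|exact: cphi'].
rewrite integralD //= !fin_int // -EFinD -EFinN => -[] H.
by congr (_%:E); lra.
Qed.

Lemma weak_deriv_iter (g : nat -> R -> R) (k : nat) (phi : R -> R) :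
  (forall j, (j < k)%N -> weak_deriv (g j) (g j.+1)) ->
  smooth_fun phi -> periodic1 phi ->
  \int[mu]_(x in I01) (g 0%N x * derive1n k phi x) =
  (-1) ^+ k * \int[mu]_(x in I01) (g k x * phi x).
Proof.
move=> H; elim: k phi H => [|k IH] phi H sphi pphi; first by rewrite expr0 mul1r.
have -> : derive1n k.+1 phi = derive1n k (derive1 phi) by rewrite derive1Sn.
rewrite IH; first last.
- exact: (@periodic_derive1n phi 1).
- exact: smooth_derive1.
- by move=> j jk; apply: H; exact: ltnW.
have h := congr1 fine (H k (ltnSn k) phi sphi pphi).
by rewrite exprSr -mulrA; congr (_ * _); rewrite mulN1r /Rintegral h fineN.
Qed.

(** Inside the interval the bump is exp(-1/(n q)) with q > 0, squeezed between 1 - 1/(n q) and 1;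
    outside it is 0 for every n. *)
Lemma bump_cvg (a b x : R) : 0 <= a -> a < b -> b <= 1 -> I01 x ->
  bump n.+1%:R ((a + b) / 2) ((b - a) / 2) x @[n --> \oo] --> (\1_(oo a b) x : R).
Proof.
move=> a0 ab b1; rewrite /= in_itv /= => /andP[x0 x1].
have nab : `|x - (a + b) / 2| < (b - a) / 2 <-> a < x < b.
  rewrite ltr_norml; split=> /andP[h1 h2]; apply/andP; split; lra.
rewrite indicE; have [h|h] := boolP (a < x < b).
  rewrite mem_set ?in_itv //=.
  have q0 := cos_gap_gt0 (_ : (b - a) / 2 <= 2^-1) (nab.2 h).
  have {}q0 := q0 ltac:(lra); set q := _ - _ in q0.
  apply: (@squeeze_cvgr _ _ _ _ (fun n => 1 - q^-1 * n.+1%:R^-1) (cst 1)).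
  - near=> n; rewrite bump_le1 andbT /bump -/q.
    rewrite flatexp_gt0E ?mulr_gt0 // expr0 mul1r invfM mulrC.
    exact: expR_ge1Dx.
  - rewrite -[X in _ --> X]subr0 -(mulr0 q^-1).
    apply: cvgB; first exact: cvg_cst.
    by apply: cvgMl_tmp; exact: cvg_harmonic.
  - exact: cvg_cst.
rewrite memNset; last by rewrite /= in_itv /=; exact/negP.
have hh : (b - a) / 2 <= `|x - (a + b) / 2|.
  by rewrite leNgt; apply/negP => /nab; exact/negP.
have h2 : `|x - (a + b) / 2| <= 1 - (b - a) / 2.
  rewrite ler_norml; apply/andP; split; lra.
have q0 := cos_gap_le0 (_ : 0 <= (b - a) / 2) hh h2.
have {}q0 := q0 ltac:(lra).
apply: (@cvg_trans _ (nbhs (cst (0:R) n @[n --> \oo]))).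
  apply: near_eq_cvg; near=> n; rewrite /bump flatexp_le0E //.
  by rewrite mulr_ge0_le0.
exact: cvg_cst.
Unshelve. all: by end_near. Qed.

(** The indicator of an interval is a bounded pointwise limit of admissible test functions, so
    dominated convergence applies. *)
Lemma test_oo (w : R -> R) (a b : R) : 0 <= a -> a < b -> b <= 1 ->
  mu.-integrable I01 (EFin \o w) ->
  (forall phi, smooth_fun phi -> periodic1 phi ->
     \int[mu]_(x in I01) (w x * phi x) = 0) ->
  \int[mu]_(x in oo a b) w x = 0.
Proof.
move=> a0 ab b1 iw H.
have mI : measurable I01 by exact: measurable_itv.
have mJ : measurable (oo a b) by exact: measurable_itv.
have mw : measurable_fun I01 w by case/integrableP: iw => /measurable_EFinP.
pose F (n : nat) (x : R) := (w x * bump n.+1%:R ((a + b) / 2) ((b - a) / 2) x)%:E.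
pose f (x : R) := (w x * \1_(oo a b) x)%:E.
have := @dominated_convergence _ _ R mu I01 mI F f (fun x => `|(w x)%:E|%E).
case.
- move=> n; apply/measurable_EFinP; apply: measurable_funM => //.
  apply: continuous_measurable => //; apply: smooth_cont; exact: bump_smooth.
- by apply/measurable_EFinP; apply: measurable_funM.
- apply: aeW => x Ix; apply: cvg_EFin; first by near=> n.
  by apply: cvgMl_tmp; exact: bump_cvg.
- exact: integrable_abse.
- apply: aeW => x n Ix; rewrite /F /= lee_fin normrM ler_piMr //.
  by rewrite ger0_norm ?bump_ge0 ?bump_le1.
move=> _ _.
have -> : [sequence (\int[mu]_(x in I01) F n x)%E]_n = cst 0%E.
  apply/funext => n /=; rewrite /F fin_int; last first.
    by apply: integrable_mulc => //; apply: smooth_cont; exact: bump_smooth.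
  by rewrite H //; [exact: bump_smooth|exact: bump_periodic].
move=> hc.
have E : (\int[mu]_(x in I01) f x = 0)%E by rewrite -(cvg_lim _ hc) ?lim_cst.
rewrite /Rintegral (_ : (\int[mu]_(x in oo a b) (w x)%:E = 0)%E) //.
rewrite -E integral_mkcond [RHS]integral_mkcond; apply: eq_integral => x _.
rewrite /f /patch indicE; case: (boolP (x \in oo a b)) => xJ.
  rewrite ifT ?mulr1 //; apply/mem_set; apply: (oo_I01 a0 b1); exact/set_mem.
by rewrite mulr0; case: ifP.
Unshelve. all: by end_near. Qed.

End WeakDerivative.

(** * Lower bound for smooth maps *)

Section Blocks.
Variable R : realType.
Local Notation mu := (@lebesgue_measure R).
Local Notation I01 := (`[0%R, 1%R]%classic : set R).
Local Notation oo a b := (`]a, b[%classic : set R).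

Lemma smooth_rolle (f : R -> R) (a b : R) : smooth_fun f -> a < b -> f a = f b ->
  exists c, a < c < b /\ derive1 f c = 0.
Proof.
move=> sf ab fab; have hf := smooth_drv sf.
have [||c] := @Rolle R f a b ab _ _ fab.
- by move=> x _; exact: has_drv_ex hf.
- by apply: continuous_subspaceT; exact: smooth_cont.
rewrite in_itv /= => hc [_ h]; exists c; split => //.
by rewrite derive1E.
Qed.

(** Rolle's theorem j times. The localization of the new zeros between z_i and z_(i+j) is carried
    along, since it must be known on which side of a peak they lie. *)
Lemma rolle_seq (v : R -> R) (n : nat) (z : nat -> R) : smooth_fun v ->
  (forall i, (i < n)%N -> z i < z i.+1) -> (forall i, (i <= n)%N -> v (z i) = 0) ->
  forall j, (j <= n)%N -> exists y : nat -> R,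
    (forall i, (i + j < n)%N -> y i < y i.+1) /\
    (forall i, (i + j <= n)%N -> derive1n j v (y i) = 0 /\ z i <= y i <= z (i + j)%N).
Proof.
move=> sv zi z0; elim=> [|j IH] jn.
  exists z; split=> i; rewrite addn0 => h; first exact: zi.
  by split; [exact: z0|rewrite lexx].
have [y [y1 y2]] := IH (ltnW jn).
have /choice[y' Hy'] : forall i, exists c, (i + j.+1 <= n)%N ->
    y i < c < y i.+1 /\ derive1n j.+1 v c = 0.
  move=> i; case: (leqP (i + j.+1) n) => h; last by exists 0.
  rewrite addnS in h.
  have [|c [c1 c2]] := smooth_rolle (smooth_derive1n (n := j) sv) (y1 i h).
    by rewrite (y2 i (ltnW h)).1 (y2 i.+1 h).1.
  by exists c.
exists y'; split=> i h.
  have [/andP[_ h1] _] := Hy' i (ltnW h).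
  have [/andP[h2 _] _] := Hy' i.+1 h.
  exact: lt_trans h1 h2.
have [/andP[h1 h2] h3] := Hy' i h; split => //.
rewrite addnS in h; have [_ /andP[h4 _]] := y2 i (ltnW h).
have [_ /andP[_ h5]] := y2 i.+1 h; rewrite addnS -addSn.
by rewrite (le_trans h4 (ltW h1)) (le_trans (ltW h2) h5).
Qed.

(* Mean value theorem, m times, each time starting from a zero of the previous derivative. *)
Lemma peak_chain (v : R -> R) (a b q : R) (m : nat) : smooth_fun v -> a <= b ->
  a <= q <= b -> 1 <= `|v q| ->
  (forall j, (j < m)%N -> exists2 y, a <= y <= b & derive1n j v y = 0) ->
  exists2 c, a <= c <= b & 1 <= `|derive1n m v c| * (b - a) ^+ m.
Proof.
move=> sv ab qab vq; elim: m => [|m IH] H.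
  by exists q => //; rewrite expr0 mulr1.
have [j jm|c cab hc] := IH; first by apply: H; exact: ltnW.
have [y yab y0] := H m (ltnSn m).
have hd := smooth_drvn m sv.
have key u w : a <= u -> u <= w -> w <= b ->
    exists2 x, a <= x <= b & derive1n m v w - derive1n m v u = derive1n m.+1 v x * (w - u).
  move=> au uw wb; have [x /andP[x1 x2] ->] := has_drv_MVT hd uw.
  by exists x => //; rewrite (le_trans au x1) (le_trans x2 wb).
have [x xab hx] : exists2 x, a <= x <= b &
    `|derive1n m v c| <= `|derive1n m.+1 v x| * (b - a).
  have /andP[a1 b1] := cab; have /andP[a2 b2] := yab.
  case/orP: (le_total y c) => yc.
    have [x xab] := key _ _ a2 yc b1; rewrite y0 subr0 => ->; exists x => //.
    by rewrite normrM ler_wpM2l // ger0_norm ?subr_ge0 // lerB.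
  have [x xab] := key _ _ a1 yc b2; rewrite y0 sub0r => E; exists x => //.
  by rewrite -normrN E normrM ler_wpM2l // ger0_norm ?subr_ge0 // lerB.
exists x => //; apply: (le_trans hc); rewrite exprS mulrA.
by rewrite ler_wpM2r // exprn_ge0 // subr_ge0.
Qed.

(** The zeros z_0, ..., z_k give a zero a of the k-th derivative left of the peak, z_(2k+2), ...,
    z_(3k+2) a zero b right of it, and the zeros from z_(k+1) on give one of each lower derivative
    in between, from which [peak_chain] starts. *)
Lemma zeros_block (v : R -> R) (k : nat) (z : nat -> R) (q : R) : smooth_fun v ->
  (forall i, (i < 3 * k.+1)%N -> z i < z i.+1) ->
  (forall i, (i <= 3 * k.+1)%N -> v (z i) = 0) ->
  z k.+1 <= q <= z k.+2 -> 1 <= `|v q| ->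
  exists a b c, [/\ z 0%N <= a, a < b, b <= z (3 * k.+1)%N, a <= c <= b &
    [/\ derive1n k v a = 0, derive1n k v b = 0 &
        1 <= `|derive1n k v c| * (b - a) ^+ k]].
Proof.
move=> sv zi z0 /andP[q1 q2] vq.
have zmono i j : (i <= j)%N -> (j <= 3 * k.+1)%N -> z i <= z j.
  elim: j => [|j IH]; first by rewrite leqn0 => /eqP ->.
  rewrite leq_eqVlt => /orP[/eqP -> //|ij] jn.
  by apply: (le_trans (IH ij (ltnW jn))); apply/ltW/zi.
have k3 : (k <= 3 * k.+1)%N by clear; lia.
have [y [y1 y2]] := rolle_seq sv zi z0 k3.
have l1 : (0 + k <= 3 * k.+1)%N by clear; lia.
have l2 : ((2 * k.+1) + k <= 3 * k.+1)%N by clear; lia.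
have l3 : (k.+2 <= 2 * k.+1)%N by clear; lia.
have l5 : (2 * k.+1 <= 3 * k.+1)%N by clear; lia.
have l6 : (k.+1 < 3 * k.+1)%N by clear; lia.
have l7 : (0 + k <= k.+1)%N by clear; lia.
have [ya0 /andP[ya1 ya2]] := y2 _ l1; have [yb0 /andP[yb1 yb2]] := y2 _ l2.
have aK : y 0%N <= z k.+1 by apply: (le_trans ya2); apply: (zmono _ _ l7); exact: ltnW.
have Kb : z (2 * k.+1)%N <= y (2 * k.+1)%N by [].
have zz : z k.+1 < z k.+2 by exact: zi.
have z2 : z k.+2 <= z (2 * k.+1)%N by exact: zmono.
have ab : y 0%N < y (2 * k.+1)%N.
  by apply: (le_lt_trans aK); apply: (lt_le_trans zz); apply: (le_trans z2).
have b3 : y (2 * k.+1)%N <= z (3 * k.+1)%N by apply: (le_trans yb2); exact: zmono.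
have qab : y 0%N <= q <= y (2 * k.+1)%N.
  by rewrite (le_trans aK q1) (le_trans q2 (le_trans z2 Kb)).
have [j jk|c cab hc] := @peak_chain v _ _ q k sv (ltW ab) qab vq.
  have jn : (j <= 3 * k.+1)%N by clear -jk; lia.
  have [w [w1 w2]] := rolle_seq sv zi z0 jn.
  have lj : (k.+1 + j <= 3 * k.+1)%N by clear -jk; lia.
  have lj2 : (k.+1 + j <= 2 * k.+1)%N by clear -jk; lia.
  have [w0 /andP[w3 w4]] := w2 _ lj; exists (w k.+1) => //.
  rewrite (le_trans aK w3) /=; apply: (le_trans w4); apply: le_trans Kb.
  exact: zmono.
by exists (y 0%N), (y (2 * k.+1)%N), c; split.
Qed.

(** Replaces a block when there are too few zeros. An oscillation of size 1 within length at most 1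
    forces a slope of size 1, while by Rolle's theorem and periodicity the same derivative vanishes
    somewhere: so it oscillates by 1 too. *)
Lemma periodic_osc (v : R -> R) (k : nat) : smooth_fun v ->
  (forall j, derive1n j v 0 = derive1n j v 1) ->
  (exists x y, [/\ 0 <= x, x <= y, y <= 1 & 1 <= `|v y - v x|]) ->
  exists x y, [/\ 0 <= x, x <= y, y <= 1 & 1 <= `|derive1n k v y - derive1n k v x|].
Proof.
move=> sv pv; elim: k => [//|k IH] /IH[x [y [x0 xy y1 h]]].
have [c /andP[c1 c2] hc] := has_drv_MVT (smooth_drvn k sv) xy.
have [d [/andP[d0 d1] hd]] := smooth_rolle (smooth_derive1n (n := k) sv) ltr01 (pv k).
have hc1 : 1 <= `|derive1n k.+1 v c|.
  rewrite hc normrM (ger0_norm (_ : 0 <= y - x)) ?subr_ge0 // in h.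
  apply: (le_trans h); rewrite ler_piMr //; lra.
have c01 : 0 <= c <= 1 by apply/andP; split; lra.
have /andP[c0 c1'] := c01.
case/orP: (le_total c d) => cd.
  exists c, d; split => //; first exact: ltW.
  by rewrite (_ : derive1n k.+1 v d = 0) // sub0r normrN.
exists d, c; split => //; first exact: ltW.
by rewrite (_ : derive1n k.+1 v d = 0) // subr0.
Qed.

End Blocks.

(** * Energy of a block and summation over blocks *)

Section Energy.
Variable R : realType.
Local Notation mu := (@lebesgue_measure R).
Local Notation I01 := (`[0%R, 1%R]%classic : set R).
Local Notation oo a b := (`]a, b[%classic : set R).

Definition energy (sg p : R) (W : R -> R * R) (a b : R) : \bar R :=
  if 0 < sg then (\int[mu]_(x in oo a b) \int[mu]_(y in oo a b) (gk sg p W x y)%:E)%E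
  else (\int[mu]_(x in oo a b) (en (W x) `^ p)%:E)%E.

(* [v] plays the role of the k-th derivative of [u]. *)
Definition link (k : nat) (u v : R -> R) : Prop :=
  if k is k'.+1 then
    mu.-integrable I01 (EFin \o v) /\
    forall a b, 0 <= a -> a <= b -> b <= 1 ->
      \int[mu]_(x in oo a b) v x = derive1n k' u b - derive1n k' u a
  else exists c, forall x, v x = u x - c.

Definition dominated (v : R -> R) (W : R -> R * R) : Prop :=
  (forall x y, `|v x - v y| <= en ((W x).1 - (W y).1, (W x).2 - (W y).2)) /\
  (forall x, `|v x| <= en (W x)).

(** Equal end values make the order-k function v have mean zero on the interval, and the inner
    increment is a partial integral of v. For k = 0 Morrey's inequality works with a plain
    oscillation. *)
Definition oscillates (k : nat) (u : R -> R) (a b : R) : Prop :=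
  if k is k'.+1 then
    derive1n k' u a = derive1n k' u b /\
    exists a' c', [/\ a <= a', a' <= c', c' <= b &
      1 <= `|derive1n k' u c' - derive1n k' u a'| * (b - a) ^+ k']
  else exists t t', [/\ a <= t <= b, a <= t' <= b & 1 <= `|u t - u t'|].

Definition lower_cst (k : nat) (sg p : R) : R :=
  if k is 0%N then (2 * morrey_cst sg p) `^ p else 1.

Lemma lower_cst_gt0 k sg p : (k = 0%N -> p^-1 < sg) -> 0 < lower_cst k sg p.
Proof.
case: k => [|k] h; last exact: ltr01.
have [r0 r1] := andP (morrey_ratio (h erefl)).
by rewrite /lower_cst powR_gt0 // /morrey_cst !mulr_gt0 // invr_gt0 subr_gt0.
Qed.

Lemma energy_sub (sg p a b a' b' : R) (W : R -> R * R) : a <= a' -> b' <= b ->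
  (energy sg p W a' b' <= energy sg p W a b)%E.
Proof.
move=> aa bb; rewrite /energy; case: ifP => _; first exact: energy_mono.
apply: le_int_mono => [x _|]; first by rewrite lee_fin powR_ge0.
exact: subset_itvW.
Qed.

Lemma energy_ge0 sg p W a b : (0 <= energy sg p W a b)%E.
Proof.
rewrite /energy; case: ifP => _; apply: integral_ge0 => x _; last by rewrite lee_fin powR_ge0.
by apply: integral_ge0 => y _; rewrite lee_fin gk_ge0.
Qed.

(** Order 0 rests on Morrey's inequality, higher orders on the Poincare inequality or, for sg = 0,
    on Jensen's. All cases carry the power s p - 1 of the length, where s = k + sg, as scaling
    demands. *)
Lemma interval_lower (k : nat) (sg p a b E : R) (W : R -> R * R) (u v : R -> R) :
  0 <= sg -> 1 <= p -> (k = 0%N -> p^-1 < sg) -> 0 <= a -> a < b -> b <= 1 ->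
  meas2 W -> measurable_fun I01 v -> dominated v W -> smooth_fun u -> link k u v ->
  oscillates k u a b -> (energy sg p W a b <= E%:E)%E ->
  1 <= lower_cst k sg p * ((b - a) `^ ((k%:R + sg) * p - 1) * E).
Proof.
move=> s0 p1 hk a0 ab b1 mW mv [d1 d2] su hl ho HE.
have l0 : 0 < b - a by rewrite subr_gt0.
have p0 : 0 < p by lra.
have one_p : (1 : R) `^ p = 1 by rewrite powR1.
case: k hk hl ho => [|k] hk hl ho.
  have ps := hk erefl; have [t [t' [ht ht' h1]]] := ho; have [c vc] := hl.
  have s1 : 0 < sg by apply: lt_trans ps; rewrite invr_gt0.
  have cv : continuous v.
    have -> : v = (fun x => u x - c) by apply/funext.
    by move=> x; apply: cvgB; [exact: smooth_cont|exact: cvg_cst].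
  rewrite /energy s1 in HE.
  have := morrey ps p1 a0 ab b1 mW cv d1 HE ht ht'.
  rewrite add0r /lower_cst; apply: le_trans.
  rewrite !vc (_ : _ - _ - _ = u t - u t'); last by ring.
  by rewrite -[leLHS]one_p; apply: powR_le => //; lra.
have [iv IV] := hl; have [Vab [a' [c' [aa ac cb hM]]]] := ho.
set M := `|_ - _| in hM; have M0 : 0 <= M by exact: normr_ge0.
have ivJ : mu.-integrable (oo a b) (EFin \o v).
  by apply: integrableS iv => //; exact: oo_I01.
have HM : M <= `|\int[mu]_(y in oo a' c') v y|.
  by rewrite IV //; [exact: le_trans aa|exact: le_trans b1].
have v0 : \int[mu]_(y in oo a b) v y = 0.
  by rewrite (IV a b a0 (ltW ab) b1) Vab subrr.
have key : M `^ p <= (b - a) `^ (p - 1 + sg * p) * E.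
  move: HE; rewrite /energy; case: ifPn => s1 HE.
    exact: (mean_zero_lower s1 p1 a0 ab b1 mW mv d1 ivJ v0 aa cb M0 HM HE).
  have sg0 : sg = 0 by apply/eqP; rewrite eq_le s0 leNgt s1.
  rewrite sg0 mul0r addr0.
  apply: (Lp_lower p1 a0 ab b1 mv ivJ aa cb M0 HM).
  apply: le_trans HE; apply: le_int => x _; first by rewrite lee_fin powR_ge0.
  by rewrite lee_fin; apply: powR_le => //; exact: ltW.
rewrite /lower_cst mul1r.
have -> : (k.+1%:R + sg) * p - 1 = (p - 1 + sg * p) + k%:R * p.
  by rewrite -natr1; ring.
rewrite powRD; last by rewrite (gt_eqF l0) implybT.
rewrite powRrM powR_mulrn ?(ltW l0) // mulrAC.
apply: (@le_trans _ _ (M `^ p * ((b - a) ^+ k) `^ p)).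
  rewrite -powRM // ?exprn_ge0 ?(ltW l0) // -[leLHS]one_p.
  by apply: powR_le => //; exact: ltW.
by rewrite ler_wpM2r // powR_ge0.
Qed.

Lemma int_super (Psi : R -> \bar R) (n : nat) (t : nat -> R) :
  measurable_fun I01 Psi -> (forall x, 0 <= Psi x)%E ->
  (forall i, (i < n)%N -> t i < t i.+1) -> 0 <= t 0%N -> t n <= 1 ->
  (\sum_(i < n) \int[mu]_(x in oo (t i) (t i.+1)) Psi x <=
   \int[mu]_(x in oo (t 0%N) (t n)) Psi x)%E.
Proof.
move=> mP P0; elim: n => [|n IH] ti t0 t1.
  by rewrite big_ord0; apply: integral_ge0.
have tn : t n < t n.+1 by exact: ti.
have t0n : t 0%N <= t n.
  have : forall m, (m <= n)%N -> t 0%N <= t m.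
    elim=> [//|m IHm] mn; apply: (le_trans (IHm (ltnW mn))); apply/ltW/ti.
    by rewrite ltnS ltnW.
  exact.
rewrite big_ord_recr /=.
have IHn := IH (fun i h => ti i (ltnW h)) t0 (le_trans (ltW tn) t1).
apply: (le_trans (leeD IHn (lexx _))).
rewrite -ge0_integral_setU //.
- apply: le_int_mono => // x [|]; rewrite /= !in_itv /= => /andP[h1 h2]; apply/andP.
    by split => //; exact: lt_trans tn.
  by split => //; exact: le_lt_trans h1.
- apply: measurable_funS mP => // x [|]; rewrite /= !in_itv /= => /andP[h1 h2]; apply/andP.
    by split; [apply/ltW/(le_lt_trans t0)|apply/ltW/(lt_le_trans h2)/(le_trans (ltW tn))].
  split; [apply/ltW/(le_lt_trans t0)/(le_lt_trans t0n) => //|apply/ltW/(lt_le_trans h2) => //].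
- apply/disj_setPS => x []; rewrite /= !in_itv /= => /andP[_ h1] /andP[h2 _].
  by have := lt_trans h1 h2; rewrite ltxx.
Qed.

(** For sg > 0 the interactions between different blocks are kept in the density [Psi], whose inner
    integral runs over the whole interval (0, 1). The energy of a block is at most the integral of
    [Psi] over it, and these integrals add up. *)
Lemma energy_super (sg p : R) (W : R -> R * R) (n : nat) (t : nat -> R) :
  meas2 W -> (forall i, (i < n)%N -> t i < t i.+1) -> 0 <= t 0%N -> t n <= 1 ->
  (\sum_(i < n) energy sg p W (t i) (t i.+1) <= energy sg p W 0 1)%E.
Proof.
move=> mW ti t0 t1.
have tb m : (m <= n)%N -> 0 <= t m /\ t m <= 1.
  move=> mn; split.
    elim: m mn => [//|m IH] mn; apply: (le_trans (IH (ltnW mn))); exact/ltW/ti.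
  have : forall j, (m + j <= n)%N -> t m <= t (m + j)%N.
    elim=> [|j IH]; first by rewrite addn0.
    by rewrite addnS => h; apply: (le_trans (IH (ltnW h))); exact/ltW/ti.
  by move=> /(_ (n - m)%N); rewrite subnKC // => /(_ (leqnn _)) h; exact: le_trans t1.
have [m1 m2] := mW.
have [Psi [mP [P0 [P1 P2]]]] : exists Psi : R -> \bar R, measurable_fun I01 Psi /\
   ((forall x, 0 <= Psi x)%E /\ (energy sg p W 0 1 = (\int[mu]_(x in oo 0%R 1%R) Psi x)%E /\
   forall a b, 0 <= a -> b <= 1 -> (energy sg p W a b <= \int[mu]_(x in oo a b) Psi x)%E)).
  rewrite /energy; case: ifP => _.
    exists (fun x => \int[mu]_(y in oo 0%R 1%R) (gk sg p W x y)%:E)%E; split; [|split; [|split]].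
    - by apply: inner_meas => //; exact: oo_I01.
    - by move=> x; apply: integral_ge0 => y _; rewrite lee_fin gk_ge0.
    - by [].
    - move=> a b a0 b1; apply: le_int => x _.
        by apply: integral_ge0 => y _; rewrite lee_fin gk_ge0.
      apply: le_int_mono; first by move=> y _; rewrite lee_fin gk_ge0.
      exact: subset_itvW.
  exists (fun x => (en (W x) `^ p)%:E); split; [|split; [|split]] => //.
    apply/measurable_EFinP; apply: (measurableT_comp (@measurable_powR R p)).
    apply: (measurableT_comp (@measurable_sqrtr R)).
    by apply: measurable_funD; exact: measurable_funX.
  by move=> x; rewrite lee_fin powR_ge0.
rewrite P1; apply: (@le_trans _ _ (\sum_(i < n) \int[mu]_(x in oo (t i) (t i.+1)) Psi x)%E).
  apply: lee_sum => i _; apply: P2; first exact: (tb i (ltnW (ltn_ord i))).1.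
  exact: (tb i.+1 (ltn_ord i)).2.
apply: (le_trans (int_super mP P0 ti t0 t1)).
by apply: le_int_mono => //; exact: subset_itvW.
Qed.

Lemma powR_tangent (al x : R) : 0 <= al -> 0 < x -> 1 - al * (x - 1) <= x `^ (- al).
Proof.
move=> a0 x0; rewrite /powR gt_eqF //.
apply: (le_trans _ (expR_ge1Dx _)).
have h : ln x <= x - 1.
  have : ln (1 + (x - 1)) <= x - 1 by apply: le_ln1Dx; lra.
  by rewrite (_ : 1 + (x - 1) = x) //; ring.
nra.
Qed.

(* The lengths of the blocks add up to at most 1, so the tangent line at the mean length n^-1 of
   the convex function l |-> l^-al gives the lower bound n^(1 + al) for the total energy. *)
Lemma blocks_sum (sg p al C E : R) (W : R -> R * R) (n : nat) (t : nat -> R) :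
  0 < C -> 0 <= al -> meas2 W ->
  (forall i, (i < n)%N -> t i < t i.+1) -> 0 <= t 0%N -> t n <= 1 ->
  (forall i e, (i < n)%N -> (energy sg p W (t i) (t i.+1) <= e%:E)%E ->
     1 <= C * ((t i.+1 - t i) `^ al * e)) ->
  (energy sg p W 0 1 <= E%:E)%E ->
  n%:R `^ (al + 1) <= C * E.
Proof.
move=> C0 al0 mW ti t0 t1 H HE.
have [->|n0] := posnP n.
  rewrite powR0; last by rewrite gt_eqF //; lra.
  rewrite mulr_ge0 ?(ltW C0) // -lee_fin; apply: le_trans HE; exact: energy_ge0.
have nR : 0 < n%:R :> R by rewrite ltr0n.
have tot := le_trans (energy_super sg p mW ti t0 t1) HE.
have fi i : (i < n)%N -> energy sg p W (t i) (t i.+1) \is a fin_num.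
  move=> h; rewrite ge0_fin_numE ?energy_ge0 //.
  apply: (@le_lt_trans _ _ E%:E); last exact: ltry.
  apply: le_trans tot; rewrite (bigD1 (Ordinal h)) //= leeDl //.
  by apply: sume_ge0 => j _; exact: energy_ge0.
pose e i := fine (energy sg p W (t i) (t i.+1)).
have eE i : (i < n)%N -> energy sg p W (t i) (t i.+1) = (e i)%:E.
  by move=> h; rewrite fineK // fi.
have tot2 : \sum_(i < n) e i <= E.
  rewrite -lee_fin -sumEFin; apply: le_trans tot.
  by apply: lee_sum => i _; rewrite eE.
have key i : (i < n)%N -> n%:R `^ al * (1 - al * (n%:R * (t i.+1 - t i) - 1)) <= C * e i.
  move=> h; have l0 : 0 < t i.+1 - t i by rewrite subr_gt0 ti.
  have := H i (e i) h; rewrite eE // => /(_ (lexx _)) h1.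
  have h2 : (t i.+1 - t i) `^ (- al) <= C * e i.
    by rewrite powRN -[leLHS]mul1r ler_pdivrMr ?powR_gt0 // -mulrA [e i * _]mulrC.
  apply: le_trans h2.
  have := powR_tangent al0 (mulr_gt0 nR l0).
  rewrite powRM ?(ltW nR) ?(ltW l0) // powRN -/(n%:R `^ _) => h3.
  by rewrite -ler_pdivlMl ?powR_gt0.
have sumt : \sum_(i < n) (t i.+1 - t i) = t n - t 0%N.
  by rewrite -(big_mkord xpredT (fun i => t i.+1 - t i)) telescope_sumr.
apply: (@le_trans _ _ (\sum_(i < n) (C * e i))); last first.
  by rewrite -mulr_sumr ler_wpM2l // ltW.
apply: (@le_trans _ _ (\sum_(i < n)
    (n%:R `^ al * (1 - al * (n%:R * (t i.+1 - t i) - 1))))); last first.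
  by apply: ler_sum => i _; exact: key.
rewrite -mulr_sumr sumrB -mulr_sumr sumrB -mulr_sumr sumt sumr_const card_ord.
rewrite powRD; last by rewrite (gt_eqF nR) implybT.
rewrite powRr1 ?(ltW nR) // ler_pM2l ?powR_gt0 //.
have : 0 <= al * (n%:R * (1 - (t n - t 0%N))).
  by rewrite !mulr_ge0 // ?ler0n //; lra.
set T := t n - t 0%N; set N := n%:R; lra.
Qed.

End Energy.

(** * Zeros and peaks of the difference of two smooth maps *)

Section Interlacing.
Variable R : realType.
Local Notation mu := (@lebesgue_measure R).
Local Notation I01 := (`[0%R, 1%R]%classic : set R).

Lemma cos_2pi_int (z : int) : cos (2 * pi * z%:~R) = 1 :> R.
Proof.
have nat_case n : cos (2 * pi * n%:R) = 1 :> R.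
  elim: n => [|n IH]; first by rewrite mulr0 cos0.
  by rewrite -[n.+1%:R]natr1 cos_period1.
case: z => n; first exact: nat_case.
by rewrite NegzE mulrNz mulrN cosN nat_case.
Qed.

Lemma ivt_right (g : R -> R) (a b L : R) : continuous g -> a <= b -> g a <= L <= g b ->
  exists t, a <= t <= b /\ g t = L.
Proof.
move=> cg ab /andP[h1 h2].
have cw : {within `[a, b], continuous g} by exact: continuous_subspaceT.
have [|t + ht] := IVT ab cw (v := L).
  by rewrite ge_min h1 le_max h2 orbT.
by rewrite in_itv /= => tab; exists t.
Qed.

(** From g 0 on, n consecutive multiples of 2 pi are reached. As g need not be monotone, each point
    is found by the intermediate value theorem to the right of the previous one; the odd multiple of
    pi halfway gives the peak. *)
Lemma interlace (g : R -> R) (n : nat) : continuous g -> g 1 - g 0 = 2 * pi * n%:R ->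
  exists z : nat -> R,
    (forall i, (i < n)%N -> 0 <= z i <= 1 /\ cos (g (z i)) = 1) /\
    (forall i, (i.+1 < n)%N -> z i < z i.+1 /\
       exists q, z i <= q <= z i.+1 /\ cos (g q) = -1).
Proof.
move=> cg gn; have pi0 := pi_gt0 R.
pose m := Num.ceil (g 0 / (2 * pi)).
have pp : 0 < 2 * pi :> R by rewrite mulr_gt0.
have [m1 m2] : g 0 <= 2 * pi * m%:~R /\ 2 * pi * m%:~R < g 0 + 2 * pi.
  have /andP[h1 h2] := ceil_itv (g 0 / (2 * pi)).
  rewrite ler_pdivrMr // in h2; rewrite intrB ltr_pdivlMr // in h1.
  by split; [rewrite mulrC|rewrite mulrC; move: h1; rewrite mulrBl mul1r; lra].
pose L i : R := 2 * pi * (m + i%:Z)%:~R.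
have LS i : L i.+1 = L i + 2 * pi.
  by rewrite /L !intrD -!pmulrn -[i.+1%:R]natr1; ring.
have Lcos i : cos (L i) = 1 by exact: cos_2pi_int.
have L0 : L 0%N = 2 * pi * m%:~R by rewrite /L addr0.
have Lle i : (i < n)%N -> L i <= g 1.
  move=> h; have : L i <= L 0%N + 2 * pi * i%:R.
    by rewrite /L addr0 intrD mulrDr.
  have : (i.+1%:R : R) <= n%:R by rewrite ler_nat.
  rewrite L0 -[i.+1%:R]natr1 => h1 h2; nra.
have /choice[T HT] : forall aL : R * R, exists t,
    (aL.1 <= 1 /\ g aL.1 <= aL.2 <= g 1) -> aL.1 <= t <= 1 /\ g t = aL.2.
  move=> [a l]; have [[h1 h2]|h] := pselect (a <= 1 /\ g a <= l <= g 1).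
    by have [t ht] := ivt_right cg h1 h2; exists t.
  by exists 0.
pose fix z i := if i is j.+1 then T (z j, L j.+1) else T (0, L 0%N).
have Hz i : (i < n)%N -> 0 <= z i <= 1 /\ g (z i) = L i.
  elim: i => [|i IH] h.
    have [|/=] := HT (0, L 0%N); first by rewrite /= ler01 Lle // L0 m1.
    by [].
  have [/andP[h1 h2] h3] := IH (ltnW h).
  have [|/= /andP[h4 h5] h6] := HT (z i, L i.+1).
    by rewrite /= h2 h3 Lle // LS andbT; split => //; lra.
  by rewrite (le_trans h1 h4) h5.
exists z; split=> i h; first by have [h1 ->] := Hz i h.
have [/andP[h1 h2] h3] := Hz i (ltnW h).
have [/andP[h4 h5] h6] := Hz i.+1 h.
have zle : z i <= z i.+1.
  have [|/= /andP[]//] := HT (z i, L i.+1).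
  by rewrite /= h2 h3 Lle // LS andbT; split => //; lra.
split.
  rewrite lt_neqAle zle andbT; apply/eqP => e.
  by move: h6; rewrite -e h3 LS; lra.
have [|q [q1 q2]] := @ivt_right g (z i) (z i.+1) (L i + pi) cg zle.
  by rewrite h3 h6 LS; apply/andP; split; lra.
by exists q; rewrite q2 cosDpi Lcos.
Qed.

(** For n = 1 there is no gap between two zeros to supply a peak; interlacing applied to g + pi,
    whose zeros are the peaks of g, does. *)
Lemma zero_and_peak (g : R -> R) (n : nat) : continuous g -> (0 < n)%N ->
  g 1 - g 0 = 2 * pi * n%:R ->
  exists z q, [/\ 0 <= z <= 1, 0 <= q <= 1, cos (g z) = 1 & cos (g q) = -1].
Proof.
move=> cg n0 gn; have pi0 := pi_gt0 R.
have [z [/(_ 0%N n0)[z01 cz] _]] := interlace cg gn.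
pose g' x := g x + pi.
have cg' : continuous g' by move=> x; apply: cvgD; [exact: cg|exact: cvg_cst].
have gn' : g' 1 - g' 0 = 2 * pi * n%:R by rewrite -gn /g'; ring.
have [q [/(_ 0%N n0)[q01 cq] _]] := interlace cg' gn'.
exists (z 0%N), (q 0%N); split => //.
by move: cq; rewrite /g' cosDpi => h; rewrite -[LHS]opprK h.
Qed.

Lemma lower_smooth (k : nat) (sg p E : R) (W : R -> R * R) (g : R -> R) (u : bool -> R -> R)
    (n : nat) :
  let v (b : bool) x := if b then (W x).1 else (W x).2 in
  0 <= sg -> 1 <= p -> (k = 0%N -> p^-1 < sg) -> 1 < (k%:R + sg) * p ->
  (forall b, smooth_fun (u b)) ->
  (forall b j, derive1n j (u b) 0 = derive1n j (u b) 1) ->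
  meas2 W -> (forall b, link k (u b) (v b)) ->
  continuous g -> (0 < n)%N -> g 1 - g 0 = 2 * pi * n%:R ->
  (forall x b, cos (g x) = 1 -> u b x = 0) ->
  (forall x, cos (g x) = -1 -> exists b, 1 <= `|u b x|) ->
  (energy sg p W 0 1 <= E%:E)%E ->
  n%:R `^ ((k%:R + sg) * p) <=
    (6 * k.-1.+1)%:R `^ ((k%:R + sg) * p) * (lower_cst k sg p * E).
Proof.
move=> v sg0 p1 hk skp su pu mW hl cg n0 gn u0 u1 HE.
set al := (k%:R + sg) * p - 1; have al0 : 0 < al by rewrite subr_gt0.
have alE : (k%:R + sg) * p = al + 1 by rewrite subrK.
have C0 := lower_cst_gt0 hk; set C := lower_cst k sg p.
have E0 : 0 <= E by rewrite -lee_fin; apply: le_trans HE; exact: energy_ge0.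
have mv b : measurable_fun I01 (v b) by case: b; [exact: mW.1|exact: mW.2].
have dv b : dominated (v b) W.
  have h (x y : R) : `|x| <= Num.sqrt (x ^+ 2 + y ^+ 2).
    by rewrite -sqrtr_sqr ler_wsqrtr // lerDl sqr_ge0.
  have h' (x y : R) : `|y| <= Num.sqrt (x ^+ 2 + y ^+ 2) by rewrite addrC.
  by split=> [x y|x]; case: b => /=; rewrite /v /en /=.
(* Number of gaps in a block. Here [k.-1.+1] is max(k, 1): for k >= 1 the zeros serve the derivative
   of order k - 1. *)
pose B := (3 * k.-1.+1)%N.
have B0 : (0 < B)%N by rewrite muln_gt0.
have BB : (6 * k.-1.+1 = 2 * B)%N by rewrite /B mulnA.
have [z [z1 z2]] := interlace cg gn.
pose N := (n.-1 %/ B)%N.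
have CE : 0 <= C * E by rewrite mulr_ge0 // ltW.
(* Without a full block, n is bounded and the whole circle serves as the only block. *)
have [N0|N0] := posnP N.
  have nB : (n <= 2 * B)%N.
    have : (n.-1 < B)%N by rewrite -[X in (_ < X)%N]mul1n -ltn_divLR // -/N N0.
    by rewrite prednK // => h; rewrite (leq_trans h) // leq_pmull.
  have one : 1 <= C * E.
    have [x [y [hx hy cx cy]]] := zero_and_peak cg n0 gn.
    have [b ub] := u1 y cy; have ux := u0 x b cx.
    have ex : exists x y, [/\ 0 <= x, x <= y, y <= 1 & 1 <= `|u b y - u b x|].
      have /andP[x0 x1] := hx; have /andP[y0 y1] := hy.
      case/orP: (le_total x y) => xy; first by exists x, y; rewrite ux subr0.
      by exists y, x; rewrite ux sub0r normrN.
    have osc : oscillates k (u b) 0 1.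
      case: (k) => [|k'] /=.
        have [x' [y' [a1 a2 a3 a4]]] := ex; exists y', x'.
        by split => //; apply/andP; split => //; [exact: le_trans a2|exact: le_trans a3].
      split; first exact: pu.
      have [x' [y' [a1 a2 a3 a4]]] := periodic_osc k' (su b) (pu b) ex.
      by exists x', y'; rewrite subr0 expr1n mulr1.
    have := interval_lower sg0 p1 hk (lexx 0) ltr01 (lexx 1) mW (mv b) (dv b) (su b) (hl b) osc HE.
    by rewrite subr0 powR1 mul1r.
  rewrite BB; apply: (@le_trans _ _ ((2 * B)%:R `^ ((k%:R + sg) * p))).
    by apply: powR_le; rewrite ?ler0n ?ler_nat //; lra.
  by rewrite ler_peMr // powR_ge0.
have NB : (N * B <= n.-1)%N by exact: leq_trunc_div.
have bnd : N%:R `^ (al + 1) <= C * E.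
  pose t i := z (i * B)%N.
  have zlt i j : (i < j)%N -> (j < n)%N -> z i < z j.
    elim: j => [//|j IH]; rewrite ltnS leq_eqVlt => /orP[/eqP -> h|ij h].
      exact: (z2 j h).1.
    exact: lt_trans (IH ij (ltnW h)) (z2 j h).1.
  have iB i : (i < N)%N -> (i.+1 * B < n)%N.
    by move=> h; rewrite -(prednK n0) ltnS (leq_trans _ NB) // leq_mul2r h orbT.
  apply: (@blocks_sum R sg p al C E W N t) => //.
  - exact: ltW.
  - by move=> i h; apply: zlt; [rewrite ltn_mul2r B0 ltnSn|exact: iB].
  - by have [/andP[]] := z1 0%N n0.
  - have h : (N * B < n)%N by rewrite -(prednK n0) ltnS.
    by have [/andP[]] := z1 _ h.
  move=> i e h; set a0 := t i; set b0 := t i.+1 => He.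
  pose zz j := z (i * B + j)%N.
  have zB : zz B = b0 by rewrite /zz /b0 /t mulSn addnC.
  have zz0 : zz 0%N = a0 by rewrite /zz addn0.
  have jn j : (j <= B)%N -> (i * B + j < n)%N.
    move=> hj; apply: leq_ltn_trans (iB i h).
    by rewrite mulSn addnC leq_add2r.
  have zzlt j : (j < B)%N -> zz j < zz j.+1.
    by move=> hj; apply: zlt; rewrite ?addnS // -addnS; exact: jn.
  have k1B : (k.-1.+2 <= B)%N by clear; rewrite /B; lia.
  have [_ [q [q1 q2]]] : zz k.-1.+1 < zz k.-1.+2 /\
      exists q, zz k.-1.+1 <= q <= zz k.-1.+2 /\ cos (g q) = -1.
    by rewrite /zz (addnS _ k.-1.+1); apply: z2; rewrite -addnS; exact: jn.
  (* The component may change from block to block: the energy of the vector dominates that of either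
     component. *)
  have [b ub] := u1 q q2.
  have uz j : (j <= B)%N -> u b (zz j) = 0.
    by move=> hj; apply: u0; exact: (z1 _ (jn j hj)).2.
  have e0 : 0 <= e by rewrite -lee_fin; apply: le_trans He; exact: energy_ge0.
  have a00 : 0 <= a0 by rewrite -zz0; have [/andP[]] := z1 _ (jn 0%N (leq0n _)).
  have b01 : b0 <= 1 by rewrite -zB; have [/andP[]] := z1 _ (jn B (leqnn _)).
  (* The oscillation takes place on a part of the block. Since al >= 0, replacing its length by that
     of the block keeps the inequality. *)
  have fin a' b' : a0 <= a' -> a' < b' -> b' <= b0 -> oscillates k (u b) a' b' ->
      1 <= C * ((b0 - a0) `^ al * e).
    move=> h1 h2 h3 ho.
    have He' : (energy sg p W a' b' <= e%:E)%E by exact: le_trans (energy_sub _ _ _ h1 h3) He.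
    have := interval_lower sg0 p1 hk (le_trans a00 h1) h2 (le_trans h3 b01) mW (mv b) (dv b)
      (su b) (hl b) ho He'.
    move=> h4; apply: (le_trans h4); rewrite ler_pM2l // ler_wpM2r //.
    by apply: powR_le; lra.
  have zmono j j' : (j <= j')%N -> (j' <= B)%N -> zz j <= zz j'.
    rewrite leq_eqVlt => /orP[/eqP -> //|jj] hj; apply/ltW/zlt; first by rewrite ltn_add2l.
    exact: jn.
  have ab0 : a0 < b0 by rewrite -zz0 -zB; apply: zlt; [rewrite ltn_add2l|exact: jn].
  case Ek: k => [|k'].
    apply: (fin a0 b0) => //; rewrite Ek /=; exists q, a0.
    split; last by rewrite -zz0 uz ?subr0.
      have /andP[h1 h2] := q1; rewrite -zz0 -zB.
      by rewrite (le_trans (zmono 0%N k.-1.+1 _ _) h1) ?(le_trans h2 (zmono k.-1.+2 B _ _)) // ltnW.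
    by rewrite lexx ltW.
  rewrite Ek /= in q1 k1B.
  have uz' j : (j <= 3 * k'.+1)%N -> u b (zz j) = 0.
    by move=> hj; apply: uz; rewrite /B Ek.
  have zzlt' j : (j < 3 * k'.+1)%N -> zz j < zz j.+1.
    by move=> hj; apply: zzlt; rewrite /B Ek.
  have [a [b' [c [ha hab hb /andP[ac cb] [va vb vc]]]]] := zeros_block (su b) zzlt' uz' q1 ub.
  have hb0 : b' <= b0 by rewrite -zB /B Ek.
  apply: (fin a b') => //; first by rewrite -zz0.
  rewrite Ek /=; split; first by rewrite va vb.
  by exists a, c; rewrite va subr0.
rewrite BB natrM powRM //.
(* Since N >= 1, n <= (N + 1) B <= 2 N B: this doubles 3 to the 6 of the constant. *)
have n2 : (n <= 2 * B * N)%N.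
  have h1 : (n.-1 < N.+1 * B)%N by rewrite -ltn_divLR.
  rewrite prednK // in h1; apply: (leq_trans h1).
  by rewrite -mulnA (mulnC B) mulnA leq_mul2r mul2n -addnn -addn1 leq_add2l N0 orbT.
have : (n%:R : R) `^ (al + 1) <= (2 * B * N)%:R `^ (al + 1).
  by apply: powR_le; rewrite ?ler0n ?ler_nat //; lra.
rewrite alE => h; apply: (le_trans h).
rewrite [(2 * B * N)%:R]natrM powRM // [(2 * B)%:R]natrM [(2 * _) `^ _]powRM //.
by rewrite ler_wpM2l // mulr_ge0 // powR_ge0.
Qed.

End Interlacing.

(** * Lower bound for the distance *)

Section LowerBound.
Variable R : realType.
Local Notation mu := (@lebesgue_measure R).
Local Notation I01 := (`[0%R, 1%R]%classic : set R).
Local Notation oo a b := (`]a, b[%classic : set R).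

Lemma sob_split (s : R) : 0 <= s ->
  [/\ (sob_k s)%:R + sob_sigma s = s, 0 <= sob_sigma s & sob_sigma s < 1].
Proof.
move=> s0; rewrite /sob_sigma /sob_k.
have /andP[h1 h2] := truncn_itv s0.
split; first by rewrite addrC subrK.
  by rewrite subr_ge0.
by move: h2; rewrite -[_.+1%:R]natr1; lra.
Qed.

Definition top_energy (sg p : R) (G : R -> R * R) : \bar R :=
  if 0 < sg then gagliardo sg p G else pint p G.

Lemma top_energy_ge0 sg p G : (0 <= top_energy sg p G)%E.
Proof.
rewrite /top_energy; case: ifP => _; apply: integral_ge0 => x _; last by rewrite lee_fin powR_ge0.
by apply: integral_ge0 => y _; rewrite lee_fin divr_ge0 ?powR_ge0.
Qed.

Lemma energy_le_top sg p G : (energy sg p G 0 1 <= top_energy sg p G)%E.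
Proof.
have sub : oo 0 1 `<=` I01 by exact: oo_I01.
rewrite /energy /top_energy; case: ifP => _; last first.
  by apply: le_int_mono => // x _; rewrite lee_fin powR_ge0.
apply: (@le_trans _ _ (\int[mu]_(x in oo 0%R 1%R) \int[mu]_(y in I01) (gk sg p G x y)%:E)%E).
  apply: le_int => x _; first by apply: integral_ge0 => y _; rewrite lee_fin gk_ge0.
  by apply: le_int_mono => // y _; rewrite lee_fin gk_ge0.
apply: le_int_mono => // x _; by apply: integral_ge0 => y _; rewrite lee_fin gk_ge0.
Qed.

Lemma en_ge (z : R * R) : `|z.1| <= en z /\ `|z.2| <= en z.
Proof.
rewrite /en -!sqrtr_sqr; split; apply: ler_wsqrtr; first by rewrite lerDl sqr_ge0.
by rewrite lerDr sqr_ge0.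
Qed.

Lemma en_le (z : R * R) : en z <= `|z.1| + `|z.2|.
Proof.
rewrite /en -[leRHS]ger0_norm ?addr_ge0 // -sqrtr_sqr; apply: ler_wsqrtr.
rewrite sqrrD !real_normK ?num_real // -addrA lerD2l lerDr.
by rewrite mulrn_wge0 // mulr_ge0.
Qed.

Lemma en_ge0 (z : R * R) : 0 <= en z. Proof. exact: sqrtr_ge0. Qed.

Lemma max3_dominates (x y z : R) (f : R -> R) : (forall t, 0 <= f t) ->
  exists m, [/\ x <= m, y <= m, z <= m & f m <= f x + (f y + f z)].
Proof.
move=> f0; have := f0 x; have := f0 y; have := f0 z.
case/orP: (le_total x y) => xy; last first.
  case/orP: (le_total x z) => xz hz hy hx.
    by exists z; rewrite xz (le_trans xy xz) lexx; split => //; rewrite addrA lerDr addr_ge0.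
  by exists x; rewrite xz xy lexx; split => //; rewrite lerDl addr_ge0.
case/orP: (le_total y z) => yz hz hy hx.
  by exists z; rewrite yz (le_trans xy yz) lexx; split => //; rewrite addrA lerDr addr_ge0.
by exists y; rewrite yz xy lexx; split => //; rewrite addrCA lerDl addr_ge0.
Qed.

(** Two components with three terms each are at most 6 times the largest of the three norms, whose
    p-th power is at most the sum of the three powers. *)
Lemma en_comb3 (p : R) (a b c : R * R) : 1 <= p ->
  en (a.1 - b.1 + c.1, a.2 - b.2 + c.2) `^ p <=
  6 `^ p * (en a `^ p + (en b `^ p + en c `^ p)).
Proof.
move=> p1; have p0 : 0 <= p by lra.
have [a1 a2] := en_ge a; have [b1 b2] := en_ge b; have [c1 c2] := en_ge c.
have e0 := en_ge0.
have t3 (x y z : R) : `|x - y + z| <= `|x| + `|y| + `|z|.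
  by apply: (le_trans (ler_normD _ _)); rewrite lerD2r ler_normB.
have h := en_le (a.1 - b.1 + c.1, a.2 - b.2 + c.2).
have h1 := t3 a.1 b.1 c.1; have h2 := t3 a.2 b.2 c.2.
have [m [ma mb mc mp]] := max3_dominates (en a) (en b) (en c) (fun t : R => powR_ge0 t p).
have m0 : 0 <= m by exact: le_trans ma.
apply: (@le_trans _ _ ((6 * m) `^ p)).
  by apply: powR_le => //; move: h => /= h; lra.
by rewrite powRM // ler_wpM2l // powR_ge0.
Qed.

(* If a, b, c witness f - g, f - fn, g - gn, then [comb3 a b c] witnesses fn - gn up to a constant. *)
Definition comb3 (a b c : R -> R * R) (x : R) : R * R :=
  ((a x).1 - (b x).1 + (c x).1, (a x).2 - (b x).2 + (c x).2).

Lemma comb3_meas a b c : meas2 a -> meas2 b -> meas2 c -> meas2 (comb3 a b c).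
Proof.
move=> [a1 a2] [b1 b2] [c1 c2]; split => /=.
  by apply: measurable_funD => //; exact: measurable_funB.
by apply: measurable_funD => //; exact: measurable_funB.
Qed.

Lemma ge0_integralD3 (D : set R) (f1 f2 f3 : R -> \bar R) (C : R) : measurable D -> 0 <= C ->
  (forall x, D x -> 0 <= f1 x)%E -> (forall x, D x -> 0 <= f2 x)%E ->
  (forall x, D x -> 0 <= f3 x)%E ->
  measurable_fun D f1 -> measurable_fun D f2 -> measurable_fun D f3 ->
  (\int[mu]_(x in D) (C%:E * (f1 x + (f2 x + f3 x))) =
   C%:E * (\int[mu]_(x in D) f1 x + (\int[mu]_(x in D) f2 x + \int[mu]_(x in D) f3 x)))%E.
Proof.
move=> mD C0 f10 f20 f30 m1 m2 m3.
rewrite ge0_integralZl_EFin //; first last.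
- exact: emeasurable_funD m1 (emeasurable_funD m2 m3).
- by move=> x Dx; rewrite !adde_ge0 ?f10 ?f20 ?f30.
rewrite ge0_integralD //; first last.
- exact: emeasurable_funD m2 m3.
- by move=> x Dx; rewrite adde_ge0 ?f20 ?f30.
by rewrite ge0_integralD.
Qed.

Lemma eq_leRL (x y z : \bar R) : (x <= z)%E -> z = y -> (x <= y)%E.
Proof. by move=> h <-. Qed.

Lemma top_energy_comb3 (sg p : R) (a b c : R -> R * R) : 1 <= p ->
  meas2 a -> meas2 b -> meas2 c ->
  (top_energy sg p (comb3 a b c) <= (6 `^ p)%:E *
    (top_energy sg p a + (top_energy sg p b + top_energy sg p c)))%E.
Proof.
move=> p1 ma mb mc; have [s0|/negbTE s0] := boolP (0 < sg); rewrite /top_energy s0; last first.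
  pose f (z : R -> R * R) x := (en (z x) `^ p)%:E.
  have f0 (z : R -> R * R) x : I01 x -> (0 <= f z x)%E by move=> _; rewrite lee_fin powR_ge0.
  have me (z : R -> R * R) : meas2 z -> measurable_fun I01 (f z).
    move=> [z1 z2]; apply/measurable_EFinP; apply: (measurableT_comp (@measurable_powR R p)).
    apply: (measurableT_comp (@measurable_sqrtr R)).
    by apply: measurable_funD; exact: measurable_funX.
  have E := ge0_integralD3 (measurable_itv _) (powR_ge0 (6 : R) p) (f0 a) (f0 b) (f0 c)
    (me a ma) (me b mb) (me c mc).
  apply: le_trans (_ : _ <= _)%E (eq_leRL (lexx _) E).
  apply: le_int => x Ix; first exact: f0.
  by rewrite /f -!EFinD -EFinM lee_fin; exact: en_comb3.
pose G (z : R -> R * R) x := (\int[mu]_(y in I01) (gk sg p z x y)%:E)%E.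
have G0 (z : R -> R * R) x : I01 x -> (0 <= G z x)%E.
  by move=> _; apply: integral_ge0 => y _; rewrite lee_fin gk_ge0.
have mG (z : R -> R * R) : meas2 z -> measurable_fun I01 (G z).
  by move=> mz; apply: inner_meas.
have E := ge0_integralD3 (measurable_itv _) (powR_ge0 (6 : R) p) (G0 a) (G0 b) (G0 c)
    (mG a ma) (mG b mb) (mG c mc).
apply: le_trans (_ : _ <= _)%E (eq_leRL (lexx _) E).
apply: le_int => x Ix; first exact: (G0 (comb3 a b c)).
pose f (z : R -> R * R) y := (gk sg p z x y)%:E.
have f0 (z : R -> R * R) y : I01 y -> (0 <= f z y)%E by move=> _; rewrite lee_fin gk_ge0.
have mf (z : R -> R * R) : meas2 z -> measurable_fun I01 (f z).
  by move=> mz; apply/measurable_EFinP; exact: ymeas.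
have Ex := ge0_integralD3 (measurable_itv _) (powR_ge0 (6 : R) p) (f0 a) (f0 b) (f0 c)
    (mf a ma) (mf b mb) (mf c mc).
apply: le_trans (_ : _ <= _)%E (eq_leRL (lexx _) Ex).
apply: le_int => y _; first by rewrite lee_fin divr_ge0 ?powR_ge0.
rewrite /f -!EFinD -EFinM lee_fin /gk.
rewrite -!mulrDl mulrA; apply: ler_wpM2r; first by rewrite invr_ge0 powR_ge0.
have := en_comb3 ((a x).1 - (a y).1, (a x).2 - (a y).2) ((b x).1 - (b y).1, (b x).2 - (b y).2)
    ((c x).1 - (c y).1, (c x).2 - (c y).2) p1.
rewrite /comb3 /=; apply: le_trans; rewrite le_eqVlt; apply/orP; left; apply/eqP.
by congr (en (_, _) `^ _); ring.
Qed.

Lemma witness_meas s p h g j : sob_witness s p h g -> (j <= sob_k s)%N -> meas2 (g j : R -> R * R).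
Proof. by move=> [_ [H _]] /H[? []]. Qed.

Lemma val_ge (s p : R) h g : 1 <= p -> sob_witness s p h g ->
  exists t, [/\ top_energy (sob_sigma s) p (g (sob_k s)) = (t `^ p)%:E, 0 <= t &
    t <= sob_norm_val s p g].
Proof.
move=> p1 [_ [H1 [_ H2]]]; have p0 : p != 0 by apply: lt0r_neq0; lra.
set T := top_energy _ _ _; exists ((fine T) `^ (1 / p)).
have Tfin : T \is a fin_num.
  rewrite ge0_fin_numE ?top_energy_ge0 // /T /top_energy; case: ifP => // _.
  by have [_ []] := H1 _ (leqnn _).
split; last first.
- have S0 : forall n, 0 <= \sum_(j < n) powR (fine (pint p (g j))) (1 / p).
    by move=> n; apply: sumr_ge0 => j _; exact: powR_ge0.
  rewrite /sob_norm_val /T /top_energy; case: ifP => _.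
    by rewrite lerDr S0.
  by rewrite addr0 big_ord_recr /= lerDr S0.
- exact: powR_ge0.
- rewrite -powRrM mul1r mulVf // powRr1 ?fineK //.
  by rewrite fine_ge0 ?top_energy_ge0.
Qed.

Lemma Lp_integrable (p : R) (G : R -> R * R) (v : R -> R) : 1 <= p -> meas2 G ->
  measurable_fun I01 v -> (forall x, `|v x| <= en (G x)) -> (pint p G < +oo)%E ->
  mu.-integrable I01 (EFin \o v).
Proof.
move=> p1 [m1 m2] mv hv fG.
have me : measurable_fun I01 (fun x => en (G x)).
  apply: (measurableT_comp (@measurable_sqrtr R)).
  by apply: measurable_funD; exact: measurable_funX.
have [E EE] : exists E : R, pint p G = E%:E.
  have : (0 <= pint p G)%E by apply: integral_ge0 => x _; rewrite lee_fin powR_ge0.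
  by move: fG; case: (pint p G) => [r| |] // _ _; exists r.
have hE : (\int[mu]_(x in I01) (en (G x) `^ p)%:E <= E%:E)%E by rewrite -EE.
have [I [I1 _ _]] := jensen (measurable_itv _) me (fun x _ => en_ge0 (G x)) (mu_I01 R) ltr01 p1 hE.
apply/integrableP; split; first exact/measurable_EFinP.
apply: (@le_lt_trans _ _ (\int[mu]_(x in I01) (en (G x))%:E)%E); last by rewrite I1 ltry.
by apply: le_int => x _; [rewrite lee_fin|rewrite lee_fin].
Qed.

End LowerBound.

(** * From smooth maps to the Sobolev classes *)

Section DistLower.
Variable R : realType.
Local Notation mu := (@lebesgue_measure R).
Local Notation I01 := (`[0%R, 1%R]%classic : set R).
Local Notation oo a b := (`]a, b[%classic : set R).

Lemma derive1n_subc (u : R -> R) (c : R) (j : nat) : smooth_fun u ->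
  derive1n j.+1 (fun x => u x - c) = derive1n j.+1 u.
Proof.
move=> su; rewrite !derive1Sn; congr (derive1n j _).
have h := has_drvD (smooth_drv su) (has_drvN (has_drv_cst c)).
by rewrite (has_drv_val h); apply/funext => x; rewrite oppr0 addr0.
Qed.

(** Order k of a witness is some weak derivative. Moving k derivatives onto the test function shows
    that it agrees with the classical derivative of u in the weak sense; by [test_oo] both have the
    same integral over each open interval, which the fundamental theorem evaluates. *)
Lemma link_of_weak (k : nat) (u : R -> R) (c : R) (g : nat -> R -> R) :
  smooth_fun u -> (forall j, derive1n j u 0 = derive1n j u 1) ->
  (forall x, g 0%N x = u x - c) ->
  (forall j, (j <= k)%N -> mu.-integrable I01 (EFin \o g j)) ->
  (forall j, (j < k)%N -> weak_deriv (g j) (g j.+1)) ->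
  link k u (g k).
Proof.
case: k => [|k] su pu g0 ig wg; first by exists c.
split; first exact: ig.
move=> a b a0; rewrite le_eqVlt => /orP[/eqP <- _|ab b1].
  rewrite subrr set_itv_ge ?Rintegral_set0 //=.
  by rewrite -leNgt bnd_simp.
have mI : measurable I01 by exact: measurable_itv.
pose d j x := if j is 0%N then u x - c else derive1n j u x.
have sd j : smooth_fun (d j).
  case: j => [|j]; last exact: (smooth_derive1n (n := j.+1)).
  by apply: smoothB su _; exact: smooth_cst.
have wd j : (j < k.+1)%N -> weak_deriv (d j) (d j.+1).
  move=> _; case: j => [|j].
    have -> : d 1%N = derive1 (d 0%N) by exact: esym (derive1n_subc c 0 su).
    by apply: smooth_weak_deriv; [exact: (sd 0%N)|congr (_ - _); exact: (pu 0%N)].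
  by apply: (@smooth_weak_deriv _ (derive1n j.+1 u)); [exact: (sd j.+1)|exact: pu].
have id := oo_integrable a b (smooth_cont (sd k.+1)).
have id1 := cont_integrable 0 1 (smooth_cont (sd k.+1)).
have igk := ig _ (leqnn k.+1).
have igk' : mu.-integrable (oo a b) (EFin \o g k.+1).
  by apply: integrableS igk => //; exact: oo_I01 (ltW (le_lt_trans a0 ab)) b1 || exact: oo_I01.
have H : \int[mu]_(x in oo a b) (g k.+1 x - d k.+1 x) = 0.
  apply: (@test_oo R _ a b a0 ab b1).
    rewrite (_ : EFin \o _ = ((EFin \o g k.+1) \- (EFin \o d k.+1))%E).
      by apply: integrableB.
    by apply/funext => x; rewrite /= EFinB.
  move=> phi sphi pphi.
  have h1 := weak_deriv_iter wg sphi pphi; have h2 := weak_deriv_iter wd sphi pphi.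
  have e : \int[mu]_(x in I01) (g 0%N x * derive1n k.+1 phi x) =
           \int[mu]_(x in I01) (d 0%N x * derive1n k.+1 phi x).
    by apply: eq_Rintegral => x _; rewrite g0.
  have cphi := smooth_cont sphi.
  have i1 := integrable_mulc igk cphi; have i2 := integrable_mulc id1 cphi.
  have -> : \int[mu]_(x in I01) ((g k.+1 x - d k.+1 x) * phi x) =
     \int[mu]_(x in I01) (g k.+1 x * phi x) - \int[mu]_(x in I01) (d k.+1 x * phi x).
    by rewrite -RintegralB //; apply: eq_Rintegral => x _; rewrite mulrBl.
  apply/eqP; rewrite subr_eq0; apply/eqP; apply: (@mulfI _ ((-1) ^+ k.+1)).
    by rewrite expf_neq0 // oppr_eq0 oner_eq0.
  by rewrite -h1 -h2.
rewrite RintegralB // in H; move/eqP: H; rewrite subr_eq0 => /eqP ->.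
have F := has_drv_FTC2 (ltW ab) (smooth_drvn k su) (smooth_cont (sd k.+1)).
have mdo : measurable_fun (oo a b) (fun x => (d k.+1 x)%:E).
  by apply/measurable_EFinP; exact: (continuous_measurable (measurable_itv _) (smooth_cont (sd k.+1))).
have B := @integral_itv_bndoo R a b _ true false mdo.
by rewrite /Rintegral -B [X in fine X]F.
Qed.

(** The identity |F - G|^2 = 2 - 2 cos(al - be). At cosine -1 it gives 4, so the two components
    cannot both be smaller than 1. *)
Lemma degree_values (F G : R -> R * R) (al be : R -> R) :
  (forall x, F x = (cos (al x), sin (al x))) -> (forall x, G x = (cos (be x), sin (be x))) ->
  forall x, (cos (al x - be x) = 1 -> (F x).1 - (G x).1 = 0 /\ (F x).2 - (G x).2 = 0) /\
   (cos (al x - be x) = -1 -> 1 <= `|(F x).1 - (G x).1| \/ 1 <= `|(F x).2 - (G x).2|).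
Proof.
move=> FE GE x; rewrite FE GE /=; set a := al x; set b := be x.
have p1 := cos2Dsin2 a; have p2 := cos2Dsin2 b.
split=> h; have D : (cos a - cos b) ^+ 2 + (sin a - sin b) ^+ 2 = 2 - 2 * cos (a - b).
- by rewrite cosB; nra.
- have c0 : (cos a - cos b) ^+ 2 = 0.
    by apply/eqP; rewrite eq_le sqr_ge0 andbT; have := sqr_ge0 (sin a - sin b); lra.
  have s0 : (sin a - sin b) ^+ 2 = 0 by lra.
  by split; apply/eqP; rewrite -sqrf_eq0; apply/eqP.
- by rewrite cosB; nra.
- rewrite h in D.
  have [c1|c1] := leP 1 `|cos a - cos b|; first by left.
  have [s1|s1] := leP 1 `|sin a - sin b|; first by right.
  have := real_normK (num_real (cos a - cos b)); have := real_normK (num_real (sin a - sin b)).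
  have := normr_ge0 (cos a - cos b); have := normr_ge0 (sin a - sin b).
  nra.
Qed.

Lemma Wnorm_near (s p e : R) (h : R -> R * R) : 0 < e -> (Wnorm s p h <= e%:E)%E ->
  exists g, sob_witness s p h g /\ sob_norm_val s p g < 2 * e.
Proof.
move=> e0 h1; have : (Wnorm s p h < (2 * e)%:E)%E.
  by apply: (le_lt_trans h1); rewrite lte_fin; lra.
by move=> /ereal_inf_lt[_ [g [wg ->]]]; rewrite lte_fin => ?; exists g.
Qed.

Lemma smooth_periodic_ends (u : R -> R) j : smooth_fun u -> periodic1 u ->
  derive1n j u 0 = derive1n j u 1.
Proof. by move=> su pu; rewrite -(periodic_derive1n j su pu 0) add0r. Qed.

(** The first power is the number of zeros lost per block, [lower_cst] the bound on one block, and
    6^p * 3 the price of combining three witnesses. *)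
Definition dist_cst (s p : R) : R :=
  (6 * (sob_k s).-1.+1)%:R `^ (s * p) *
    (lower_cst (sob_k s) (sob_sigma s) p * (6 `^ p * 3)).

Definition sel (b : bool) (z : R * R) : R := if b then z.1 else z.2.

(** Weak derivatives and integrability are linear, so the three witnesses combine order by order
    into a chain of weak derivatives of F - G - c. The energy is computed on its top order, zeros
    and peaks on F - G. *)
Lemma smooth_dist_lower (s p : R) (F G : R -> R * R) (d1 d2 : int)
    (c : R * R) (ha hb hc : R -> R * R) (wa wb wc : nat -> R -> R * R) :
  0 < s -> 1 <= p -> 1 < s * p -> d1 != d2 ->
  smooth_S1_map F -> has_degree F d1 -> smooth_S1_map G -> has_degree G d2 ->
  (forall x, comb3 ha hb hc x = ((F x).1 - (G x).1 - c.1, (F x).2 - (G x).2 - c.2)) ->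
  sob_witness s p ha wa -> sob_witness s p hb wb -> sob_witness s p hc wc ->
  (`|d1 - d2|%:~R : R) `^ (s * p) <= dist_cst s p *
    (sob_norm_val s p wa + sob_norm_val s p wb + sob_norm_val s p wc) `^ p.
Proof.
move=> s0 p1 sp d12 [F1 [F2 [F3 F4]]] [al [cal [FE dF]]] [G1 [G2 [G3 G4]]] [be [cbe [GE dG]]].
move=> hE Ha Hb Hc.
have [ks sg0 sg1] := sob_split (ltW s0).
set k := sob_k s in ks *; set sg := sob_sigma s in ks sg0 sg1 *.
have p0 : 0 < p by lra.
pose W j := comb3 (wa j) (wb j) (wc j).
pose u (b : bool) x := if b then (F x).1 - (G x).1 else (F x).2 - (G x).2.
have su b : smooth_fun (u b) by case: b; exact: smoothB.
have pu b : periodic1 (u b) by case: b => x; rewrite /u /= F3 G3.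
have mw (w : nat -> R -> R * R) h j : sob_witness s p h w -> (j <= k)%N -> meas2 (w j).
  by move=> Hw jk; exact: (witness_meas Hw jk).
have mW : meas2 (W k) by apply: comb3_meas; [exact: mw Ha _|exact: mw Hb _|exact: mw Hc _].
have vm b (z : R -> R * R) : meas2 z -> measurable_fun I01 (fun x => sel b (z x)).
  by case: b => -[].
have iw (w : nat -> R -> R * R) h b j : sob_witness s p h w -> (j <= k)%N ->
    mu.-integrable I01 (EFin \o (fun x => sel b (w j x))).
  move=> Hw jk; apply: (Lp_integrable p1 (mw _ _ _ Hw jk)).
  - by apply: vm; exact: mw Hw jk.
  - by move=> x; case: (b); [exact: (en_ge _).1|exact: (en_ge _).2].
  - by case: Hw => _ [/(_ j jk) [_ []]].
have ww (w : nat -> R -> R * R) h b j : sob_witness s p h w -> (j < k)%N ->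
    weak_deriv (fun x => sel b (w j x)) (fun x => sel b (w j.+1 x)).
  by move=> [_ [_ [H _]]] jk; have [] := H j jk; case: (b).
have iD (f g : R -> R) : mu.-integrable I01 (EFin \o f) -> mu.-integrable I01 (EFin \o g) ->
    mu.-integrable I01 (EFin \o (fun x => f x - g x)).
  move=> hf hg; rewrite (_ : EFin \o _ = ((EFin \o f) \- (EFin \o g))%E).
    by apply: integrableB.
  by apply/funext => x; rewrite /= EFinB.
have vW b j x : sel b (W j x) = sel b (wa j x) - (sel b (wb j x) - sel b (wc j x)).
  by case: b; rewrite /sel /W /comb3 /=; ring.
have pe b j : derive1n j (u b) 0 = derive1n j (u b) 1.
  exact: (smooth_periodic_ends j (su b) (pu b)).
have vWf b j : (fun x => sel b (W j x)) =
    (fun x => sel b (wa j x) - (sel b (wb j x) - sel b (wc j x))) by apply/funext => x; exact: vW.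
have ibc b j : (j <= k)%N -> mu.-integrable I01 (EFin \o (fun x => sel b (wb j x) - sel b (wc j x))).
  by move=> jk; exact: (iD _ _ (iw _ _ b _ Hb jk) (iw _ _ b _ Hc jk)).
have h0 b x : sel b (W 0%N x) = u b x - sel b c.
  have := hE x; case: Ha => <- _; case: Hb => <- _; case: Hc => <- _.
  by rewrite /W => ->; case: b.
have h1 b j : (j <= k)%N -> mu.-integrable I01 (EFin \o (fun x => sel b (W j x))).
  by move=> jk; rewrite vWf; exact: (iD _ _ (iw _ _ b _ Ha jk) (ibc b j jk)).
have h2 b j : (j < k)%N -> weak_deriv (fun x => sel b (W j x)) (fun x => sel b (W j.+1 x)).
  move=> jk; have jk' := ltnW jk; rewrite !vWf.
  apply: (weak_derivB (iw _ _ b _ Ha jk') (iw _ _ b _ Ha jk) (ibc b _ jk') (ibc b _ jk)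
    (ww _ _ b _ Ha jk)).
  exact: (weak_derivB (iw _ _ b _ Hb jk') (iw _ _ b _ Hb jk) (iw _ _ b _ Hc jk')
    (iw _ _ b _ Hc jk) (ww _ _ b _ Hb jk) (ww _ _ b _ Hc jk)).
have hl b : link k (u b) (fun x => sel b (W k x)).
  exact: (link_of_weak (g := fun j x => sel b (W j x)) (su b) (pe b) (h0 b) (h1 b) (h2 b)).
have [ta [Ta ta0 tav]] := val_ge p1 Ha; have [tb [Tb tb0 tbv]] := val_ge p1 Hb.
have [tc [Tc tc0 tcv]] := val_ge p1 Hc.
move: tav tbv tcv; move: (sob_norm_val s p wa) (sob_norm_val s p wb) (sob_norm_val s p wc).
move=> A B C tav tbv tcv; set S := A + B + C; have S0 : 0 <= S.
  by apply: addr_ge0; [apply: addr_ge0|]; [exact: le_trans tav|exact: le_trans tbv|exact: le_trans tcv].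
have tS t : 0 <= t -> t <= S -> t `^ p <= S `^ p by move=> a1 a2; exact: (powR_le (ltW p0) a1 a2).
have HE : (energy sg p (W k) 0 1 <= (6 `^ p * (3 * S `^ p))%:E)%E.
  apply: (le_trans (energy_le_top _ _ _)).
  apply: (le_trans (top_energy_comb3 sg p1 (mw _ _ _ Ha (leqnn _)) (mw _ _ _ Hb (leqnn _))
    (mw _ _ _ Hc (leqnn _)))).
  rewrite Ta Tb Tc -!EFinD -EFinM lee_fin ler_pM2l ?powR_gt0 //.
  have [A0 B0 C0] : [/\ 0 <= A, 0 <= B & 0 <= C].
    by split; [exact: le_trans tav|exact: le_trans tbv|exact: le_trans tcv].
  have ga : ta <= S by rewrite /S -addrA ler_wpDr // addr_ge0.
  have gb : tb <= S by rewrite /S addrAC ler_wpDl // addr_ge0.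
  have gc : tc <= S by rewrite /S ler_wpDl // addr_ge0.
  rewrite (_ : 3 * S `^ p = S `^ p + (S `^ p + S `^ p)); last by ring.
  by apply: lerD; [exact: tS|apply: lerD; exact: tS].
have hk : k = 0%N -> p^-1 < sg.
  move=> k0; move: ks; rewrite k0 add0r => ->.
  by rewrite -[ltLHS]mul1r ltr_pdivrMr // mulrC.
(* This sign makes the angle difference gain +2 pi |d1 - d2|; the cosine is even, so zeros and peaks
   stay where they are. *)
pose e : R := if (d2 <= d1)%R then 1 else -1.
pose n := absz (d1 - d2).
have n0 : (0 < n)%N by rewrite absz_gt0 subr_eq0.
have nE : (n%:R : R) = e * (d1 - d2)%:~R.
  rewrite /n /e; case: (lerP d2 d1) => h.
    by rewrite mul1r -[in RHS](gez0_abs (_ : 0 <= d1 - d2)) ?subr_ge0.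
  by rewrite mulN1r -intrN -[in RHS](gez0_abs (_ : 0 <= - (d1 - d2))) ?abszN // oppr_ge0 subr_le0 ltW.
have cose x : cos (e * x) = cos x by rewrite /e; case: ifP => _; rewrite ?mul1r ?mulN1r ?cosN.
have -> : (`|d1 - d2|%:~R : R) = n%:R by rewrite /n -abszE.
have skp : 1 < (k%:R + sg) * p by rewrite ks.
pose g x := e * (al x - be x).
have cg : continuous g.
  by move=> x; apply: cvgMl_tmp; apply: cvgB; [exact: cal|exact: cbe].
have gn : g 1 - g 0 = 2 * pi * n%:R.
  rewrite /g nE intrB -mulrBr (_ : _ - _ - _ = (al 1 - al 0) - (be 1 - be 0)); last by ring.
  by rewrite dF dG; ring.
have dv := degree_values FE GE.
have := lower_smooth (u := u) sg0 p1 hk skp su pe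
  mW hl cg n0 gn _ _ HE.
rewrite ks /dist_cst -/k -/sg => /(_ _ _)/le_trans; apply.
- by move=> x b; rewrite /g cose => /(dv x).1 [q1 q2]; case: (b).
- by move=> x; rewrite /g cose => /(dv x).2 [q1|q1]; [exists true|exists false].
- by rewrite le_eqVlt; apply/orP; left; apply/eqP; ring.
Qed.

Lemma dist_cst_gt0 (s p : R) : 0 < s -> 1 <= p -> 1 < s * p -> 0 < dist_cst s p.
Proof.
move=> s0 p1 sp; have [ks _ _] := sob_split (ltW s0).
rewrite /dist_cst mulr_gt0 ?powR_gt0 ?ltr0n // mulr_gt0 ?powR_gt0 //.
apply: lower_cst_gt0 => k0; move: ks; rewrite k0 add0r => ->.
by rewrite -[ltLHS]mul1r ltr_pdivrMr ?(lt_le_trans ltr01) // mulrC.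
Qed.

Lemma distW_lower (s p : R) (d1 d2 : int) : 0 < s -> 1 <= p -> 1 < s * p ->
  (((dist_cst s p `^ p^-1)^-1 * (`|d1 - d2|%:~R) `^ s)%:E <= distW s p d1 d2)%E.
Proof.
move=> s0 p1 sp; have Q0 := dist_cst_gt0 s0 p1 sp; have p0 : 0 < p by lra.
set Q := dist_cst s p `^ p^-1; have Qp : 0 < Q by exact: powR_gt0.
apply/ereal_infP => _ [f [wf [fn [Hfn cf]]] [g [wg [gn [Hgn cg]]] <-]].
apply/ereal_infP => _ [w [Hw ->]]; rewrite lee_fin.
have v0 : 0 <= sob_norm_val s p w.
  by have [t [_ t0 tv]] := val_ge p1 Hw; exact: le_trans tv.
have [<-|d12] := eqVneq d1 d2.
  by rewrite subrr normr0 powR0 ?mulr0 // gt_eqF.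
(* Each of the two approximations will have a witness of norm below 2 (e / 4), so that both together
   cost less than e. *)
apply/ler_addgt0Pr => e e0; have e4 : 0 < e / 4 by lra.
have [N1 HN1] := cf _ e4; have [N2 HN2] := cg _ e4.
have [wa [Ha va]] := Wnorm_near e4 (HN1 N1 (leqnn _)).
have [wb [Hb vb]] := Wnorm_near e4 (HN2 N2 (leqnn _)).
have [sF dF] := Hfn N1; have [sG dG] := Hgn N2.
have := @smooth_dist_lower s p (fn N1) (gn N2) d1 d2 (mean (fsub f g)) _ _ _ w wa wb
  s0 p1 sp d12 sF dF sG dG _ Hw Ha Hb.
rewrite ler_pdivrMl // => H.
set D := `|d1 - d2|%:~R in H *.
have D0 : 0 <= D by rewrite /D ler0z.
have a0 : 0 <= sob_norm_val s p wa by have [t [_ t0 tv]] := val_ge p1 Ha; exact: le_trans tv.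
have b0 : 0 <= sob_norm_val s p wb by have [t [_ t0 tv]] := val_ge p1 Hb; exact: le_trans tv.
move: v0 a0 b0 va vb H.
move: (sob_norm_val s p w) (sob_norm_val s p wa) (sob_norm_val s p wb) => X A B X0 A0 B0 va vb H.
set S := X + A + B in H.
have S0 : 0 <= S by rewrite /S !addr_ge0.
apply: (@le_trans _ _ (Q * S)); last by rewrite ler_pM2l // /S; lra.
have -> : D `^ s = (D `^ (s * p)) `^ p^-1 by rewrite -powRrM mulfK // gt_eqF.
have -> : Q * S = (dist_cst s p * S `^ p) `^ p^-1.
  rewrite powRM ?powR_ge0 ?(ltW Q0) // -powRrM mulfV ?powRr1 //; last by rewrite gt_eqF.
apply: powR_le; [by rewrite invr_ge0 ltW|exact: powR_ge0|apply: H => x].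
by rewrite /comb3 /fsub /=; congr (_, _); ring.
Qed.

End DistLower.

(** * Upper bound *)

Section Upper.
Variable R : realType.
Local Notation mu := (@lebesgue_measure R).
Local Notation I01 := (`[0%R, 1%R]%classic : set R).

(** When the short arc between the points passes through the base point, they are compared through F
    0 = F 1. *)
Lemma lip_cdist (F : R -> R) (L x y : R) : smooth_fun F -> F 0 = F 1 ->
  (forall z, I01 z -> `|derive1 F z| <= L) -> I01 x -> I01 y ->
  `|F x - F y| <= L * cdist x y.
Proof.
move=> sF F01 HL.
have lip a b : 0 <= a -> a <= b -> b <= 1 -> `|F b - F a| <= L * (b - a).
  move=> a0 ab b1; have [c /andP[c1 c2] ->] := has_drv_MVT (smooth_drv sF) ab.
  rewrite normrM (ger0_norm (_ : 0 <= b - a)) ?subr_ge0 // ler_wpM2r ?subr_ge0 //.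
  apply: HL; rewrite /= in_itv /=; apply/andP; split; lra.
wlog xy : x y / x <= y.
  move=> W; case/orP: (le_total x y) => [/W//|yx Ix Iy].
  rewrite distrC (_ : cdist x y = cdist y x); last by rewrite /cdist distrC.
  exact: W.
rewrite /= !in_itv /= => /andP[x0 x1] /andP[y0 y1].
rewrite /cdist (ler0_norm (_ : x - y <= 0)) ?subr_le0 // opprB.
case: (leP (y - x) (1 - (y - x))) => h; first by rewrite distrC; exact: lip.
have h1 := lip 0 x (lexx 0) x0 x1; have h2 := lip y 1 y0 y1 (lexx 1).
have h3 := ler_normD (F x - F 0) (F 1 - F y).
rewrite (_ : F x - F 0 + (F 1 - F y) = F x - F y) in h3; last by rewrite F01; ring.
by apply: (le_trans h3); lra.
Qed.

(** The norm is an infimum, so one chain g gives an upper bound. On a domain of measure 1 the L^p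
    norms are at most the suprema M j, and the top seminorm is estimated by [gagliardo_lip]. *)
Lemma Wnorm_le (s p A lam : R) (h : R -> R * R) (g : nat -> R -> R * R) (M : nat -> R) :
  0 <= s -> 1 <= p -> g 0%N = h ->
  (forall j, (j <= sob_k s)%N -> meas2 (g j)) ->
  (forall j x, (j <= sob_k s)%N -> I01 x -> en (g j x) <= M j) ->
  (forall j, (j < sob_k s)%N ->
     weak_deriv (fun x => (g j x).1) (fun x => (g j.+1 x).1) /\
     weak_deriv (fun x => (g j x).2) (fun x => (g j.+1 x).2)) ->
  0 <= A -> 0 < lam ->
  (0 < sob_sigma s -> forall x y, I01 x -> I01 y ->
     en ((g (sob_k s) x).1 - (g (sob_k s) y).1, (g (sob_k s) x).2 - (g (sob_k s) y).2)
       <= A * Num.min 1 (lam * cdist x y)) ->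
  (Wnorm s p h <= (\sum_(j < (sob_k s).+1) M j +
     (gag_cst (sob_sigma s) p * A `^ p * lam `^ (sob_sigma s * p)) `^ p^-1)%:E)%E.
Proof.
move=> s0 p1 g0 mg Mg wg A0 l0 HA; have p0 : 0 < p by lra.
have pn : p != 0 by rewrite gt_eqF.
have [_ sg0 sg1] := sob_split s0.
have I0 : I01 0 by rewrite /= in_itv /= lexx ler01.
have M0 j : (j <= sob_k s)%N -> 0 <= M j.
  by move=> jk; apply: le_trans (Mg j 0 jk I0); exact: en_ge0.
have pintM j : (j <= sob_k s)%N -> (pint p (g j) <= (M j `^ p)%:E)%E.
  move=> jk; apply: int_I01_le => x Ix; first by rewrite lee_fin powR_ge0.
  rewrite lee_fin; apply: powR_le; [exact: ltW|exact: en_ge0|exact: Mg].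
have gagM : 0 < sob_sigma s -> (gagliardo (sob_sigma s) p (g (sob_k s)) <=
    (gag_cst (sob_sigma s) p * A `^ p * lam `^ (sob_sigma s * p))%:E)%E.
  by move=> sp; apply: gagliardo_lip => //; [rewrite sp sg1|exact: HA].
have fine_root (X : \bar R) (Y : R) : (0 <= X)%E -> (X <= Y%:E)%E ->
    (fine X) `^ (1 / p) <= Y `^ p^-1.
  case: X => [r| |] //; rewrite /= !lee_fin => r0 rY; rewrite mul1r.
  by apply: powR_le => //; rewrite invr_ge0 ltW.
apply: ge_ereal_inf; exists (sob_norm_val s p g)%:E.
  exists g; split => //; split => //; split.
    move=> j jk; have [m1 m2] := mg j jk; split => //; split => //.
    by apply: (le_lt_trans (pintM j jk)); rewrite ltry.
  by split => // sp; apply: (le_lt_trans (gagM sp)); rewrite ltry.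
rewrite lee_fin /sob_norm_val; apply: lerD.
  apply: ler_sum => j _; have jk : (j <= sob_k s)%N by rewrite -ltnS.
  have -> : M j = (M j `^ p) `^ p^-1 by rewrite -powRrM mulfV // powRr1 // M0.
  apply: fine_root; last exact: pintM.
  by apply: integral_ge0 => x _; rewrite lee_fin powR_ge0.
case: ifPn => sp; last exact: powR_ge0.
apply: fine_root; last exact: gagM.
apply: integral_ge0 => x _; apply: integral_ge0 => y _.
by rewrite lee_fin divr_ge0 ?powR_ge0.
Qed.

End Upper.

(** * Pairs of smooth maps with prescribed degrees *)

Section Construction.
Variable R : realType.
Local Notation mu := (@lebesgue_measure R).
Local Notation I01 := (`[0%R, 1%R]%classic : set R).

(** Order 0 is h itself, because a witness starts with h as a function on the line, whereas h agrees
    with the smooth pair (u1, u2) only on [0,1]. *)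
Definition chain (h : R -> R * R) (u1 u2 : R -> R) (j : nat) (x : R) : R * R :=
  if j is 0%N then h x else (derive1n j u1 x, derive1n j u2 x).

Lemma weak_deriv_eq (u u' v : R -> R) : (forall x, I01 x -> u x = u' x) ->
  weak_deriv u v -> weak_deriv u' v.
Proof.
move=> uu wu phi sphi pphi; rewrite -wu //.
by apply: eq_integral => x /set_mem Ix; rewrite uu.
Qed.

Section Chain.
Variables (h : R -> R * R) (u1 u2 : R -> R).
Hypotheses (s1 : smooth_fun u1) (s2 : smooth_fun u2).
Hypotheses (e1 : forall j, derive1n j u1 0 = derive1n j u1 1).
Hypotheses (e2 : forall j, derive1n j u2 0 = derive1n j u2 1).
Hypothesis hu : forall x, I01 x -> h x = (u1 x, u2 x).

Lemma chainE j x : I01 x -> chain h u1 u2 j x = (derive1n j u1 x, derive1n j u2 x).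
Proof. by case: j => [|j] // Ix; rewrite /chain hu. Qed.

Lemma chain_meas j : meas2 (chain h u1 u2 j).
Proof.
have c1 := smooth_cont (smooth_derive1n (n := j) s1).
have c2 := smooth_cont (smooth_derive1n (n := j) s2).
have mI : measurable I01 by exact: measurable_itv.
split.
  apply: (eq_measurable_fun (derive1n j u1)); last exact: continuous_measurable.
  by move=> x /set_mem Ix; rewrite chainE.
apply: (eq_measurable_fun (derive1n j u2)); last exact: continuous_measurable.
by move=> x /set_mem Ix; rewrite chainE.
Qed.

Lemma chain_weak j :
  weak_deriv (fun x => (chain h u1 u2 j x).1) (fun x => (chain h u1 u2 j.+1 x).1) /\
  weak_deriv (fun x => (chain h u1 u2 j x).2) (fun x => (chain h u1 u2 j.+1 x).2).
Proof.
split.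
  apply: (@weak_deriv_eq (derive1n j u1)); first by move=> x Ix; rewrite chainE.
  exact: (smooth_weak_deriv (smooth_derive1n (n := j) s1) (e1 j)).
apply: (@weak_deriv_eq (derive1n j u2)); first by move=> x Ix; rewrite chainE.
exact: (smooth_weak_deriv (smooth_derive1n (n := j) s2) (e2 j)).
Qed.

Lemma cdist_le1 (x y : R) : I01 x -> I01 y -> cdist x y <= 1.
Proof.
rewrite /= !in_itv /= => /andP[x0 x1] /andP[y0 y1].
rewrite /cdist ge_min; apply/orP; left; rewrite ler_norml; apply/andP; split; lra.
Qed.

Lemma Wnorm_smooth_lty (s p : R) : 0 <= s -> 1 <= p -> (Wnorm s p h < +oo)%E.
Proof.
move=> s0 p1.
have /choice[M HM] : forall j, exists M : R, forall x, I01 x -> en (chain h u1 u2 j x) <= M.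
  move=> j; have [M1 _ H1] := cont_bounded (smooth_cont (smooth_derive1n (n := j) s1)).
  have [M2 _ H2] := cont_bounded (smooth_cont (smooth_derive1n (n := j) s2)).
  exists (M1 + M2) => x Ix; rewrite chainE //; apply: (le_trans (en_le _)).
  by apply: lerD; [exact: H1|exact: H2].
set k := sob_k s.
have [K1 K10 HK1] := cont_bounded (smooth_cont (smooth_derive1n (n := k.+1) s1)).
have [K2 K20 HK2] := cont_bounded (smooth_cont (smooth_derive1n (n := k.+1) s2)).
have := @Wnorm_le R s p (K1 + K2) 1 h (chain h u1 u2) M s0 p1 erefl
  (fun j _ => chain_meas j) (fun j x _ Ix => HM j x Ix) (fun j _ => chain_weak j)
  (addr_ge0 K10 K20) ltr01.
move=> /(_ _)/le_lt_trans; apply; last exact: ltry.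
move=> _ x y Ix Iy; rewrite !chainE // mul1r.
have -> : Num.min 1 (cdist x y) = cdist x y by apply/min_idPr; exact: cdist_le1.
apply: (le_trans (en_le _)); rewrite mulrDl; apply: lerD.
  exact: (lip_cdist (smooth_derive1n (n := k) s1) (e1 k) HK1).
exact: (lip_cdist (smooth_derive1n (n := k) s2) (e2 k) HK2).
Qed.

End Chain.

Lemma derive1n_cst0 j (x : R) : derive1n j (fun=> 0 : R) x = 0.
Proof.
elim: j x => [//|j IH] x.
have E : derive1n j (fun=> 0 : R) = (fun=> 0) by apply/funext.
by rewrite -[LHS]/(derive1 (derive1n j (fun=> 0 : R)) x) E (has_drv_val (has_drv_cst 0)).
Qed.

Lemma Wnorm0 (s p : R) : 0 <= s -> 1 <= p -> (Wnorm s p (fun=> (0%R:R, 0%R:R)) <= 0)%E.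
Proof.
move=> s0 p1; have p0 : 0 < p by lra.
have sz : smooth_fun (fun=> 0 : R) by exact: smooth_cst.
have ez j : derive1n j (fun=> 0 : R) 0 = derive1n j (fun=> 0 : R) 1 by rewrite !derive1n_cst0.
have hz x : I01 x -> (fun=> (0:R, 0:R)) x = ((fun=> 0 : R) x, (fun=> 0 : R) x) by [].
have en0 : en ((0 : R), (0 : R)) = 0 by rewrite /en /= expr0n /= addr0 sqrtr0.
have := @Wnorm_le R s p 0 1 (fun=> (0:R, 0:R)) (chain (fun=> (0:R, 0:R)) (fun=> 0) (fun=> 0)) (fun=> 0)
  s0 p1 erefl (fun j _ => chain_meas sz sz hz j) _
  (fun j _ => chain_weak sz sz ez ez hz j) (lexx 0) ltr01.
move=> /(_ _ _)/le_trans; apply.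
- by move=> j x _ Ix; rewrite chainE // !derive1n_cst0 en0.
- by move=> _ x y Ix Iy; rewrite !chainE // !derive1n_cst0 /= !subr0 en0 mul0r.
rewrite lee_fin big1 // add0r powR0 ?gt_eqF // mulr0 mul0r powR0 //.
by rewrite invr_neq0 // gt_eqF.
Qed.

Lemma smooth_S1_Edeg (s p : R) (F : R -> R * R) (d : int) : 0 <= s -> 1 <= p ->
  smooth_S1_map F -> has_degree F d -> Edeg s p d F.
Proof.
move=> s0 p1 SF dF; have [F1 [F2 [F3 F4]]] := SF; split.
  split; last by apply: aeW => x _; exact: F4.
  apply: (@Wnorm_smooth_lty F (fun x => (F x).1) (fun x => (F x).2)) => //.
  - by move=> j; apply: smooth_periodic_ends => // x; rewrite F3.
  - by move=> j; apply: smooth_periodic_ends => // x; rewrite F3.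
  - by move=> x _; case: (F x).
exists (fun=> F); split => // e e0; exists 0%N => n _.
rewrite (_ : fsub F F = (fun=> (0:R, 0:R))); last by apply/funext => x; rewrite /fsub !subrr.
by apply: (le_trans (Wnorm0 s0 p1)); rewrite lee_fin ltW.
Qed.

Lemma Wnorm_ge0 (s p : R) h : (0 <= Wnorm s p h)%E.
Proof.
apply/ereal_infP => _ [g [_ ->]]; rewrite lee_fin /sob_norm_val addr_ge0 //.
  by apply: sumr_ge0 => j _; exact: powR_ge0.
by case: ifP => // _; exact: powR_ge0.
Qed.

Lemma distW_ge0 (s p : R) d1 d2 : (0 <= distW s p d1 d2)%E.
Proof. by apply/ereal_infP => _ [f _ [g _ <-]]; exact: Wnorm_ge0. Qed.

Lemma distW_le (s p : R) (F G : R -> R * R) (d1 d2 : int) : 0 <= s -> 1 <= p ->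
  smooth_S1_map F -> has_degree F d1 -> smooth_S1_map G -> has_degree G d2 ->
  (distW s p d1 d2 <= Wsemi s p (fsub F G))%E.
Proof.
move=> s0 p1 sF dF sG dG; apply: ereal_inf_lbound.
by exists F; [exact: smooth_S1_Edeg|exists G => //; exact: smooth_S1_Edeg].
Qed.

Lemma S1_of_angle (th : R -> R) (d : int) : smooth_fun th ->
  (forall x, th (x + 1) = th x + 2 * pi * d%:~R) ->
  let F x := (cos (th x), sin (th x)) in smooth_S1_map F /\ has_degree F d.
Proof.
move=> sth pth F; have c1 := cos_2pi_int R d.
have s1 : sin (2 * pi * d%:~R) = 0 :> R.
  by apply/eqP; rewrite -norm_cos_eq1 c1 normr1.
split; last first.
  exists th; split; first exact: smooth_cont.
  by split => //; rewrite -[X in th X - _]add0r pth addrC addKr.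
split; first exact: (smooth_comp (@smooth_cos R) sth).
split; first exact: (smooth_comp (@smooth_sin R) sth).
split => x; first by rewrite /F pth cosD sinD c1 s1 !mulr1 !mulr0 subr0 addr0.
by rewrite /en /F /= cos2Dsin2 sqrtr1.
Qed.

Lemma primitive_shift (b B : R -> R) : has_drv B b -> periodic1 b ->
  forall x, B (x + 1) = B x + (B 1 - B 0).
Proof.
move=> hB pb x.
have h1 := has_drv_comp hB (has_drvD (has_drv_id R) (has_drv_cst 1)).
have h2 := has_drvD h1 (has_drvN hB).
have h3 : has_drv (fun x => B (x + 1) - B x) (fun=> 0).
  split=> y; apply: (is_derive_subst (has_drvE h2 y)).
  by rewrite addr0 mulr1 pb subrr.
have := has_drv0_cst h3 x 0; rewrite add0r => h; lra.
Qed.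

(** A smooth staircase, the normalized primitive of a bump at the integers: it climbs by 1 near each
    integer and is flat elsewhere. It will carry the common phase. *)
Lemma bump_step (rho : R) : 0 < rho -> rho <= 2^-1 ->
  exists B : R -> R, [/\ smooth_fun B, forall x, B (x + 1) = B x + 1 &
    forall x, rho <= x <= 1 - rho -> B x = 0].
Proof.
move=> r0 r1; have sb := @bump_smooth R 1 0 rho; have pb := @bump_periodic R 1 0 rho.
have [B [hB B0]] := primitive_ex (smooth_cont sb).
have sB := smooth_prim hB sb.
have mono x y : x <= y -> B x <= B y.
  move=> xy; have [c _ h] := has_drv_MVT hB xy.
  by rewrite -subr_ge0 h mulr_ge0 ?subr_ge0 // bump_ge0.
have I0 : 0 < B 1 - B 0.
  have r2 : 0 <= rho / 2 by lra.
  have [c /andP[c1 c2] h] := has_drv_MVT hB r2.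
  have : 0 < B (rho / 2) - B 0.
    rewrite h mulr_gt0 ?subr_gt0 //; last by lra.
    rewrite flatexp_gt0 // mul1r subr0; apply: cos_gap_gt0 => //.
    by rewrite ger0_norm //; lra.
  by have := mono (rho / 2) 1 _; lra.
exists (fun x => (B 1 - B 0)^-1 * (B x - B (1 / 2))); split.
- by apply: smoothM; [exact: smooth_cst|apply: (smoothB sB); exact: smooth_cst].
- move=> x; rewrite (primitive_shift hB pb); field; exact: lt0r_neq0.
- have flat x y : rho <= x -> x <= y -> y <= 1 - rho -> B x = B y.
    move=> rx xy yr; have [c /andP[c1 c2] h] := has_drv_MVT hB xy.
    apply/eqP; rewrite eq_sym -subr_eq0 h /bump flatexp_le0E ?mul0r // mul1r subr0.
    by apply: cos_gap_le0; rewrite ?ger0_norm //; lra.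
  move=> x /andP[x1 x2]; case/orP: (le_total x (1 / 2)) => h.
    by rewrite (flat x (1 / 2)) ?subrr ?mulr0 //; lra.
  by rewrite (flat (1 / 2) x) ?subrr ?mulr0 //; lra.
Qed.

Lemma shift_nat (dl : R -> R) : (forall x, dl (x + 1) = dl x + pi) ->
  forall n x, dl (x + n%:R) = dl x + pi * n%:R.
Proof.
move=> h; elim=> [|n IH] x; first by rewrite mulr0 !addr0.
by rewrite -[n.+1%:R]natr1 addrA h IH; ring.
Qed.

(* F = exp(i(m + D)) and G = exp(i(m - D)) give F - G = 2 i exp(i m) sin D; the common phase m
   only varies where D is a multiple of pi. *)
Lemma pair_exists (dl : R -> R) (n : nat) (d1 d2 : int) : smooth_fun dl ->
  (forall x, dl (x + 1) = dl x + pi) -> (forall x, `|x| <= 8^-1 -> dl x = 0) ->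
  (0 < n)%N -> absz (d1 - d2) = n ->
  exists F G e, [/\ smooth_S1_map F /\ has_degree F d1, smooth_S1_map G /\ has_degree G d2,
    `|e| = 1 :> R & forall x, I01 x -> (F x).1 - (G x).1 = 0 /\
      (F x).2 - (G x).2 = 2 * (e * sin (dl (n%:R * x)))].
Proof.
move=> sdl pdl zdl n0 dn.
have nR : 1 <= n%:R :> R by rewrite ler1n.
have n0R : n%:R != 0 :> R by rewrite lt0r_neq0 // ltr0n.
(* For |x| <= rho the argument n x stays within 1/8 of 0, where [dl] vanishes: there the phase may
   vary freely. *)
pose rho : R := (8 * n%:R)^-1.
have rho0 : 0 < rho by rewrite invr_gt0; lra.
have nrho : n%:R * rho = 8^-1 by rewrite /rho invfM mulrCA mulfV // mulr1.
have rho1 : rho <= 8^-1 by nra.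
have [|B [sB pB zB]] := bump_step rho0; first by lra.
pose e : R := if (d2 <= d1)%R then 1 else -1.
have e1 : `|e| = 1 by rewrite /e; case: ifP => _; rewrite ?normrN normr1.
have nE : e * n%:R = (d1 - d2)%:~R.
  rewrite -dn /e; case: (leP d2 d1) => h.
    by rewrite mul1r -[in RHS](@gez0_abs (d1 - d2)%R) ?subr_ge0.
  rewrite mulN1r -[in RHS](opprK (d1 - d2)%R) [in RHS]intrN -(abszN (d1 - d2)).
  by rewrite -[in RHS](@gez0_abs (- (d1 - d2))%R) // oppr_ge0 subr_le0 ltW.
(* Over a period m gains pi (d1 + d2) and D gains pi (d1 - d2), so m + D and m - D gain 2 pi d1 and
   2 pi d2. *)
pose m x := pi * (d1 + d2)%:~R * B x.
pose D x := e * dl (n%:R * x).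
have sm : smooth_fun m by apply: smoothM; [exact: smooth_cst|exact: sB].
have sD : smooth_fun D.
  apply: smoothM; first exact: smooth_cst.
  apply: (smooth_comp sdl); apply: smoothM; [exact: smooth_cst|exact: smooth_id].
have pm x : m (x + 1) = m x + pi * (d1 + d2)%:~R by rewrite /m pB; ring.
have pD x : D (x + 1) = D x + pi * (d1 - d2)%:~R.
  by rewrite /D mulrDr mulr1 (shift_nat pdl) -nE; ring.
have [||sF dF] := @S1_of_angle (fun x => m x + D x) d1; first exact: smoothD.
  by move=> x; rewrite pm pD !intrD intrN; ring.
have [||sG dG] := @S1_of_angle (fun x => m x - D x) d2; first exact: smoothB.
  by move=> x; rewrite pm pD !intrD intrN; ring.
exists (fun x => (cos (m x + D x), sin (m x + D x))), (fun x => (cos (m x - D x), sin (m x - D x))), e.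
split => // x; rewrite /= in_itv /= => /andP[x0 x1].
rewrite cosD cosB sinD sinB.
have sinD' : sin (D x) = e * sin (dl (n%:R * x)).
  by rewrite /D /e; case: ifP => _; rewrite ?mul1r // !mulN1r sinN.
have key : (cos (m x) = 1 /\ sin (m x) = 0) \/ sin (D x) = 0.
  have [xr|xr] := leP x rho.
    right; rewrite sinD' zdl ?sin0 ?mulr0 // ger0_norm; last by rewrite mulr_ge0.
    by rewrite -nrho; apply: ler_wpM2l.
  have [xr'|xr'] := leP x (1 - rho).
    by left; rewrite /m zB ?(ltW xr) // mulr0 cos0 sin0.
  right; rewrite sinD'; have -> : n%:R * x = n%:R * (x - 1) + n%:R by ring.
  rewrite (shift_nat pdl) zdl ?add0r.
    have := cos_2pi_int R n%:Z; rewrite -pmulrn => h.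
    have : sin (pi * n%:R) = 0 :> R.
      apply/eqP; rewrite -sqrf_eq0 sin2cos2.
      rewrite (_ : 2 * pi * n%:R = (pi * n%:R) *+ 2) in h; last by rewrite -mulr_natl; ring.
      by rewrite cos_mulr2n in h; apply/eqP; lra.
    by move=> ->; rewrite mulr0.
  have x10 : 1 - x <= rho by lra.
  rewrite normrM (ger0_norm (ler0n _ _)) (ler0_norm (_ : x - 1 <= 0)); last by lra.
  by rewrite -nrho opprB; apply: ler_wpM2l.
case: key => [[-> ->]|h].
  by rewrite !mul0r !mul1r sinD'; split; ring.
by rewrite -sinD' h; split; ring.
Qed.

End Construction.

(** * Angle functions and their antiperiodic sine *)

Section AngleProfile.
Variable R : realType.
Local Notation mu := (@lebesgue_measure R).
Local Notation I01 := (`[0%R, 1%R]%classic : set R).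

(** Once the mean is a value u c, the centred function is a difference of two values of u. *)
Lemma mean_attained (u : R -> R) : continuous u ->
  exists2 c, I01 c & (\int[mu]_(x in I01) u x)%R = u c.
Proof.
move=> cu; have [B [hB _]] := primitive_ex cu.
have [c c01 h] := has_drv_MVT hB (@ler01 R).
exists c; first by rewrite /= in_itv.
by rewrite /Rintegral (has_drv_FTC2 (@ler01 R) hB cu) /= h subr0 mulr1.
Qed.

Lemma angle_of_density (b B : R -> R) : smooth_fun b -> periodic1 b -> has_drv B b ->
  B 0 = 0 -> 0 < B 1 -> (forall x, `|x| <= 8^-1 -> b x = 0) ->
  let dl x := pi / B 1 * B x in
  [/\ smooth_fun dl, forall x, dl (x + 1) = dl x + pi & forall x, `|x| <= 8^-1 -> dl x = 0].
Proof.
move=> sb pb hB B0 B1 zb dl; split.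
- by apply: smoothM; [exact: smooth_cst|exact: smooth_prim hB sb].
- move=> x; rewrite /dl (primitive_shift hB pb) B0 subr0; field; exact: lt0r_neq0.
- move=> x; rewrite ler_norml => /andP[x1 x2]; rewrite /dl.
  suff -> : B x = 0 by rewrite mulr0.
  rewrite -B0; case/orP: (le_total 0 x) => x0.
    have [c /andP[c1 c2] h] := has_drv_MVT hB x0.
    by apply/eqP; rewrite -subr_eq0 h zb ?mul0r // ger0_norm //; lra.
  have [c /andP[c1 c2] h] := has_drv_MVT hB x0.
  by apply/eqP; rewrite eq_sym -subr_eq0 h zb ?mul0r // ler0_norm //; lra.
Qed.

Lemma bump_half_zero (x : R) : `|x| <= 8^-1 -> bump 1 (1 / 2) (3 / 8) x = 0.
Proof.
rewrite ler_norml => /andP[x1 x2]; rewrite /bump flatexp_le0E // mul1r.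
apply: cos_gap_le0; first by lra.
  by rewrite ler0_norm; lra.
by rewrite ler0_norm; lra.
Qed.

Lemma angle_ex : exists dl : R -> R, [/\ smooth_fun dl,
  forall x, dl (x + 1) = dl x + pi & forall x, `|x| <= 8^-1 -> dl x = 0].
Proof.
have sb := @bump_smooth R 1 (1 / 2) (3 / 8).
have [B [hB B0]] := primitive_ex (smooth_cont sb).
have mono x y : x <= y -> B x <= B y.
  move=> xy; have [c _ h] := has_drv_MVT hB xy.
  by rewrite -subr_ge0 h mulr_ge0 ?subr_ge0 // bump_ge0.
have B1 : 0 < B 1.
  have r2 : 1 / 4 <= 3 / 4 :> R by lra.
  have [c /andP[c1 c2] h] := has_drv_MVT hB r2.
  have : 0 < B (3 / 4) - B (1 / 4).
    rewrite h mulr_gt0 ?subr_gt0 //; last by lra.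
    rewrite flatexp_gt0 // mul1r; apply: cos_gap_gt0; first by lra.
    by rewrite ltr_norml; apply/andP; split; lra.
  have h1 : B (3 / 4) <= B 1 by apply: mono; lra.
  have h2 : B 0 <= B (1 / 4) by apply: mono; lra.
  by rewrite B0 in h2; lra.
have := angle_of_density sb (@bump_periodic R 1 (1 / 2) (3 / 8)) hB B0 B1 bump_half_zero.
by move=> h; eexists; exact: h.
Qed.

Lemma antiperiodic_derive1n (u : R -> R) k : smooth_fun u -> (forall x, u (x + 1) = - u x) ->
  forall x, derive1n k u (x + 1) = - derive1n k u x.
Proof.
move=> su pu; elim: k => [//|k IH] x.
have hk := smooth_drvn k su.
have h1 := has_drv_val (has_drv_comp hk (has_drvD (has_drv_id R) (has_drv_cst 1))).
have h2 := has_drv_val (has_drvN hk).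
have E : (fun x => derive1n k u (x + 1)) = (fun x => - derive1n k u x) by apply/funext.
by rewrite E h2 in h1; have := congr1 (@^~ x) h1; rewrite /= addr0 mulr1 => <-.
Qed.

Lemma antiperiodic_norm (g : R -> R) (n : nat) x : (forall x, g (x + 1) = - g x) ->
  `|g (x + n%:R)| = `|g x|.
Proof.
move=> h; elim: n => [|n IH]; first by rewrite addr0.
by rewrite -[n.+1%:R]natr1 addrA h normrN.
Qed.

Lemma antiperiodic_bounded (g : R -> R) : continuous g -> (forall x, g (x + 1) = - g x) ->
  exists2 M, 0 <= M & forall x, 0 <= x -> `|g x| <= M.
Proof.
move=> cg ag; have [M M0 HM] := cont_bounded cg; exists M => // x x0.
have /andP[h1 h2] := truncn_itv x0.
rewrite -(subrK (Num.truncn x)%:R x) antiperiodic_norm //; apply: HM.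
rewrite /= in_itv /= subr_ge0 h1 /=; rewrite -[_.+1%:R]natr1 in h2; lra.
Qed.

(** Flatness near 0, and by antiperiodicity near every integer, makes all derivatives of S(n x)
    agree at 0 and 1 even when n is odd and S(n x) changes sign over the period. *)
Lemma derive1n_locally0 (u : R -> R) (r : R) k : 0 < r -> (forall x, `|x| < r -> u x = 0) ->
  forall x, `|x| < r -> derive1n k u x = 0.
Proof.
move=> r0 hu; elim: k => [//|k IH] x xr.
rewrite derive1nS derive1E -(derive_cst (0 : R) x 1); apply: near_eq_derive.
have h : 0 < r - `|x| by rewrite subr_gt0.
near=> y; apply: IH.
have : `|x - y| < r - `|x| by near: y; exact: nbhsx_ballx.
have := ler_normD x (y - x); rewrite addrC subrK (distrC y x) => *; lra.
Unshelve. all: by end_near.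
Qed.

Lemma derive1n_affine (f : R -> R) (a l c : R) j : smooth_fun f -> (0 < j)%N ->
  forall x, derive1n j (fun x => a * f (l * x) - c) x = a * l ^+ j * derive1n j f (l * x).
Proof.
move=> sf; case: j => // j _.
have aff : has_drv (fun x => l * x) (fun=> l).
  split=> x; have h := has_drvE (has_drvM (has_drv_cst l) (has_drv_id R)) x.
  by apply: (is_derive_subst h); rewrite mul0r add0r mulr1.
have step k (d : R) : has_drv (fun x => a * l ^+ k * derive1n k f (l * x) - d)
    (fun x => a * l ^+ k.+1 * derive1n k.+1 f (l * x)).
  have h1 := has_drv_comp (smooth_drvn k sf) aff.
  have h2 := has_drvD (has_drvM (has_drv_cst (a * l ^+ k)) h1) (has_drvN (has_drv_cst d)).
  by split=> x; apply: (is_derive_subst (has_drvE h2 x)); rewrite exprS; ring.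
elim: j => [|j IH] x.
  rewrite derive1n1 -[RHS]/((fun y => a * l ^+ 1 * derive1n 1 f (l * y)) x).
  rewrite -(has_drv_val (step 0%N c)); congr (derive1 _ x).
  by apply/funext => y; rewrite expr0 mulr1.
rewrite derive1nS -[RHS]/((fun y => a * l ^+ j.+2 * derive1n j.+2 f (l * y)) x).
rewrite -(has_drv_val (step j.+1 0)); congr (derive1 _ x).
by apply/funext => y; rewrite subr0 IH.
Qed.

Lemma Wsemi_centered (F G : R -> R * R) (v : R -> R) : continuous v ->
  (forall x, I01 x -> (F x).1 - (G x).1 = 0 /\ (F x).2 - (G x).2 = v x) ->
  exists c, [/\ I01 c, (\int[mu]_(x in I01) v x)%R = v c & forall x, I01 x ->
    ((fsub F G x).1 - (mean (fsub F G)).1, (fsub F G x).2 - (mean (fsub F G)).2) = (0, v x - v c)].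
Proof.
move=> cv H; have [c Ic hc] := mean_attained cv.
exists c; split => // x Ix; rewrite /fsub /=; have [-> ->] := H x Ix; rewrite -hc.
congr (_, _ - _); last by apply: eq_Rintegral => y /set_mem Iy; rewrite (H y Iy).2.
rewrite sub0r; apply/eqP; rewrite oppr_eq0; apply/eqP.
rewrite (_ : Rintegral _ _ _ = \int[mu]_(x in I01) (0 : R))%R.
  by rewrite /Rintegral integral0_eq.
by apply: eq_Rintegral => y /set_mem Iy; rewrite (H y Iy).1.
Qed.

End AngleProfile.

(** * The upper bound of order n^s *)

Section UpperBound.
Variable R : realType.
Local Notation mu := (@lebesgue_measure R).
Local Notation I01 := (`[0%R, 1%R]%classic : set R).

Lemma distW_diag (s p : R) (d : int) : 0 <= s -> 1 <= p -> (distW s p d d <= 0)%E.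
Proof.
move=> s0 p1; pose th (x : R) := 2 * pi * d%:~R * x.
have sth : smooth_fun th by apply: smoothM; [exact: smooth_cst|exact: smooth_id].
have [|sF dF] := @S1_of_angle R th d sth; first by move=> x; rewrite /th; ring.
apply: (le_trans (distW_le s0 p1 sF dF sF dF)); rewrite /Wsemi.
have [c [_ _ hc]] := @Wsemi_centered R (fun x => (cos (th x), sin (th x)))
  (fun x => (cos (th x), sin (th x))) _ (smooth_cont (@smooth_cst R 0))
  (fun x _ => conj (subrr _) (subrr _)).
rewrite (_ : (fun x => _) = (fun=> (0 : R, 0 : R))); first exact: Wnorm0.
have I0 : I01 0 by rewrite /= in_itv /= lexx ler01.
have := hc 0 I0; rewrite /fsub !subrr !sub0r => -[-> ->].
by apply/funext => x; rewrite /= !subrr !add0r.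
Qed.

(** The j-th derivative costs n^j, and the top seminorm, with amplitude of order n^k and frequency
    n, costs n^k n^sg = n^s. As n >= 1 and j <= k <= s, every term is at most of order n^s. *)
Lemma upper_profile (s p : R) (S : R -> R) : 0 < s -> 1 <= p -> smooth_fun S ->
  (forall x, S (x + 1) = - S x) -> (forall x, `|x| < 8^-1 -> S x = 0) ->
  exists2 C, 0 < C & forall (n : nat) (h : R -> R * R) (a c : R), (0 < n)%N -> `|a| <= 2 ->
    I01 c -> (forall x, I01 x -> h x = (0, a * S (n%:R * x) - a * S (n%:R * c))) ->
    (Wnorm s p h <= (C * n%:R `^ s)%:E)%E.
Proof.
move=> s0 p1 sS aS zS; have s0' := ltW s0; have p0 : 0 < p by lra.
have [skE sg0 sg1] := sob_split s0'.
have /choice[B HB] : forall j, exists M, 0 <= M /\ forall x, 0 <= x -> `|derive1n j S x| <= M.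
  move=> j; have [M M0 HM] := antiperiodic_bounded
    (smooth_cont (smooth_derive1n (n := j) sS)) (antiperiodic_derive1n j sS aS).
  by exists M.
have B0 j : 0 <= B j := (HB j).1.
have {}HB j x : 0 <= x -> `|derive1n j S x| <= B j := (HB j).2 x.
have e8 : 0 < 8^-1 :> R by [].
have z0 j : derive1n j S 0 = 0 by apply: (derive1n_locally0 j e8 zS); rewrite normr0.
set k := sob_k s in skE *; set sg := sob_sigma s in skE sg0 sg1 *.
(* One constant for both the size and the slope of the k-th derivative; the summand 1 keeps it
   positive. *)
pose b := B k + B k.+1 + 1.
have b0 : 0 < b by rewrite /b; have := B0 k; have := B0 k.+1; lra.
pose gc := gag_cst sg p.
have gc0 : 0 <= gc.
  by rewrite /gc /gag_cst !mulr_ge0 // ?addr_ge0 // invr_ge0 mulr_ge0 // ?subr_ge0; lra.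
have g0 : 0 <= gc `^ p^-1 by exact: powR_ge0.
exists (\sum_(j < k.+1) 4 * (B j + 1) + (gc `^ p^-1 + 1) * (4 * b)).
  apply: ltr_wpDl; last by rewrite !mulr_gt0 //; lra.
  by apply: sumr_ge0 => j _; have := B0 j; lra.
move=> n h a c n0 a2 Ic hE.
have nR : 1 <= n%:R :> R by rewrite ler1n.
have nR0 : 0 < n%:R :> R by lra.
pose u2 x := a * S (n%:R * x) - a * S (n%:R * c).
have s1 : smooth_fun (fun=> 0 : R) by exact: smooth_cst.
have snx : smooth_fun (fun x : R => n%:R * x).
  by apply: smoothM; [exact: smooth_cst|exact: smooth_id].
have s2 : smooth_fun u2.
  apply: smoothB; last exact: smooth_cst.
  by apply: smoothM; [exact: smooth_cst|exact: (smooth_comp sS snx)].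
have zn j : derive1n j S n%:R = 0.
  apply/eqP; rewrite -normr_eq0 -(add0r n%:R).
  by rewrite (antiperiodic_norm _ _ (antiperiodic_derive1n j sS aS)) z0 normr0.
have e1 j : derive1n j (fun=> 0 : R) 0 = derive1n j (fun=> 0 : R) 1 by rewrite !derive1n_cst0.
have dE j x : (0 < j)%N -> derive1n j u2 x = a * n%:R ^+ j * derive1n j S (n%:R * x).
  by move=> j0; rewrite derive1n_affine.
have e2 j : derive1n j u2 0 = derive1n j u2 1.
  case: j => [|j]; last by rewrite !dE // mulr0 mulr1 z0 zn.
  by rewrite /= /u2 mulr0 mulr1 (z0 0%N : S 0 = 0) (zn 0%N : S n%:R = 0).
have nx x : I01 x -> 0 <= n%:R * x.
  by rewrite /= in_itv /= => /andP[x0 _]; rewrite mulr_ge0.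
have anB j x : I01 x -> `|a * n%:R ^+ j * derive1n j S (n%:R * x)| <= 2 * (n%:R ^+ j * B j).
  move=> Ix; rewrite !normrM (ger0_norm (exprn_ge0 _ (ltW nR0))) -mulrA.
  have nj : 0 <= n%:R ^+ j :> R by apply: exprn_ge0; exact: ltW.
  have h1 : n%:R ^+ j * `|derive1n j S (n%:R * x)| <= n%:R ^+ j * B j.
    by apply: ler_wpM2l => //; apply: HB; exact: nx.
  exact: (ler_pM (normr_ge0 _) (mulr_ge0 nj (normr_ge0 _)) a2 h1).
have np j : 1 <= n%:R ^+ j :> R by rewrite exprn_ege1.
have d2 j x y : I01 x -> I01 y -> `|derive1n j u2 x - derive1n j u2 y| <= 4 * (n%:R ^+ j * B j).
  move=> Ix Iy; have h1 := anB j x Ix; have h2 := anB j y Iy.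
  have -> : derive1n j u2 x - derive1n j u2 y =
     a * n%:R ^+ j * derive1n j S (n%:R * x) - a * n%:R ^+ j * derive1n j S (n%:R * y).
    case: j h1 h2 => [|j] _ _; last by rewrite !dE.
    by rewrite /= /u2 expr0; ring.
  by apply: (le_trans (ler_normB _ _)); lra.
have en0 (z : R) : en (0, z) <= `|z|.
  by apply: (le_trans (en_le _)); rewrite /= normr0 add0r.
have chE := chainE (u1 := fun=> 0) (u2 := u2) hE.
(* The 4 is twice the bound 2 on |a|, because order 0 is a difference of two values. *)
pose M j := 4 * (n%:R ^+ j * (B j + 1)).
have HM j x : (j <= k)%N -> I01 x -> en (chain h (fun=> 0) u2 j x) <= M j.
  move=> _ Ix; rewrite chE // derive1n_cst0; apply: (le_trans (en0 _)).
  have h1 : n%:R ^+ j * B j <= n%:R ^+ j * (B j + 1).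
    by apply: ler_wpM2l; [have := np j; lra|lra].
  case: j h1 => [|j] h1; rewrite /M; last first.
    by rewrite dE //; have := anB j.+1 x Ix; have := B0 j.+1; nra.
  have h3 := anB 0%N x Ix; have h4 := anB 0%N c Ic; rewrite expr0 !mulr1 /= in h3 h4.
  rewrite /= /u2 expr0 mul1r; apply: (le_trans (ler_normB _ _)).
  rewrite !mul1r in h3 h4; lra.
have := @Wnorm_le R s p (4 * n%:R ^+ k * b) n%:R h (chain h (fun=> 0) u2) M s0' p1 erefl
  (fun j _ => chain_meas s1 s2 hE j) HM (fun j _ => chain_weak s1 s2 e1 e2 hE j) _ nR0.
move=> /(_ _ _)/le_trans; apply.
- by rewrite !mulr_ge0 // ?exprn_ge0 // ltW.
- move=> _ x y Ix Iy; rewrite !chE // !derive1n_cst0 subrr; apply: (le_trans (en0 _)) => /=.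
  have cd : 0 <= cdist x y by exact: cdist_ge0.
  have np' := np k.
  rewrite /Num.min; case: ifPn => _.
    rewrite mulr1; apply: (le_trans (d2 k x y Ix Iy)).
    rewrite -mulrA; apply: ler_wpM2l => //; apply: ler_wpM2l; first by lra.
    by rewrite /b; have := B0 k.+1; lra.
  apply: (le_trans (@lip_cdist R (derive1n k u2) (2 * (n%:R ^+ k.+1 * B k.+1)) x y _ (e2 k) _ Ix Iy)).
  - exact: smooth_derive1n.
  - by move=> z Iz; rewrite -derive1nS dE //; exact: anB.
  rewrite (_ : 4 * n%:R ^+ k * b * (n%:R * cdist x y) = 4 * (n%:R ^+ k.+1 * b) * cdist x y).
    apply: ler_wpM2r => //; have nk := np k.+1.
    have : n%:R ^+ k.+1 * B k.+1 <= n%:R ^+ k.+1 * b.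
      by apply: ler_wpM2l; [lra|rewrite /b; have := B0 k; lra].
    have : 0 <= n%:R ^+ k.+1 * B k.+1 by rewrite mulr_ge0 //; lra.
    lra.
  by rewrite exprS; ring.
rewrite lee_fin [leRHS]mulrDl.
apply: lerD.
  rewrite mulr_suml; apply: ler_sum => j _; 
  rewrite (_ : M j = 4 * (B j + 1) * n%:R ^+ j); last by rewrite /M; ring.
  apply: ler_wpM2l; first by have := B0 j; lra.
  have -> : n%:R ^+ j = n%:R `^ j%:R :> R by rewrite powR_mulrn // ltW.
  apply: ler_powR => //.
  have jk : j%:R <= k%:R :> R by rewrite ler_nat -ltnS.
  by lra.
have nk0 : 0 <= n%:R ^+ k :> R by rewrite exprn_ge0 // ltW.
have A0 : 0 <= 4 * n%:R ^+ k * b by rewrite !mulr_ge0 // ltW.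
have pn : p != 0 by exact: lt0r_neq0.
rewrite -/k -/sg -/gc (powRM _ (mulr_ge0 gc0 (powR_ge0 _ _)) (powR_ge0 _ _)).
rewrite (powRM _ gc0 (powR_ge0 _ _)).
rewrite -!powRrM mulfK // mulfV // powRr1 //.
have -> : n%:R `^ s = n%:R ^+ k * n%:R `^ sg.
  by rewrite -skE powRD ?powR_mulrn ?(ltW nR0) // (lt0r_neq0 nR0) implybT.
have X0 : 0 <= 4 * n%:R ^+ k * b * n%:R `^ sg by rewrite mulr_ge0 // powR_ge0.
by move: X0; move: (n%:R ^+ k) (n%:R `^ sg) (gc `^ p^-1) => X Y Z X0; nra.
Qed.

Lemma distW_upper (s p : R) : 0 < s -> 1 <= p ->
  exists2 C, 0 < C & forall d1 d2 : int,
    (distW s p d1 d2 <= (C * (`|d1 - d2|%:~R) `^ s)%:E)%E.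
Proof.
move=> s0 p1; have s0' := ltW s0; have [dl [sdl pdl zdl]] := angle_ex R.
pose S x := sin (dl x).
have sS : smooth_fun S by exact: (smooth_comp (@smooth_sin R) sdl).
have aS x : S (x + 1) = - S x by rewrite /S pdl sinDpi.
have zS x : `|x| < 8^-1 -> S x = 0 by move=> h; rewrite /S zdl ?sin0 // ltW.
have [C C0 HC] := upper_profile s0 p1 sS aS zS; exists C => // d1 d2.
have [/eqP|n0] := posnP (absz (d1 - d2)).
  rewrite absz_eq0 subr_eq0 => /eqP ->; apply: (le_trans (distW_diag d2 s0' p1)).
  by rewrite lee_fin mulr_ge0 ?powR_ge0 // ltW.
have [F [G [e [[sF dF] [sG dG] e1 FG]]]] := pair_exists sdl pdl zdl n0 erefl.
set n := absz (d1 - d2) in n0 FG.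
apply: (le_trans (distW_le s0' p1 sF dF sG dG)).
have cv : continuous (fun x : R => 2 * e * S (n%:R * x)).
  apply: smooth_cont; apply: smoothM; first exact: smooth_cst.
  by apply: (smooth_comp sS); apply: smoothM; [exact: smooth_cst|exact: smooth_id].
have [|c [Ic _ hc]] := @Wsemi_centered R F G _ cv.
  by move=> x Ix; have [-> ->] := FG x Ix; rewrite mulrA.
have -> : `|d1 - d2|%:~R = n%:R :> R by rewrite /n -abszE.
apply: (HC n _ (2 * e) c n0 _ Ic) => //.
by rewrite normrM e1 mulr1 ger0_norm.
Qed.

End UpperBound.

(** * The critical exponent *)

Section LogEnergy.
Variable R : realType.
Local Notation mu := (@lebesgue_measure R).
Local Notation I01 := (`[0%R, 1%R]%classic : set R).

Lemma int_comb3_le (J : set R) (f1 f2 f3 : R -> R) (X A1 A2 A3 M1 M2 M3 : R) : measurable J ->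
  0 <= X -> 0 <= A1 -> 0 <= A2 -> 0 <= A3 ->
  (forall y, 0 <= f1 y) -> (forall y, 0 <= f2 y) -> (forall y, 0 <= f3 y) ->
  measurable_fun setT f1 -> measurable_fun setT f2 -> measurable_fun setT f3 ->
  (\int[mu]_(y in J) (f1 y)%:E <= M1%:E)%E -> (\int[mu]_(y in J) (f2 y)%:E <= M2%:E)%E ->
  (\int[mu]_(y in J) (f3 y)%:E <= M3%:E)%E ->
  (\int[mu]_(y in J) (X * (A1 * f1 y + (A2 * f2 y + A3 * f3 y)))%:E
    <= (X * (A1 * M1 + (A2 * M2 + A3 * M3)))%:E)%E.
Proof.
move=> mJ X0 A10 A20 A30 f10 f20 f30 m1 m2 m3 h1 h2 h3.
have mE (f : R -> R) (A : R) : measurable_fun setT f -> measurable_fun J (fun y => (A * f y)%:E).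
  move=> mf; apply/measurable_EFinP; apply: measurable_funM; first exact: measurable_cst.
  exact: measurable_funS mf.
have f0 (f : R -> R) (A : R) y : 0 <= A -> (forall y, 0 <= f y) -> J y -> (0 <= (A * f y)%:E)%E.
  by move=> A0 f0 _; rewrite lee_fin mulr_ge0.
have E := ge0_integralD3 mJ X0 (fun y => @f0 f1 A1 y A10 f10) (fun y => @f0 f2 A2 y A20 f20)
  (fun y => @f0 f3 A3 y A30 f30) (mE _ _ m1) (mE _ _ m2) (mE _ _ m3).
have Z (f : R -> R) (A M : R) : 0 <= A -> (forall y, 0 <= f y) -> measurable_fun setT f ->
    (\int[mu]_(y in J) (f y)%:E <= M%:E)%E -> (\int[mu]_(y in J) (A * f y)%:E <= (A * M)%:E)%E.
  move=> A0 ff0 mf hf; under eq_integral do rewrite EFinM.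
  rewrite ge0_integralZl_EFin //; first last.
  - by apply/measurable_EFinP; exact: measurable_funS mf.
  - by move=> y _; rewrite lee_fin.
  by rewrite EFinM; apply: lee_wpmul2l; rewrite ?lee_fin.
under eq_integral do rewrite EFinM !EFinD.
rewrite E EFinM !EFinD; apply: lee_wpmul2l; first by rewrite lee_fin.
by apply: leeD; [exact: Z|apply: leeD; exact: Z].
Qed.

Lemma ln_ratio_le (a b : R) : 0 < b -> b <= a -> ln (a / b) <= (a - b) / b.
Proof.
move=> b0 ba; rewrite (_ : a / b = 1 + (a - b) / b); last by field; exact: lt0r_neq0.
apply: le_ln1Dx; apply: (@lt_le_trans _ _ 0); first by lra.
by rewrite divr_ge0 ?subr_ge0 // ltW.
Qed.

(** The inequality ln u < u at u = t^(1/(2p)). The final power 1/2 is small enough for the singular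
    integrals at c and at infinity to converge. *)
Lemma ln_powR_le (p t : R) : 1 < p -> 1 <= t -> (ln t) `^ p <= (2 * p) `^ p * t `^ 2^-1.
Proof.
move=> p1 t1; have p0 : 0 < p by lra.
have l0 : 0 <= ln t by exact: ln_ge0.
have h : ln t <= 2 * p * t `^ (2 * p)^-1.
  have h1 := ln_sublinear (powR_gt0 (2 * p)^-1 (lt_le_trans ltr01 t1)).
  rewrite ln_powR in h1.
  have q0 : 0 < 2 * p by lra.
  by rewrite mulrC -ler_pdivrMr // mulrC ltW.
apply: (@le_trans _ _ ((2 * p * t `^ (2 * p)^-1) `^ p)); first by apply: powR_le => //; exact: ltW.
rewrite powRM ?powR_ge0 //; last by lra.
rewrite -powRrM (_ : (2 * p)^-1 * p = 2^-1) //; field; exact: lt0r_neq0.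
Qed.

(* The three terms handle |x - y| <= a / 2, then y farther from c than x, then y nearer to c:
   there ln (a / b) is bounded by its argument, respectively by a small power of it. *)
Lemma log_kernel (p eps c x y a : R) : 1 < p -> 0 < eps -> y != c -> x != y ->
  a = `|x - c| + eps ->
  `|ln (a / (`|y - c| + eps))| `^ p / `|x - y| `^ 2 <=
  4 * (2 * p) `^ p * (a `^ (- p) * near_pw x (a / 2) (p - 2) y +
   (a `^ (- 2^-1) * far_pw x (a / 2) (- 1 - 2^-1) y +
    a `^ (- (3 / 2)) * near_pw c a (- 2^-1) y)).
Proof.
move=> p1 e0 yc xy aE; set b := `|y - c| + eps; have p0 : 0 < p by lra.
have w0 : 0 < `|y - c| by rewrite normr_gt0 subr_eq0.
have a0 : 0 < a by rewrite aE ltr_wpDl.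
have b0 : 0 < b by rewrite /b ltr_wpDl.
have r0 : 0 < `|x - y| by rewrite normr_gt0 subr_eq0.
have ry : `|y - x| = `|x - y| by rewrite distrC.
have bar : b - a <= `|x - y|.
  by have := ler_normD (y - x) (x - c); rewrite addrA subrK ry aE /b; lra.
have abr : a - b <= `|x - y|.
  by have := ler_normD (x - y) (y - c); rewrite addrA subrK aE /b; lra.
have K0 : 0 < (2 * p) `^ p by rewrite powR_gt0; lra.
set N1 := a `^ (- p) * _; set N2 := a `^ (- 2^-1) * _; set N3 := a `^ _ * near_pw c _ _ _.
have N10 : 0 <= N1 by rewrite mulr_ge0 ?powR_ge0 ?near_pw_ge0.
have N20 : 0 <= N2 by rewrite mulr_ge0 ?powR_ge0 ?far_pw_ge0.
have N30 : 0 <= N3 by rewrite mulr_ge0 ?powR_ge0 ?near_pw_ge0.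
have r20 : 0 < `|x - y| `^ 2 by rewrite powR_gt0.
set r := `|x - y| in bar abr r0 r20 ry *.
have ln_sym : ln (b / a) = - ln (a / b) by rewrite -invf_div lnV // posrE divr_gt0.
rewrite ler_pdivrMr //.
have [rs|rl] := leP r (a / 2).
  have ba : a / 2 <= b by lra.
  have hl : `|ln (a / b)| <= 2 * r / a.
    have A1 : r / (a / 2) = 2 * r / a by field; exact: lt0r_neq0.
    rewrite -A1; have [h|h] := leP b a.
      rewrite ger0_norm; last by rewrite ln_ge0 // ler_pdivlMr ?mul1r.
      apply: (le_trans (ln_ratio_le b0 h)); apply: ler_pM => //; first by rewrite subr_ge0.
        by rewrite invr_ge0 ltW.
      by rewrite lef_pV2 // posrE; lra.
    rewrite -normrN -ln_sym ger0_norm; last by rewrite ln_ge0 // ler_pdivlMr ?mul1r ?ltW.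
    apply: (le_trans (ln_ratio_le a0 (ltW h))); apply: ler_pM => //; first by rewrite subr_ge0 ltW.
      by rewrite invr_ge0 ltW.
    by rewrite lef_pV2 // ?posrE; lra.
  have N1E : N1 * r `^ 2 = (r / a) `^ p.
    rewrite /N1 /near_pw ry r0 rs /= (powRM _ (ltW r0)) ?invr_ge0 ?(ltW a0) //.
    rewrite -mulrA -powRD ?(lt0r_neq0 r0) ?implybT // subrK.
    by rewrite -(powR_inv1 (ltW a0)) -powRrM mulN1r mulrC.
  apply: (@le_trans _ _ ((2 * p) `^ p * (r / a) `^ p)).
    have ra : 0 <= r / a by rewrite divr_ge0 // ltW.
    have p2 : 0 <= 2 * p by lra.
    rewrite -powRM //; apply: powR_le => //; first exact: ltW.
    apply: (le_trans hl); rewrite -mulrA; apply: ler_wpM2r; last by lra.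
    by rewrite divr_ge0 ?ltW.
  rewrite -N1E mulrA; apply: ler_wpM2r; first exact: ltW.
  by move: (_ `^ p) K0 N10 N20 N30 => X; clear; nra.
have fE : far_pw x (a / 2) (- 1 - 2^-1) y = r `^ (- 1 - 2^-1) by rewrite /far_pw ry (ltW rl).
have [h|h] := leP a b.
  rewrite -normrN -ln_sym ger0_norm; last by rewrite ln_ge0 // ler_pdivlMr ?mul1r.
  have t1 : 1 <= b / a by rewrite ler_pdivlMr ?mul1r.
  apply: (le_trans (ln_powR_le p1 t1)).
  have h4 : (b / a) `^ 2^-1 <= 4 * (r `^ 2^-1 * a `^ (- 2^-1)).
    apply: (@le_trans _ _ ((4 * (r / a)) `^ 2^-1)).
      apply: powR_le => //; first by rewrite divr_ge0 ?ltW.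
      rewrite mulrA; apply: ler_wpM2r; first by rewrite invr_ge0 ltW.
      by lra.
    have ai : 0 <= a^-1 by rewrite invr_ge0 ltW.
    rewrite (powRM _ _ (mulr_ge0 (ltW r0) ai)) // (powRM _ (ltW r0) ai).
    rewrite -[a^-1](powR_inv1 (ltW a0)) -powRrM mulN1r.
    apply: ler_wpM2r; first by rewrite mulr_ge0 ?powR_ge0.
    rewrite -[leRHS]powRr1 //; apply: ler_powR; lra.
  have N2E : N2 * r `^ 2 = r `^ 2^-1 * a `^ (- 2^-1).
    rewrite /N2 fE -mulrA -powRD ?(lt0r_neq0 r0) ?implybT // mulrC.
    by congr (_ `^ _ * _); lra.
  apply: (@le_trans _ _ ((2 * p) `^ p * (4 * (N2 * r `^ 2)))).
    by apply: ler_wpM2l; [exact: ltW|rewrite N2E].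
  move: (_ `^ p) K0 (r `^ 2) r20 N10 N20 N30 => X X0 Y Y0; clear -X0 Y0 => h1 h2 h3.
  rewrite (_ : X * _ = 4 * X * N2 * Y); last by ring.
  apply: ler_wpM2r; first exact: ltW.
  by apply: ler_wpM2l; lra.
rewrite ger0_norm; last by rewrite ln_ge0 // ler_pdivlMr ?mul1r ?ltW.
have t1 : 1 <= a / b by rewrite ler_pdivlMr ?mul1r ?ltW.
apply: (le_trans (ln_powR_le p1 t1)).
have wb : `|y - c| <= b by rewrite /b lerDl ltW.
have nE : near_pw c a (- 2^-1) y = `|y - c| `^ (- 2^-1).
  by rewrite /near_pw w0 (le_trans wb (ltW h)).
have h4 : (a / b) `^ 2^-1 <= 4 * (N3 * r `^ 2).
  apply: (@le_trans _ _ ((a / `|y - c|) `^ 2^-1)).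
    apply: powR_le => //; first by rewrite divr_ge0 ?ltW.
    by apply: ler_wpM2l; [exact: ltW|rewrite lef_pV2 ?posrE].
  rewrite (powRM _ (ltW a0)) ?invr_ge0 //.
  rewrite -[`|y - c|^-1](powR_inv1 (ltW w0)) -powRrM mulN1r /N3 nE.
  have -> : a `^ 2^-1 = a `^ (- (3 / 2)) * a `^ 2.
    by rewrite -powRD ?(lt0r_neq0 a0) ?implybT //; congr (_ `^ _); lra.
  rewrite -mulrA [X in _ * X]mulrC -!mulrA [leRHS]mulrCA; apply: ler_wpM2l; first exact: powR_ge0.
  rewrite [leRHS]mulrCA; apply: ler_wpM2l; first exact: powR_ge0.
  by rewrite (@powR_mulrn _ a 2 (ltW a0)) (@powR_mulrn _ r 2 (ltW r0)) !expr2; nra.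
move: (_ `^ p) K0 (r `^ 2) r20 N10 N20 N30 h4 => X X0 Y Y0 h1 h2 h3 h4.
apply: (@le_trans _ _ (X * (4 * (N3 * Y)))); first by apply: ler_wpM2l => //; exact: ltW.
rewrite (_ : X * _ = 4 * X * N3 * Y); last by ring.
apply: ler_wpM2r; first exact: ltW.
by apply: ler_wpM2l; lra.
Qed.

End LogEnergy.

(** * Energy of a function that is Lipschitz in a logarithm *)

Section LogEnergyIntegral.
Variable R : realType.
Local Notation mu := (@lebesgue_measure R).
Local Notation I01 := (`[0%R, 1%R]%classic : set R).

Lemma int_inv_dist (c eps : R) : 0 < eps -> 0 <= c <= 1 ->
  (\int[mu]_(x in I01 `\ c) ((`|x - c| + eps)^-1)%:E <= (2 * (ln (1 + eps) - ln eps))%:E)%E.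
Proof.
move=> e0 /andP[c0 c1].
pose D := [set x : R | 0 < `|x - c| <= 1].
have nat_lt (n : nat) : 0 < (n.+1%:R : R) by rewrite ltr0n.
have [| | | | | | |_ _ H] := @int_shell_le R (fun t => (t + eps)^-1) (fun t => ln (t + eps)) c
    (fun n => n.+1%:R^-1) (fun=> 1) (ln (1 + eps) - ln eps) D.
- by move=> n; rewrite invr_gt0.
- by move=> n; rewrite invf_le1 // ler1n.
- by move=> n; rewrite lef_pV2 ?posrE // ler_nat.
- by [].
- move=> t t0; have te : 0 < t + eps by rewrite addr_gt0.
  have te0 : t + eps != 0 by exact: lt0r_neq0.
  have hd := is_deriveD (is_derive_id t (1 : R)) (is_derive_cst eps t (1 : R)).
  split; first by rewrite invr_ge0 ltW.
  + apply: (is_derive_subst (@is_derive1_comp R (@ln R) (fun x => x + eps) t _ _ (is_derive1_ln te) hd)).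
    by rewrite addr0 mulr1.
  + apply: (@continuous_comp _ _ _ (fun y : R => y + eps) (fun z => z^-1)).
      by apply: cvgD; [exact: cvg_id|exact: cvg_cst].
    exact: inv_continuous.
- move=> n; rewrite lerD2l lerN2 ler_ln ?posrE ?addr_gt0 ?invr_gt0 //.
  by rewrite lerDr invr_ge0 ltW.
- move=> y; split=> [/andP[h1 h2]|[n /andP[h1 h2]]].
    have [n nE] : exists n : nat, `|y - c|^-1 <= n%:R.
      exists (Num.truncn `|y - c|^-1).+1; apply: ltW.
      have iy : 0 <= `|y - c|^-1 by rewrite invr_ge0.
      by have /andP[] := truncn_itv iy.
    exists n; rewrite h2 andbT -[leRHS]invrK lef_pV2 ?posrE ?invr_gt0 //.
    by apply: (le_trans nE); rewrite ler_nat.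
  by rewrite /D /= h2 andbT; apply: lt_le_trans h1; rewrite invr_gt0.
apply: le_trans H; apply: le_int_mono => [x _|x [/= + xc]].
  by rewrite lee_fin invr_ge0 addr_ge0 // ltW.
rewrite in_itv /= => /andP[x0 x1]; rewrite /D /= normr_gt0 subr_eq0.
apply/andP; split; first by apply/eqP.
by rewrite ler_norml; apply/andP; split; lra.
Qed.

(** The terms 2/(p - 1) and 12 = 8 + 4 come from the three integrals in y, the last factor 2 from
    the integral in x. *)
Definition log_cst (p : R) : R := 4 * (2 * p) `^ p * (2 / (p - 1) + 12) * 2.

(** Each term of the kernel bound, integrated in y, is of degree -1 in a = |x - c| + eps, and 1/a
    integrates to a logarithm. The constant m trades the circle distance for |x - y| where v takes
    different values. *)
Lemma log_energy (p eps c k m : R) (v : R -> R) : 1 < p -> 0 < eps -> 0 < m -> 0 <= k ->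
  0 <= c <= 1 -> measurable_fun I01 v ->
  (forall x y, I01 x -> I01 y ->
     `|v x - v y| <= k * `|ln ((`|x - c| + eps) / (`|y - c| + eps))|) ->
  (forall x y, I01 x -> I01 y -> v x != v y -> m * `|x - y| <= cdist x y) ->
  (gagliardo p^-1 p (fun x => (0%R : R, v x))
    <= (log_cst p * (k `^ p / m ^+ 2) * (ln (1 + eps) - ln eps))%:E)%E.
Proof.
move=> p1 e0 m0 k0 c01 mv Hk Hm; have p0 : 0 < p by lra.
have pn : p != 0 by exact: lt0r_neq0.
pose h x := (0 : R, v x).
have mh : meas2 h by split=> //; exact: measurable_cst.
have mI : measurable I01 by exact: measurable_itv.
have mJ : measurable (I01 `\ c) by apply: measurableD => //; exact: measurable_set1.
have JI : I01 `\ c `<=` I01 by move=> x [].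
pose X := k `^ p / m ^+ 2 * (4 * (2 * p) `^ p).
have X0 : 0 <= X by rewrite !mulr_ge0 ?powR_ge0 // invr_ge0 exprn_ge0 // ltW.
pose K := 2 / (p - 1) + 12.
have K0 : 0 <= K by rewrite /K addr_ge0 // divr_ge0 // subr_ge0 ltW.
have gE : gagliardo p^-1 p h = (\int[mu]_(x in I01) \int[mu]_(y in I01) (gk p^-1 p h x y)%:E)%E by [].
(* The point c has measure 0 and is removed from both domains: the kernel bound requires y != c, and
   the last integral is computed on shells around c. *)
rewrite -/h gE -(integral_setD1 mJ); last by apply: (measurable_funS mI JI); exact: inner_meas.
apply: (@le_trans _ _ (\int[mu]_(x in I01 `\ c) (X * K * (`|x - c| + eps)^-1)%:E)%E); last first.
  have XK0 : 0 <= X * K by exact: mulr_ge0.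
  under eq_integral do rewrite EFinM.
  rewrite ge0_integralZl_EFin //; first last.
  - apply/measurable_EFinP; apply: continuous_measurable => // x.
    apply: (@continuous_comp _ _ _ (fun y : R => `|y - c| + eps) (fun z => z^-1)).
      apply: cvgD; last exact: cvg_cst.
      by apply: cvg_norm; apply: cvgB; [exact: cvg_id|exact: cvg_cst].
    by apply: inv_continuous; rewrite lt0r_neq0 // ltr_wpDl.
  - by move=> x _; rewrite lee_fin invr_ge0 addr_ge0 // ltW.
  apply: (@le_trans _ _ ((X * K)%:E * (2 * (ln (1 + eps) - ln eps))%:E)%E).
    by apply: lee_wpmul2l; [rewrite lee_fin|exact: int_inv_dist].
  by rewrite -EFinM lee_fin le_eqVlt /log_cst /X /K; apply/orP; left; apply/eqP; ring.
apply: le_int => x [Ix /= xc].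
  by apply: integral_ge0 => y _; rewrite lee_fin gk_ge0.
set a := `|x - c| + eps; have a0 : 0 < a by rewrite /a ltr_wpDl.
rewrite -(integral_setD1 mJ); last first.
  by apply: (measurable_funS mI JI); apply/measurable_EFinP; exact: ymeas.
apply: (@le_trans _ _ (\int[mu]_(y in I01 `\ c) (X * (a `^ (- p) * near_pw x (a / 2) (p - 2) y +
   (a `^ (- 2^-1) * far_pw x (a / 2) (- 1 - 2^-1) y +
    a `^ (- (3 / 2)) * near_pw c a (- 2^-1) y)))%:E)%E).
  apply: le_int => y [Iy /= yc]; rewrite lee_fin ?gk_ge0 //.
  have [vE|vxy] := eqVneq (v x) (v y).
    rewrite /gk /h /= vE !subrr /en /= expr0n addr0 sqrtr0 powR0 // mul0r.
    by rewrite mulr_ge0 // !addr_ge0 // mulr_ge0 ?powR_ge0 ?near_pw_ge0 ?far_pw_ge0.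
  have xy : x != y by apply: contra vxy => /eqP ->.
  have ycb : y != c by apply/eqP.
  have LK := log_kernel p1 e0 ycb xy (erefl a).
  have r0 : 0 < `|x - y| by rewrite normr_gt0 subr_eq0.
  have mr : m * `|x - y| <= cdist x y by exact: Hm.
  rewrite /gk /h /= subrr /en /= expr0n add0r sqrtr_sqr mulVf //.
  set L := `|ln _| in LK.
  have h1 : `|v x - v y| `^ p <= k `^ p * L `^ p.
    by rewrite -powRM ?normr_ge0 //; apply: powR_le => //; [exact: ltW|exact: Hk].
  have h2 : (cdist x y `^ (1 + 1))^-1 <= (m ^+ 2)^-1 * (`|x - y| `^ 2)^-1.
    rewrite -invfM lef_pV2 ?posrE ?mulr_gt0 ?powR_gt0 ?exprn_gt0 //; first last.
      by apply: lt_le_trans mr; rewrite mulr_gt0.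
    rewrite -(powR_mulrn 2 (ltW m0)) -powRM ?(ltW m0) // (_ : 1 + 1 = 2) //.
    by apply: powR_le => //; rewrite mulr_ge0 // ltW.
  apply: (@le_trans _ _ (k `^ p * L `^ p * ((m ^+ 2)^-1 * (`|x - y| `^ 2)^-1))).
    by apply: ler_pM => //; rewrite ?powR_ge0 // invr_ge0 powR_ge0.
  rewrite (_ : _ * _ * _ = k `^ p / m ^+ 2 * (L `^ p / `|x - y| `^ 2)); last by ring.
  rewrite /X -[leRHS]mulrA; apply: ler_wpM2l LK.
  by rewrite divr_ge0 ?powR_ge0 // exprn_ge0 // ltW.
have a2 : 0 < a / 2 by lra.
have q1 : -1 < p - 2 by lra.
have q3 : -1 < - 2^-1 :> R by lra.
have q2 : 0 < 2^-1 :> R by lra.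
have HI := int_comb3_le mJ X0 (powR_ge0 a (- p)) (powR_ge0 a (- 2^-1)) (powR_ge0 a (- (3 / 2)))
  (near_pw_ge0 x (a / 2) (p - 2)) (far_pw_ge0 x (a / 2) (- 1 - 2^-1)) (near_pw_ge0 c a (- 2^-1))
  (near_pw_meas x q1 a2) (far_pw_meas x q2 a2) (near_pw_meas c q3 a0)
  (int_near_pw x _ q1 a2) (int_far_pw x _ q2 a2) (int_near_pw c _ q3 a0).
apply: (le_trans HI); rewrite lee_fin -mulrA; apply: ler_wpM2l => //.
have t1 : a `^ (- p) * (2 * ((a / 2) `^ (p - 2 + 1) / (p - 2 + 1))) <= 2 / (p - 1) * a^-1.
  rewrite (_ : p - 2 + 1 = p - 1); last by ring.
  have : a `^ (- p) * (a / 2) `^ (p - 1) <= a^-1.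
    have -> : a^-1 = a `^ (- p) * a `^ (p - 1).
      rewrite -powRD ?(lt0r_neq0 a0) ?implybT // -(powR_inv1 (ltW a0)); congr (_ `^ _); lra.
    apply: ler_wpM2l; first exact: powR_ge0.
    by apply: powR_le; lra.
  move=> h1; have p10 : 0 <= 2 / (p - 1) by rewrite divr_ge0 // subr_ge0 ltW.
  by have := ler_wpM2l p10 h1; apply: le_trans; rewrite le_eqVlt; apply/orP; left; apply/eqP; ring.
have t2 : a `^ (- 2^-1) * (2 * ((a / 2) `^ (- 2^-1) / 2^-1)) <= 8 * a^-1.
  have : a `^ (- 2^-1) * (a / 2) `^ (- 2^-1) <= 2 * a^-1.
    have -> : a^-1 = a `^ (- 2^-1) * a `^ (- 2^-1).
      rewrite -powRD ?(lt0r_neq0 a0) ?implybT // -(powR_inv1 (ltW a0)); congr (_ `^ _); lra.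
    rewrite mulrCA; apply: ler_wpM2l; first exact: powR_ge0.
    rewrite powRM ?(ltW a0) // mulrC; apply: ler_wpM2r; first exact: powR_ge0.
    have E2 : (2^-1 : R) = 2 `^ (-1) by rewrite powR_inv1.
    rewrite {1}E2 -powRrM -[leRHS]powRr1 //; apply: ler_powR; first by rewrite ler1n.
    by lra.
  by rewrite invrK; lra.
have t3 : a `^ (- (3 / 2)) * (2 * (a `^ (- 2^-1 + 1) / (- 2^-1 + 1))) <= 4 * a^-1.
  have h1 : a `^ (- (3 / 2)) * a `^ (- 2^-1 + 1) = a^-1.
    by rewrite -powRD ?(lt0r_neq0 a0) ?implybT // -(powR_inv1 (ltW a0)); congr (_ `^ _); lra.
  rewrite -h1 le_eqVlt; apply/orP; left; apply/eqP.
  have q : - 2^-1 + 1 = 2^-1 :> R by lra.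
  by rewrite q invrK; ring.
by rewrite /K mulrDl; lra.
Qed.

End LogEnergyIntegral.

(** * The logarithmic density *)

Section LogProfile.
Variable R : realType.
Local Notation mu := (@lebesgue_measure R).
Local Notation I01 := (`[0%R, 1%R]%classic : set R).

Lemma has_drv_exp : has_drv (@expR R) (@expR R).
Proof. by split=> x; exact: is_derive_expR. Qed.

Lemma has_drv_sin : has_drv (@sin R) (@cos R).
Proof. by split=> x; exact: is_derive_sin. Qed.

Lemma sin_lip (x y : R) : `|sin x - sin y| <= `|x - y|.
Proof.
wlog xy : x y / y <= x.
  by move=> W; case/orP: (le_total y x) => [/W//|/W]; rewrite distrC [leRHS]distrC.
have [c _ ->] := has_drv_MVT has_drv_sin xy.
by rewrite normrM ler_piMl // ler_norml cos_geN1 cos_le1.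
Qed.

(* Substitute s + eps = exp z. *)
Lemma log_var_le (B b : R -> R) (K eps x y : R) : has_drv B b -> 0 < eps -> 0 <= x -> x <= y ->
  (forall s, x <= s <= y -> b s * (s + eps) <= K) ->
  B y - B x <= K * (ln (y + eps) - ln (x + eps)).
Proof.
move=> hB e0 x0 xy HK.
have xe : 0 < x + eps by rewrite ltr_wpDl.
have ye : 0 < y + eps by rewrite ltr_wpDl // (le_trans x0).
have h := has_drv_comp hB (has_drvD has_drv_exp (has_drv_cst (- eps))).
have l : ln (x + eps) <= ln (y + eps) by rewrite ler_ln ?posrE // lerD2r.
have [c /andP[c1 c2]] := has_drv_MVT h l.
rewrite !lnK ?posrE // !addrK => ->; apply: ler_wpM2r; first by rewrite subr_ge0.
rewrite addr0 -[X in _ * X <= _](subrK eps); apply: HK.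
have : x + eps <= expR c by rewrite -[leLHS]lnK ?posrE // ler_expR.
have : expR c <= y + eps by rewrite -[leRHS]lnK ?posrE // ler_expR.
by move=> *; apply/andP; split; lra.
Qed.

Lemma log_var_ge (B b : R -> R) (K eps x y : R) : has_drv B b -> 0 < eps -> 0 <= x -> x <= y ->
  (forall s, x <= s <= y -> K <= b s * (s + eps)) ->
  K * (ln (y + eps) - ln (x + eps)) <= B y - B x.
Proof.
move=> hB e0 x0 xy HK.
have := log_var_le (K := - K) (has_drvN hB) e0 x0 xy.
rewrite mulNr => H; suff : - B y - - B x <= - (K * (ln (y + eps) - ln (x + eps))) by lra.
by apply: H => s /HK; rewrite mulNr lerN2.
Qed.

(** The power X^(-1/2) for X > 0, in a form whose smoothness follows by composition. *)
Definition invsqrt (X : R) : R := expR (- ln X / 2).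

Lemma invsqrt_le (q X : R) : 0 < q -> q ^+ 2 <= X -> invsqrt X <= q^-1.
Proof.
move=> q0 qX; have q20 : 0 < q ^+ 2 by rewrite exprn_gt0.
have : ln (q ^+ 2) <= ln X by rewrite ler_ln ?posrE // (lt_le_trans q20).
rewrite lnXn // -mulr_natl => h.
by rewrite /invsqrt -[q^-1]lnK ?posrE ?invr_gt0 // ler_expR lnV ?posrE //; lra.
Qed.

Lemma invsqrt_ge (q X : R) : 0 < q -> 0 < X -> X <= q ^+ 2 -> q^-1 <= invsqrt X.
Proof.
move=> q0 X0 qX; have q20 : 0 < q ^+ 2 by rewrite exprn_gt0.
have : ln X <= ln (q ^+ 2) by rewrite ler_ln ?posrE.
rewrite lnXn // -mulr_natl => h.
by rewrite /invsqrt -[q^-1]lnK ?posrE ?invr_gt0 // ler_expR lnV ?posrE //; lra.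
Qed.

(* Comparable to (|x - 1/2| + eps)^-1 near 1/2 and vanishing near the integers. *)
Definition log_density (eps x : R) : R :=
  bump 1 (1 / 2) (3 / 8) x * invsqrt (cos (pi * x) ^+ 2 + eps ^+ 2).

Lemma log_density_smooth eps : 0 < eps -> smooth_fun (log_density eps).
Proof.
move=> e0; apply: smoothM; first exact: bump_smooth.
have X0 x : 0 < cos (pi * x) ^+ 2 + eps ^+ 2 :> R by rewrite ltr_wpDl ?sqr_ge0 // exprn_gt0.
apply: (smooth_comp (@smooth_expR R)).
apply: smoothM; last exact: smooth_cst.
apply: smoothN; apply: smooth_ln => //.
apply: smoothD; last exact: smooth_cst.
have sc : smooth_fun (fun x : R => cos (pi * x)).
  by apply: (smooth_comp (@smooth_cos R)); apply: smoothM; [exact: smooth_cst|exact: smooth_id].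
exact: (smoothM sc sc).
Qed.

Lemma log_density_periodic eps : periodic1 (log_density eps).
Proof.
move=> x; rewrite /log_density (@bump_periodic R 1 (1 / 2) (3 / 8) x).
by rewrite mulrDr mulr1 cosDpi sqrrN.
Qed.

(** This symmetry about 1/2 gives [dl (1 - x) = pi - dl x], so that the sine of the angle is even
    about its peak. *)
Lemma log_density_sym eps x : log_density eps (1 - x) = log_density eps x.
Proof.
have E1 : bump 1 (1 / 2) (3 / 8) (1 - x) = bump 1 (1 / 2) (3 / 8) x.
  by rewrite /bump -cosN (_ : - (2 * pi * (1 - x - 1 / 2)) = 2 * pi * (x - 1 / 2)) //; field.
have E2 : cos (pi * (1 - x)) = - cos (pi * x).
  by rewrite (_ : pi * (1 - x) = - (pi * x) + pi) ?cosDpi ?cosN //; ring.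
by rewrite /log_density E1 E2 sqrrN.
Qed.

(** At distance s from 1/2 the squared cosine is sin(pi s)^2, comparable to s^2 for s <= 3/8; beyond
    that the bump vanishes. The lower bound stops at 1/4, where the bump is still bounded away from
    0. *)
Lemma log_density_bounds : exists k K : R, [/\ 0 < k, 0 < K & forall eps, 0 < eps ->
  [/\ forall x, 0 <= log_density eps x,
   forall s, 0 <= s <= 1 / 2 -> log_density eps (1 / 2 + s) * (s + eps) <= K &
   forall s, 0 <= s <= 1 / 4 -> k <= log_density eps (1 / 2 + s) * (s + eps)]].
Proof.
have p0 := pi_gt0 R; have p4 : pi <= 4 :> R by have := @pihalf_lt2 R; rewrite ltr_pdivrMr //; lra.
have p1 : 1 <= pi :> R by have := @pi_ge2 R; lra.
(* The least slope of the sine on [0, 3 pi / 8]. *)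
pose k0 : R := cos (pi * (3 / 8)).
have k00 : 0 < k0 by rewrite /k0; apply: cos_gt0_pihalf; apply/andP; split; lra.
have k01 : k0 <= 1 by exact: cos_le1.
have sin_ge (s : R) : 0 <= s <= 3 / 8 -> k0 * s <= sin (pi * s).
  move=> /andP[s0 s1]; have ps : 0 <= pi * s by rewrite mulr_ge0 // ltW.
  have [c /andP[c1 c2]] := has_drv_MVT has_drv_sin ps.
  rewrite sin0 !subr0 => ->.
  have kc : k0 <= cos c.
    have c3 : c <= pi * (3 / 8) by apply: (le_trans c2); apply: ler_wpM2l => //; exact: ltW.
    rewrite /k0 leNgt ltr_cos -?leNgt // in_itv /=; apply/andP; split; lra.
  apply: (@le_trans _ _ (k0 * (pi * s))); last exact: ler_wpM2r.
  by apply: ler_wpM2l; [exact: ltW|nra].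
have sin_le (s : R) : 0 <= s -> `|sin (pi * s)| <= 4 * s.
  move=> s0; have := sin_lip (pi * s) 0; rewrite sin0 !subr0 => h.
  by apply: (le_trans h); rewrite ger0_norm ?mulr_ge0 ?(ltW p0) //; nra.
have cosE (s : R) : cos (pi * (1 / 2 + s)) ^+ 2 = sin (pi * s) ^+ 2 :> R.
  by rewrite mulrDr mul1r addrC cosDpihalf sqrrN.
(* The argument of the bump at distance 1/4 from its centre, where the first cosine is 0. *)
pose g : R := - cos (2 * pi * (3 / 8)).
have g0 : 0 < g.
  have := @cos_gap_gt0 R (1 / 4) (3 / 8); rewrite /g (_ : 2 * pi * (1 / 4) = pi / 2); last by field.
  by rewrite cos_pihalf sub0r; apply; [lra|rewrite ger0_norm; lra].
exists (flatexp 0 g / 4), (2 / k0); split.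
- by rewrite divr_gt0 // flatexp_gt0.
- by rewrite divr_gt0.
move=> eps e0; split.
- by move=> x; rewrite mulr_ge0 ?bump_ge0 // expR_ge0.
- move=> s /andP[s0 s1]; have se : 0 < s + eps by lra.
  have [s2|s2] := leP s (3 / 8); last first.
    rewrite /log_density /bump flatexp_le0E ?mul0r ?divr_ge0 ?(ltW k00) // mul1r.
    apply: cos_gap_le0; first by lra.
      by rewrite ger0_norm; lra.
    by rewrite ger0_norm; lra.
  have h1 : invsqrt (sin (pi * s) ^+ 2 + eps ^+ 2) <= (k0 * (s + eps) / 2)^-1.
    apply: invsqrt_le; first by rewrite divr_gt0 // mulr_gt0.
    have hs : k0 * s <= sin (pi * s) by apply: sin_ge; rewrite s0.
    have ks : 0 <= k0 * s by rewrite mulr_ge0 // ltW.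
    have h2 : (k0 * s) ^+ 2 <= sin (pi * s) ^+ 2.
      by rewrite ler_pXn2r // nnegrE // (le_trans ks).
    have h3 : (k0 * eps) ^+ 2 <= eps ^+ 2.
      by rewrite ler_pXn2r ?nnegrE ?mulr_ge0 ?(ltW k00) ?(ltW e0) // ler_piMl // ltW.
    have h4 : (k0 * (s + eps) / 2) ^+ 2 <= (k0 * s) ^+ 2 + (k0 * eps) ^+ 2.
      have : 0 <= (k0 * s - k0 * eps) ^+ 2 by rewrite sqr_ge0.
      have : 0 <= (k0 * s + k0 * eps) ^+ 2 by rewrite sqr_ge0.
      by rewrite mulrDr; move: (k0 * s) (k0 * eps) => u v; rewrite !expr2; lra.
    by apply: (le_trans h4); exact: lerD.
  rewrite /log_density cosE; have hb := @bump_le1 R 1 (1 / 2) (3 / 8) (1 / 2 + s).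
  have E : (k0 * (s + eps) / 2)^-1 * (s + eps) = 2 / k0.
    by field; rewrite !lt0r_neq0.
  rewrite -E; apply: ler_wpM2r; first exact: ltW.
  apply: le_trans h1; rewrite ler_piMl // ?expR_ge0 //.
- move=> s /andP[s0 s1]; have se : 0 < s + eps by lra.
  have h1 : (4 * (s + eps))^-1 <= invsqrt (sin (pi * s) ^+ 2 + eps ^+ 2).
    apply: invsqrt_ge; first by lra.
      by rewrite ltr_wpDl ?sqr_ge0 // exprn_gt0.
    have : sin (pi * s) ^+ 2 <= (4 * s) ^+ 2.
      by rewrite -[leLHS]real_normK ?num_real // ler_pXn2r ?nnegrE //; [exact: sin_le|lra].
    by rewrite !expr2; nra.
  have h2 : flatexp 0 g <= bump 1 (1 / 2) (3 / 8) (1 / 2 + s).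
    have cs : 0 <= cos (2 * pi * (1 / 2 + s - 1 / 2)).
      by apply: cos_ge0_pihalf; apply/andP; split; nra.
    rewrite /bump mul1r; set G := _ - _.
    have gG : g <= G by rewrite /G /g; lra.
    have G0 : 0 < G by lra.
    rewrite !flatexp_gt0E // !expr0 !mul1r ler_expR lerN2 lef_pV2 ?posrE //.
  rewrite /log_density cosE.
  have E : flatexp 0 g / 4 = flatexp 0 g * (4 * (s + eps))^-1 * (s + eps).
    by field; rewrite lt0r_neq0.
  rewrite E; apply: ler_wpM2r; first exact: ltW.
  by apply: ler_pM => //; [exact: flatexp_ge0|rewrite invr_ge0; lra].
Qed.

End LogProfile.

(** * One period of the sine of the logarithmic angle *)

Section FoldedProfile.
Variable R : realType.
Local Notation mu := (@lebesgue_measure R).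
Local Notation I01 := (`[0%R, 1%R]%classic : set R).

(* One period of [sin \o dl], centred at its peak; it is even because [dl (1 - x) = pi - dl x]. *)
Definition fold_sin (dl : R -> R) (r : R) : R :=
  if `|r| <= 1 / 2 then sin (dl (1 / 2 + r)) else 0.

Lemma log_angle : exists2 C : R, 0 < C & forall eps, 0 < eps ->
  exists dl : R -> R, [/\ smooth_fun dl, forall x, dl (x + 1) = dl x + pi,
    forall x, `|x| <= 8^-1 -> dl x = 0, forall x, dl (1 - x) = pi - dl x &
    forall r t, 0 <= r -> r <= t -> t <= 1 / 2 ->
      `|dl (1 / 2 + t) - dl (1 / 2 + r)| <=
        C / (ln (1 / 4 + eps) - ln eps) * (ln (t + eps) - ln (r + eps))].
Proof.
have [k [K [k0 K0 H]]] := log_density_bounds R; have p0 := pi_gt0 R.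
exists (pi * K / k); first by rewrite divr_gt0 // mulr_gt0.
move=> eps e0; have [b0 bK bk] := H eps e0.
have sb := log_density_smooth e0; have pb := @log_density_periodic R eps.
set b := log_density eps in b0 bK bk sb pb.
have [B [hB B0]] := primitive_ex (smooth_cont sb).
have mono x y : x <= y -> B x <= B y.
  move=> xy; have [c _ h] := has_drv_MVT hB xy.
  by rewrite -subr_ge0 h mulr_ge0 // subr_ge0.
have hBs : has_drv (fun s => B (1 / 2 + s)) (fun s => b (1 / 2 + s)).
  have h := has_drv_comp hB (has_drvD (has_drv_cst (1 / 2)) (has_drv_id R)).
  by split=> x; apply: (is_derive_subst (has_drvE h x)); rewrite add0r mulr1.
set L := ln (1 / 4 + eps) - ln eps.
have L0 : 0 < L by rewrite subr_gt0 ltr_ln ?posrE //; lra.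
have B1 : k * L <= B 1.
  have q : 0 <= 1 / 4 :> R by lra.
  have := log_var_ge hBs e0 (lexx 0) q bk; rewrite add0r addr0 -/L.
  have : B (1 / 2 + 1 / 4) <= B 1 by apply: mono; lra.
  have : B 0 <= B (1 / 2) by apply: mono; lra.
  by rewrite B0; lra.
have B10 : 0 < B 1 by apply: lt_le_trans B1; rewrite mulr_gt0.
have zb x : `|x| <= 8^-1 -> b x = 0.
  by move=> h; rewrite /b /log_density bump_half_zero // mul0r.
have [sdl pdl zdl] := angle_of_density sb pb hB B0 B10 zb.
exists (fun x => pi / B 1 * B x); split => //.
- have h1 := has_drv_comp hB (has_drvD (has_drv_cst 1) (has_drvN (has_drv_id R))).
  have h2 := has_drvD h1 hB.
  have h3 : has_drv (fun x => B (1 - x) + B x) (fun=> 0).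
    split=> y; apply: (is_derive_subst (has_drvE h2 y)).
    by rewrite add0r mulrN1 /b log_density_sym addNr.
  move=> x; have := has_drv0_cst h3 x 0; rewrite subr0 B0 addr0 => h.
  have -> : B (1 - x) = B 1 - B x by lra.
  by field; exact: lt0r_neq0.
- move=> r t r0 rt t1; rewrite -mulrBr normrM (ger0_norm (_ : 0 <= pi / B 1)); last first.
    by rewrite divr_ge0 // ltW.
  rewrite ger0_norm; last by rewrite subr_ge0; apply: mono; lra.
  have h : B (1 / 2 + t) - B (1 / 2 + r) <= K * (ln (t + eps) - ln (r + eps)).
    apply: (log_var_le hBs e0 r0 rt) => s /andP[s0 s1]; apply: bK; apply/andP; split; lra.
  have l0 : 0 <= ln (t + eps) - ln (r + eps) by rewrite subr_ge0 ler_ln ?posrE; lra.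
  apply: (@le_trans _ _ (pi / (k * L) * (K * (ln (t + eps) - ln (r + eps))))).
    apply: ler_pM => //.
    - by rewrite divr_ge0 // ltW.
    - by rewrite subr_ge0; apply: mono; lra.
    - by apply: ler_wpM2l; [exact: ltW|rewrite lef_pV2 ?posrE // mulr_gt0].
  rewrite le_eqVlt; apply/orP; left; apply/eqP; field.
  by rewrite !lt0r_neq0.
Qed.

Section Fold.
Variable dl : R -> R.
Hypotheses (sdl : smooth_fun dl) (pdl : forall x, dl (x + 1) = dl x + pi).
Hypotheses (zdl : forall x, `|x| <= 8^-1 -> dl x = 0) (ydl : forall x, dl (1 - x) = pi - dl x).

Lemma fold_sin_norm r : fold_sin dl r = fold_sin dl `|r|.
Proof.
rewrite /fold_sin normr_id; case: ifP => // _.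
case/orP: (le_total 0 r) => r0; first by rewrite ger0_norm.
rewrite ler0_norm // (_ : 1 / 2 - r = 1 - (1 / 2 + r)); last by field.
by rewrite ydl [pi - _]addrC sinDpi sinN opprK.
Qed.

Lemma fold_sin0 r : 3 / 8 <= `|r| -> fold_sin dl r = 0.
Proof.
rewrite fold_sin_norm /fold_sin normr_id => h; case: ifP => // h2.
rewrite (_ : 1 / 2 + `|r| = (`|r| - 1 / 2) + 1); last by field.
rewrite pdl zdl ?add0r ?sinpi // ler0_norm; first by lra.
by lra.
Qed.

Lemma fold_sin_meas (a b : R) : measurable_fun I01 (fun x => fold_sin dl (a * x - b)).
Proof.
have cs : continuous (fun x => sin (dl (1 / 2 + (a * x - b)))).
  apply: smooth_cont; apply: (smooth_comp (@smooth_sin R)); apply: (smooth_comp sdl).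
  apply: smoothD; first exact: smooth_cst.
  apply: smoothB; last exact: smooth_cst.
  by apply: smoothM; [exact: smooth_cst|exact: smooth_id].
have mI : measurable I01 by exact: measurable_itv.
apply: measurable_fun_if => //.
- apply: measurable_fun_ler; last exact: measurable_cst.
  apply: continuous_measurable => // x; apply: cvg_norm.
  by apply: cvgB; [apply: cvgM; [exact: cvg_cst|exact: cvg_id]|exact: cvg_cst].
- by apply: measurable_funS (continuous_measurable mI cs) => // x [].
Qed.

(** Consecutive pieces overlap only at integers, where they vanish, so the sum is exact at every
    point. The signs reflect that [dl] gains pi per period. *)
Lemma sin_sum n y : 0 <= y ->
  \sum_(j < n) (-1) ^+ j * fold_sin dl (y - (j%:R + 1 / 2)) = if y <= n%:R then sin (dl y) else 0.
Proof.
elim: n => [|n IH] y0.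
  rewrite big_ord0; case: ifP => // y1; have -> : y = 0 by apply/eqP; rewrite eq_le y0 y1.
  by rewrite zdl ?sin0 // normr0.
rewrite big_ord_recr /= IH // /fold_sin -[n.+1%:R]natr1 ler_norml.
have sh x : sin (dl (x + n%:R)) = (-1) ^+ n * sin (dl x).
  elim: {IH} n => [|m IH]; first by rewrite addr0 expr0 mul1r.
  by rewrite -[m.+1%:R]natr1 addrA pdl sinDpi IH exprS mulN1r mulNr.
have [h1|h1] := boolP (y <= n%:R); have [h2|h2] := boolP (y <= n%:R + 1).
- have [h3|_] := boolP (- (1 / 2) <= y - (n%:R + 1 / 2)); last by rewrite mulr0 addr0.
  have -> : y = n%:R by lra.
  rewrite (_ : 1 / 2 + (n%:R - (n%:R + 1 / 2)) = 0); last by field.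
  by rewrite (zdl (x := 0)) ?normr0 // sin0 if_same mulr0 addr0.
- by have := h2; lra.
- rewrite -ltNge in h1.
  have -> : (- (1 / 2) <= y - (n%:R + 1 / 2) <= 1 / 2) = true by apply/andP; split; lra.
  rewrite add0r (_ : 1 / 2 + (y - (n%:R + 1 / 2)) = y - n%:R); last by field.
  by rewrite -sh subrK.
- rewrite -ltNge in h2.
  have -> : (- (1 / 2) <= y - (n%:R + 1 / 2) <= 1 / 2) = false.
    by apply/negbTE; rewrite negb_and -!ltNge; apply/orP; right; lra.
  by rewrite mulr0 addr0.
Qed.

(** By evenness only |r| and |t| matter. When |t| exceeds 1/2 it is replaced by 1/2, where the sine
    is already 0, and monotonicity of the logarithm does the rest. *)
Lemma fold_sin_log (eps c r t : R) : 0 < eps -> 0 <= c ->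
  (forall r t, 0 <= r -> r <= t -> t <= 1 / 2 ->
      `|dl (1 / 2 + t) - dl (1 / 2 + r)| <= c * (ln (t + eps) - ln (r + eps))) ->
  `|fold_sin dl r - fold_sin dl t| <= c * `|ln ((`|r| + eps) / (`|t| + eps))|.
Proof.
move=> e0 c0 H.
wlog rt : r t / `|r| <= `|t|.
  move=> W; case/orP: (le_total `|r| `|t|) => [/W//|/W]; rewrite distrC => h.
  apply: (le_trans h); rewrite -[in leRHS]normrN -lnV ?invf_div //.
  by rewrite posrE divr_gt0 // ltr_wpDl.
have re : 0 < `|r| + eps by rewrite ltr_wpDl.
have te : 0 < `|t| + eps by rewrite ltr_wpDl.
have ll : ln (`|r| + eps) <= ln (`|t| + eps) by rewrite ler_ln ?posrE // lerD2r.
rewrite ln_div ?posrE // (ler0_norm (_ : ln (`|r| + eps) - ln (`|t| + eps) <= 0)) ?subr_le0 //.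
rewrite opprB.
rewrite (fold_sin_norm r) (fold_sin_norm t).
have key s : `|r| <= s -> s <= 1 / 2 -> s <= `|t| ->
    `|sin (dl (1 / 2 + `|r|)) - sin (dl (1 / 2 + s))| <= c * (ln (`|t| + eps) - ln (`|r| + eps)).
  move=> rs s2 st; apply: (le_trans (sin_lip _ _)); rewrite distrC.
  apply: (le_trans (H _ _ (normr_ge0 _) rs s2)); apply: ler_wpM2l => //.
  rewrite lerD2r ler_ln ?posrE // ?lerD2r //; have := normr_ge0 r; lra.
have [t2|t2] := leP `|t| (1 / 2).
  rewrite /fold_sin !normr_id t2 (le_trans rt t2).
  exact: key.
have -> : fold_sin dl `|t| = 0 by apply: fold_sin0; rewrite normr_id; lra.
have [r2|r2] := leP `|r| (1 / 2); last first.
  rewrite fold_sin0 ?normr_id; last by lra.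
  by rewrite subrr normr0 mulr_ge0 // subr_ge0.
rewrite /fold_sin normr_id r2.
have := key (1 / 2) r2 (lexx _) (ltW t2).
rewrite (_ : 1 / 2 + 1 / 2 = 0 + 1); last by field.
by rewrite pdl (zdl (x := 0)) ?normr0 // add0r sinpi.
Qed.

End Fold.
End FoldedProfile.

(** * Summing the pieces and letting eps tend to 0 *)

Section CriticalExponent.
Variable R : realType.
Local Notation mu := (@lebesgue_measure R).
Local Notation I01 := (`[0%R, 1%R]%classic : set R).

Definition vec2 (v : R -> R) (x : R) : R * R := (0, v x).

Lemma en_vec (z : R) : en (0, z) = `|z|.
Proof. by rewrite /en /= expr0n add0r sqrtr_sqr. Qed.

Lemma vec2_meas (v : R -> R) : measurable_fun I01 v -> meas2 (vec2 v).
Proof. by move=> mv; split => //; exact: measurable_cst. Qed.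

(** Each piece falls under [log_energy] with centre (j + 1/2)/n. The value m = 1/(8n) is the
    distance kept from the ends of [0,1] by the set where the piece is nonzero. *)
Lemma fold_energy (dl : R -> R) (p eps c a : R) (n j : nat) : smooth_fun dl ->
  (forall x, dl (x + 1) = dl x + pi) -> (forall x, `|x| <= 8^-1 -> dl x = 0) ->
  (forall x, dl (1 - x) = pi - dl x) ->
  (forall r t, 0 <= r -> r <= t -> t <= 1 / 2 ->
      `|dl (1 / 2 + t) - dl (1 / 2 + r)| <= c * (ln (t + eps) - ln (r + eps))) ->
  1 < p -> 0 < eps -> 0 <= c -> (j < n)%N -> `|a| <= 2 ->
  let w x := a * fold_sin dl (n%:R * x - (j%:R + 1 / 2)) in
  measurable_fun I01 w /\
  (gagliardo p^-1 p (vec2 w) <=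
    (log_cst p * ((2 * c) `^ p / (8 * n%:R)^-1 ^+ 2) * (ln (1 + eps / n%:R) - ln (eps / n%:R)))%:E)%E.
Proof.
move=> sdl pdl zdl ydl Hc p1 e0 c0 jn a2 w.
have jR : j%:R + 1 <= n%:R :> R by rewrite natr1 ler_nat.
have j0 : 0 <= j%:R :> R by [].
have n0 : 0 < n%:R :> R by lra.
have mw : measurable_fun I01 w.
  apply: measurable_funM; first exact: measurable_cst.
  exact: (fold_sin_meas sdl).
split => //; set m := (8 * n%:R)^-1.
have nm : n%:R * m = 8^-1 by rewrite /m; field; exact: lt0r_neq0.
have m0 : 0 < m by rewrite invr_gt0 mulr_gt0.
pose c1 : R := (j%:R + 1 / 2) / n%:R.
have nc : n%:R * c1 = j%:R + 1 / 2 by rewrite /c1; field; exact: lt0r_neq0.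
have c01 : 0 <= c1 <= 1.
  by rewrite /c1 ler_pdivrMr // mul1r divr_ge0 ?(ltW n0) /=; lra.
have c20 : 0 <= 2 * c by rewrite mulr_ge0.
apply: (log_energy p1 _ m0 c20 c01 mw); first by rewrite divr_gt0.
  move=> x y _ _; rewrite /w -mulrBr normrM -mulrA; apply: ler_pM => //.
  apply: (le_trans (fold_sin_log pdl zdl ydl _ _ e0 c0 Hc)); apply: ler_wpM2l => //.
  (* The factor n cancels in the quotient inside the logarithm, so rescaling only turns eps into eps
     / n. *)
  have E z : `|n%:R * z - (j%:R + 1 / 2)| + eps = n%:R * (`|z - c1| + eps / n%:R).
    rewrite -nc -mulrBr normrM (ger0_norm (ltW n0)) mulrDr; congr (_ + _).
    by field; exact: lt0r_neq0.
  by rewrite !E -mulf_div divff ?mul1r // lt0r_neq0.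
move=> x y; rewrite /= !in_itv /= => /andP[x0 x1] /andP[y0 y1] wxy.
have m1 : m <= 1 by have : 1 <= n%:R :> R by [lra]; nra.
have inside z : w z != 0 -> m <= z /\ z <= 1 - m.
  move=> wz; have : `|n%:R * z - (j%:R + 1 / 2)| < 3 / 8.
    rewrite ltNge; apply: contra wz => h; rewrite /w.
    by rewrite (fold_sin0 pdl zdl ydl h) mulr0.
  rewrite ltr_norml => /andP[z1 z2].
  have z3 : n%:R * m <= n%:R * z by rewrite nm; lra.
  have z4 : n%:R * z <= n%:R * (1 - m) by rewrite mulrBr nm; lra.
  by rewrite !ler_pM2l // in z3 z4.
(* One of the two values is nonzero, so its point is at least m away from both 0 and 1. *)
have d1 : `|x - y| <= 1 - m.
  have [wx|wx] := eqVneq (w x) 0; last first.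
    by have [? ?] := inside x wx; rewrite ler_norml; apply/andP; split; lra.
  have wy : w y != 0 by rewrite -wx eq_sym.
  by have [? ?] := inside y wy; rewrite ler_norml; apply/andP; split; lra.
have d0 : 0 <= `|x - y| by [].
rewrite /cdist le_min; apply/andP; split; nra.
Qed.

Lemma gagliardo0 (p : R) : 1 < p -> (gagliardo p^-1 p (fun=> (0%R : R, 0%R : R)) = 0)%E.
Proof.
move=> p1; have pn : p != 0 by apply: lt0r_neq0; lra.
rewrite /gagliardo integral0_eq // => x _; rewrite integral0_eq // => y _.
by rewrite /= subrr en_vec normr0 powR0 // mul0r.
Qed.

(** A quasi-triangle inequality, applied n times with zero as the middle term of [comb3]. Q depends
    on n and p, but neither on the functions nor on e. *)
Lemma gagliardo_sum (p : R) (n : nat) : 1 < p -> exists2 Q : R, 0 <= Q &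
  forall (w : nat -> R -> R) (e : R), 0 <= e ->
  (forall j, (j < n)%N -> measurable_fun I01 (w j) /\ (gagliardo p^-1 p (vec2 (w j)) <= e%:E)%E) ->
  measurable_fun I01 (fun x => \sum_(j < n) w j x) /\
  (gagliardo p^-1 p (vec2 (fun x => (\sum_(j < n) w j x)%R)) <= (Q * e)%:E)%E.
Proof.
move=> p1; have p1' := ltW p1; have sg : 0 < p^-1 by rewrite invr_gt0; lra.
have topE G : top_energy p^-1 p G = gagliardo p^-1 p G by rewrite /top_energy sg.
elim: n => [|n [Q Q0 IH]].
  exists 0 => // w e e0 _; split.
    rewrite (_ : (fun x => _) = (fun=> 0 : R)); first exact: measurable_cst.
    by apply/funext => x; rewrite big_ord0.
  rewrite mul0r (_ : vec2 _ = (fun=> (0 : R, 0 : R))) ?gagliardo0 //.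
  by apply/funext => x; rewrite /vec2 big_ord0.
exists (6 `^ p * (Q + 1)); first by rewrite mulr_ge0 ?powR_ge0 // addr_ge0.
move=> w e e0 H.
have [mS eS] := IH w e e0 (fun j jn => H j (ltnW jn)); have [mw ew] := H n (ltnSn n).
split.
  rewrite (_ : (fun x => _) = (fun x => \sum_(j < n) w j x + w n x)).
    exact: measurable_funD.
  by apply/funext => x; rewrite big_ord_recr.
have mz : meas2 (fun=> (0 : R, 0 : R)) by split; exact: measurable_cst.
have := top_energy_comb3 p^-1 p1' (vec2_meas mS) mz (vec2_meas mw).
rewrite !topE gagliardo0 // add0e.
rewrite (_ : comb3 _ _ _ = vec2 (fun x => \sum_(j < n.+1) w j x)); last first.
  by apply/funext => x; rewrite /comb3 /vec2 /= big_ord_recr /= !subr0 add0r.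
move=> h; apply: (le_trans h).
rewrite -mulrA EFinM; apply: lee_wpmul2l; first by rewrite lee_fin powR_ge0.
by rewrite mulrDl mul1r EFinD; exact: leeD.
Qed.

(** Since 1/p < 1, the norm is an L^p norm plus a seminorm. As v c is the mean, the Poincare
    inequality on an interval of length 1 bounds the L^p part by the same energy; hence the factor
    2. *)
Lemma Wnorm_centered_le (p E : R) (v : R -> R) (c : R) (h : R -> R * R) : 1 < p -> 0 <= E ->
  continuous v -> (\int[mu]_(x in I01) v x)%R = v c ->
  (forall x, I01 x -> h x = (0, v x - v c)) ->
  (gagliardo p^-1 p (vec2 v) <= E%:E)%E -> (Wnorm p^-1 p h <= (2 * E `^ p^-1)%:E)%E.
Proof.
move=> p1 E0 cv vc hE gE; have p0 : 0 < p by lra.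
have pn : p != 0 by exact: lt0r_neq0.
have i0 : 0 < p^-1 by rewrite invr_gt0.
have i1 : p^-1 < 1 by rewrite invf_lt1.
have k0 : sob_k p^-1 = 0%N.
  by rewrite /sob_k; apply/eqP; rewrite truncn_eq ?(ltW i0) //= ?i1.
have sE : sob_sigma p^-1 = p^-1 by rewrite /sob_sigma k0 subr0.
have mI : measurable I01 by exact: measurable_itv.
have mv : measurable_fun I01 v by exact: continuous_measurable.
have mh : meas2 h.
  split.
    by apply: (eq_measurable_fun (fun=> 0 : R)); [move=> x /set_mem Ix; rewrite hE|exact: measurable_cst].
  apply: (eq_measurable_fun (fun x => v x - v c)); first by move=> x /set_mem Ix; rewrite hE.
  by apply: measurable_funB => //; exact: measurable_cst.
have gh : (gagliardo p^-1 p h <= E%:E)%E.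
  apply: le_trans gE; apply: le_int => x Ix.
    by apply: integral_ge0 => y _; rewrite lee_fin gk_ge0.
  apply: le_int => y Iy; first by rewrite lee_fin gk_ge0.
  by rewrite lee_fin !hE //= opprB addrA subrK.
have moo : `]0%R, 1%R[%classic `<=` I01 by exact: subset_itv_oo_cc.
have iv : mu.-integrable `]0%R, 1%R[ (EFin \o v).
  by apply: integrableS (cont_integrable 0 1 cv) => //; exact: subset_itv_oo_cc.
have vc' : (\int[mu]_(x in `]0%R, 1%R[) v x)%R = v c.
  rewrite -vc /Rintegral; congr fine; rewrite [RHS]integral_itv_bndoo //.
  by apply/measurable_EFinP; exact: (measurable_funS mI moo).
have hv x y : `|v x - v y| <= en ((vec2 v x).1 - (vec2 v y).1, (vec2 v x).2 - (vec2 v y).2).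
  by rewrite /vec2 /= subrr en_vec.
have ph : (pint p h <= E%:E)%E.
  have := @poincare_Lp R p^-1 p 0 1 E (vec2 v) v i0 (ltW p1) (lexx 0) ltr01 (lexx 1)
    (vec2_meas mv) mv hv iv.
  rewrite vc' subr0 divr1 powR1 mul1r => H.
  rewrite /pint (_ : (\int[mu]_(x in I01) _)%E =
      (\int[mu]_(x in `]0%R, 1%R[) (`|v x - v c| `^ p)%:E)%E).
    apply: H; apply: le_trans gE.
    have moo' : measurable (`]0%R, 1%R[%classic : set R) by exact: measurable_itv.
    apply: (@le_trans _ _ (\int[mu]_(x in `]0%R, 1%R[)
        \int[mu]_(y in I01) (gk p^-1 p (vec2 v) x y)%:E)%E).
      apply: le_int => x Jx; first by apply: integral_ge0 => y _; rewrite lee_fin gk_ge0.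
      by apply: le_int_mono => // y _; rewrite lee_fin gk_ge0.
    apply: le_int_mono => // x _.
    by apply: integral_ge0 => y _; rewrite lee_fin gk_ge0.
  rewrite -[RHS](@integral_itv_bndoo _ 0 1 _ true false); last first.
    apply/measurable_EFinP; apply: (measurableT_comp (@measurable_powR R p)).
    apply: (measurableT_comp (normr_measurable (D := setT))).
    by apply: (measurable_funS mI moo); apply: measurable_funB => //; exact: measurable_cst.
  by apply: eq_integral => x /set_mem Ix; rewrite hE // en_vec.
have fine_root (X : \bar R) : (0 <= X)%E -> (X <= E%:E)%E -> (fine X) `^ p^-1 <= E `^ p^-1.
  case: X => [r| |] //; rewrite /= !lee_fin => r0 rE.
  by apply: powR_le => //; exact: ltW.
apply: ge_ereal_inf; exists (sob_norm_val p^-1 p (fun=> h))%:E.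
  exists (fun=> h); split => //; split => //; split.
    move=> j _; have [m1 m2] := mh; split => //; split => //.
    by apply: (le_lt_trans ph); rewrite ltry.
  split; first by move=> j; rewrite k0.
  by move=> _; rewrite sE; apply: (le_lt_trans gh); rewrite ltry.
rewrite lee_fin /sob_norm_val k0 sE i0 big_ord_recl big_ord0 addr0 mulrDl !mul1r.
apply: lerD; apply: fine_root => //.
  by apply: integral_ge0 => x _; rewrite lee_fin powR_ge0.
by apply: integral_ge0 => x _; apply: integral_ge0 => y _; rewrite lee_fin gk_ge0.
Qed.

(** For eps = exp(-N) the logarithm in the denominator is at least N/2 and the other one at most (n
    + 2) N. The product is at most A N^(1 - p), which is small for large N as p > 1. *)
Lemma log_ratio_decay (p C D eta : R) (n : nat) : 1 < p -> 0 < C -> 0 <= D -> 0 < eta -> (0 < n)%N ->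
  exists2 eps, 0 < eps &
    0 < ln (1 / 4 + eps) - ln eps /\
    0 <= D * ((2 * (C / (ln (1 / 4 + eps) - ln eps))) `^ p *
      (ln (1 + eps / n%:R) - ln (eps / n%:R))) <= eta.
Proof.
move=> p1 C0 D0 eta0 n0; have p0 : 0 < p by lra.
have nR : 1 <= n%:R :> R by rewrite ler1n.
have n0' : 0 < n%:R :> R by lra.
pose A := D * ((4 * C) `^ p * (n%:R + 2)).
have A0 : 0 <= A by rewrite !mulr_ge0 ?powR_ge0 // addr_ge0.
(* The second summand makes A N^(1 - p) <= eta; the 4 absorbs ln 4 <= 2, so that N - ln 4 >= N/2. *)
pose N := 4 + (A / eta) `^ (p - 1)^-1.
have N4 : 4 <= N by rewrite /N lerDl powR_ge0.
have p10 : 0 < p - 1 by lra.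
have NA : A <= eta * N `^ (p - 1).
  rewrite -ler_pdivrMl // mulrC.
  have q : 0 <= A / eta by rewrite divr_ge0 // ltW.
  have -> : A / eta = ((A / eta) `^ (p - 1)^-1) `^ (p - 1).
    by rewrite -powRrM mulVf ?powRr1 // lt0r_neq0.
  by apply: powR_le; [exact: ltW|exact: powR_ge0|rewrite /N lerDr].
exists (expR (- N)); first exact: expR_gt0.
have e0 := expR_gt0 (- N).
have e1 : expR (- N) <= 1 by rewrite expR_le1; lra.
set eps := expR (- N) in e0 e1 *.
have lne : ln eps = - N by rewrite expRK.
have L1 : N / 2 <= ln (1 / 4 + eps) - ln eps.
  have h : ln (1 / 4) <= ln (1 / 4 + eps) by rewrite ler_ln ?posrE ?addr_gt0 // lerDl ltW.
  have : ln (4 : R) <= 2.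
    rewrite (_ : 4 = 2 ^+ 2); last by rewrite expr2 -natrM.
    rewrite lnXn // mulr2n.
    have m1 : -1 < 1 :> R by lra.
    by have := le_ln1Dx m1; rewrite (_ : 1 + 1 = 2) //; lra.
  have h4 : ln (1 / 4) = - ln 4 :> R by rewrite div1r lnV ?posrE.
  by rewrite lne; lra.
have L0 : 0 < ln (1 / 4 + eps) - ln eps by lra.
split => //; set L := ln (1 / 4 + eps) - ln eps in L1 L0 *.
have M0 : 0 < eps / n%:R by rewrite divr_gt0.
have M1 : 0 <= ln (1 + eps / n%:R) - ln (eps / n%:R).
  by rewrite subr_ge0 ler_ln ?posrE ?addr_gt0 // lerDr.
have M2 : ln (1 + eps / n%:R) - ln (eps / n%:R) <= (n%:R + 2) * N.
  have h1 : ln (1 + eps / n%:R) <= eps / n%:R by apply: le_ln1Dx; lra.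
  have h2 : eps / n%:R <= 1 by rewrite ler_pdivrMr // mul1r; lra.
  have h3 : ln n%:R < n%:R :> R by exact: ln_sublinear.
  rewrite ln_div ?posrE // lne; nra.
have K1 : (2 * (C / L)) `^ p <= (4 * C) `^ p * N `^ (- p).
  rewrite -(mulN1r p) powRrM powR_inv1; last by lra.
  have N0 : 0 <= N^-1 by rewrite invr_ge0; lra.
  rewrite -powRM //; last by lra.
  apply: powR_le; [exact: ltW|by rewrite mulr_ge0 // divr_ge0 // ltW|].
  have hL : 1 / 2 <= N^-1 * L by rewrite [N^-1 * L]mulrC ler_pdivlMr; lra.
  have C4 : 0 <= 4 * C by lra.
  by have := ler_wpM2l C4 hL; rewrite [X in _ -> X <= _]mulrA ler_pdivrMr //; lra.
apply/andP; split; first by rewrite !mulr_ge0 // powR_ge0.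
apply: (@le_trans _ _ (D * ((4 * C) `^ p * N `^ (- p) * ((n%:R + 2) * N)))).
  by apply: ler_wpM2l => //; apply: ler_pM => //; exact: powR_ge0.
have N0 : 0 < N by lra.
have E : N `^ (- p) * N = (N `^ (p - 1))^-1.
  rewrite -powRN -[X in _ * X = _](powRr1 (ltW N0)) -powRD; last by rewrite (lt0r_neq0 N0) implybT.
  by congr (_ `^ _); ring.
rewrite (_ : D * _ = A * (N `^ (- p) * N)); last by rewrite /A; ring.
by rewrite E ler_pdivrMr ?powR_gt0.
Qed.

Lemma distW_critical_small (p eta : R) (d1 d2 : int) : 1 < p -> 0 < eta ->
  (distW p^-1 p d1 d2 <= eta%:E)%E.
Proof.
move=> p1 eta0; have p0 : 0 < p by lra.
have i0 : 0 <= p^-1 by rewrite invr_ge0 ltW.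
have p1' := ltW p1.
have [/eqP|n0] := posnP (absz (d1 - d2)).
  rewrite absz_eq0 subr_eq0 => /eqP ->; apply: (le_trans (distW_diag d2 i0 p1')).
  by rewrite lee_fin ltW.
set n := absz (d1 - d2) in n0.
have nR0 : 0 < n%:R :> R by rewrite ltr0n.
have [C C0 HC] := log_angle R.
have [Q Q0 HQ] := gagliardo_sum n p1.
have lc0 : 0 <= log_cst p.
  rewrite /log_cst !mulr_ge0 ?powR_ge0 // addr_ge0 // divr_ge0 // subr_ge0 //.
(* All factors independent of eps are collected, so that eps can be chosen before the angle is
   built. *)
pose D := Q * log_cst p * ((8 * n%:R)^-1 ^+ 2)^-1.
have m0 : 0 < (8 * n%:R)^-1 :> R by rewrite invr_gt0 mulr_gt0.
have m20 : 0 <= ((8 * n%:R)^-1 ^+ 2)^-1 :> R by rewrite invr_ge0 exprn_ge0 // ltW.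
have D0 : 0 <= D by apply: mulr_ge0 => //; exact: mulr_ge0.
(* An energy at most (eta / 2)^p gives a norm at most 2 (eta / 2) = eta. *)
have e20 : 0 < (eta / 2) `^ p by rewrite powR_gt0 // divr_gt0.
have [eps e0 [L0 /andP[Z0 Z1]]] := log_ratio_decay p1 C0 D0 e20 n0.
have [dl [sdl pdl zdl ydl ldl]] := HC eps e0.
set c := C / _ in ldl Z0 Z1.
have c0 : 0 <= c by rewrite divr_ge0 // ltW.
have [F [G [e [[sF dF] [sG dG] e1 FG]]]] := pair_exists sdl pdl zdl n0 erefl.
apply: (le_trans (distW_le i0 p1' sF dF sG dG)).
pose v x := 2 * (e * sin (dl (n%:R * x))).
have cv : continuous v.
  apply: smooth_cont; apply: smoothM; first exact: smooth_cst.
  apply: smoothM; first exact: smooth_cst.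
  apply: (smooth_comp (@smooth_sin R)); apply: (smooth_comp sdl).
  by apply: smoothM; [exact: smooth_cst|exact: smooth_id].
have [x0 [_ vx0 hE]] := Wsemi_centered cv FG.
pose w j x := 2 * e * (-1) ^+ j * fold_sin dl (n%:R * x - (j%:R + 1 / 2)).
pose q := log_cst p * ((2 * c) `^ p / (8 * n%:R)^-1 ^+ 2) *
  (ln (1 + eps / n%:R) - ln (eps / n%:R)).
have en0 : 0 < eps / n%:R by rewrite divr_gt0.
have q0 : 0 <= q.
  apply: mulr_ge0; last by rewrite subr_ge0 ler_ln ?posrE ?addr_gt0 // lerDr.
  by apply: mulr_ge0 => //; apply: mulr_ge0 => //; exact: powR_ge0.
have [|_ HS] := HQ w q q0.
  move=> j jn; apply: (fold_energy sdl pdl zdl ydl ldl p1 e0 c0 jn).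
  by rewrite !normrM e1 normrX normrN normr1 expr1n !mulr1 ger0_norm.
have vS x : I01 x -> v x = \sum_(j < n) w j x.
  rewrite /= in_itv /= => /andP[x1 x2]; have nx : 0 <= n%:R * x by rewrite mulr_ge0.
  have := sin_sum pdl zdl n nx.
  rewrite (_ : n%:R * x <= n%:R = true); last by rewrite ger_pMr.
  rewrite /v => <-; rewrite mulrA mulr_sumr; apply: eq_bigr => j _.
  by rewrite /w !mulrA.
have gv : (gagliardo p^-1 p (vec2 v) <= ((eta / 2) `^ p)%:E)%E.
  apply: (@le_trans _ _ (Q * q)%:E); last first.
    by rewrite lee_fin; apply: le_trans Z1; rewrite le_eqVlt /D /q; apply/orP; left; apply/eqP; ring.
  apply: le_trans HS; apply: le_int => x Ix.
    by apply: integral_ge0 => y _; rewrite lee_fin gk_ge0.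
  apply: le_int => y Iy; first by rewrite lee_fin gk_ge0.
  by rewrite lee_fin /vec2 /= !vS.
have := Wnorm_centered_le p1 (ltW e20) cv vx0 hE gv.
rewrite -powRrM mulfV ?lt0r_neq0 // powRr1; last by rewrite divr_ge0 // ltW.
by rewrite (_ : 2 * (eta / 2) = eta) //; field.
Qed.

Lemma distW_critical (p : R) (d1 d2 : int) : 1 < p -> distW p^-1 p d1 d2 = 0%E.
Proof.
move=> p1; apply/eqP; rewrite eq_le distW_ge0 andbT.
by apply/lee_addgt0Pr => eta eta0; rewrite add0e; exact: distW_critical_small.
Qed.

End CriticalExponent.

Theorem theorem1p3 (R : realType) :
  (forall p : R, 1 < p -> forall d1 d2 : int, distW (1 / p) p d1 d2 = 0%E) /\
  (forall s p : R, 0 < s -> 1 <= p -> 1 < s * p ->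
     exists C C' : R, 0 < C /\ 0 < C' /\
       forall d1 d2 : int,
         ((C' * powR (`|d1 - d2|%:~R) s)%:E <= distW s p d1 d2)%E /\
         (distW s p d1 d2 <= (C * powR (`|d1 - d2|%:~R) s)%:E)%E).
Proof.
split=> [p p1 d1 d2|s p s0 p1 sp]; first by rewrite div1r; exact: distW_critical.
have [C C0 HC] := distW_upper s0 p1.
exists C, (dist_cst s p `^ p^-1)^-1; split => //; split.
  by rewrite invr_gt0 powR_gt0 // dist_cst_gt0.
by move=> d1 d2; split; [exact: distW_lower|exact: HC].
Qed.
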